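(* There exists a constant $N_2$ depending only on $d_1$ and $K$ such that the following holds. Suppose, in addition to the standing assumptions of the context, that $\sigma^\alpha_k,b^\alpha_k,c^\alpha,f^\alpha$ are independent of $t$ and $\lambda\ge N_2$. Let $\tilde v(x)$ be the probabilistic solution (equivalently, the unique bounded viscosity solution) of $$\sup_{\alpha\in A}[L^{\alpha}u+f^{\alpha}]=0\quad\text{in }\mathbb R^{d},$$ and for $h>0$ let $\tilde v_h$ be the unique bounded solution of $$\sup_{\alpha\in A}[L^{\alpha}_hu+f^{\alpha}]=0\quad\text{in }\mathbb R^{d}.$$ Then $$|\tilde v-\tilde v_h|\le Nh^{1/2}\quad\text{in }\mathbb R^{d},$$ where $N$ depends only on $d,d_1$ and $K$.
   Context: Standing data and assumptions. $A$ is a separable metric space; $K\in[1,\infty)$, $\lambda\in[0,\infty)$ are constants; $d,d_1\ge1$ are integers; the index $k$ runs through $\pm1,\dots,\pm d_1$. Given are vectors $\ell_k\in\mathbb R^{d}$ and (in the time-independent case considered here) real-valued functions $\sigma^{\alpha}_k(x)$, $b^{\alpha}_k(x)$, $c^{\alpha}(x)$, $f^{\alpha}(x)$, $\alpha\in A$, $x\in\mathbb R^{d}$, continuous in $\alpha$, with $\ell_k=-\ell_{-k}$, $|\ell_k|\le K$, $\sigma^{\alpha}_k=\sigma^{\alpha}_{-k}$, $b^{\alpha}_k\ge0$, $c^{\alpha}\ge\lambda$. For every $\psi\in\{\sigma^{\alpha}_k,b^{\alpha}_k,c^{\alpha}-\lambda,f^{\alpha}\}$ and $x,y\in\mathbb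 R^{d}$: $|\psi(x)|\le K$ and $|\psi(x)-\psi(y)|\le K|x-y|$. Put $a^{\alpha}_k=\tfrac12(\sigma^{\alpha}_k)^2$. Notation. $D_{l}u=\sum_i u_{x^i}l^i$, $D^2_{l}u=\sum_{i,j}u_{x^ix^j}l^il^j$, $\delta_{h,l}u(x)=\frac{u(x+hl)-u(x)}{h}$, $\Delta_{h,l}u(x)=\frac{u(x+hl)-2u(x)+u(x-hl)}{h^2}$, and, with summation over $k=\pm1,\dots,\pm d_1$, $$L^{\alpha}u=\sum_k a^{\alpha}_kD^2_{\ell_k}u+\sum_k b^{\alpha}_kD_{\ell_k}u-c^{\alpha}u,\qquad L^{\alpha}_hu=\sum_k a^{\alpha}_k\Delta_{h,\ell_k}u+\sum_k b^{\alpha}_k\delta_{h,\ell_k}u-c^{\alpha}u.$$ The probabilistic solution is the value function of the infinite-horizon control problem for the diffusions with generators $L^\alpha$ and running reward $f^\alpha$. *)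

(* Defs.v *)
From HB Require Import structures.
From mathcomp Require Import all_boot all_order all_algebra.
From mathcomp Require Import all_classical all_reals all_analysis.
Set Implicit Arguments.
Unset Strict Implicit.
Unset Printing Implicit Defensive.
Import Order.TTheory GRing.Theory Num.Theory.
Import numFieldNormedType.Exports.
Local Open Scope classical_set_scope.
Local Open Scope ring_scope.

Definition separable (T : topologicalType) : Prop :=
  exists2 S : set T, countable S & dense S.

(* The library's norm on row vectors is the max norm; [enorm] is Euclidean. *)
Definition enorm (R : realType) (d : nat) (x : 'rV[R]_d) : R :=
  Num.sqrt (\sum_(i < d) x 0 i ^+ 2).

(* [(true, i)] and [(false, i)] encode the indices +(i+1) and -(i+1). *)
Definition signed_index (d1 : nat) : Type := (bool * 'I_d1)%type.

Definition opp_index (d1 : nat) (k : signed_index d1) : signed_index d1 := (~~ k.1, k.2).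

Definition bounded_lipschitz (R : realType) (d : nat) (K : R)
    (psi : 'rV[R]_d -> R) : Prop :=
  (forall x, `|psi x| <= K) /\
  (forall x y, `|psi x - psi y| <= K * enorm (x - y)).

Section Bellman.
Variables (R : realType) (d d1 : nat).
Implicit Types (u v phi : 'rV[R]_d -> R) (l x : 'rV[R]_d) (h : R).

Definition partial (i : 'I_d) u : 'rV[R]_d -> R :=
  fun x => 'D_(delta_mx 0 i) u x.

Definition C1 u : Prop :=
  continuous u /\
  forall i, (forall x, derivable u x (delta_mx 0 i)) /\ continuous (partial i u).

Definition C2 u : Prop := C1 u /\ forall i, C1 (partial i u).

Definition Dl l u x : R := \sum_(i < d) partial i u x * l 0 i.

Definition D2l l u x : R :=
  \sum_(i < d) \sum_(j < d) partial j (partial i u) x * l 0 i * l 0 j.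

Definition deltah h l u x : R := (u (x + h *: l) - u x) / h.

Definition Deltah h l u x : R :=
  (u (x + h *: l) - 2 * u x + u (x - h *: l)) / h ^+ 2.

Variable A : metricType R.

Record coefficients := Coefficients {
  ell : signed_index d1 -> 'rV[R]_d;
  sigma_coef : A -> signed_index d1 -> 'rV[R]_d -> R;
  b_coef : A -> signed_index d1 -> 'rV[R]_d -> R;
  c_coef : A -> 'rV[R]_d -> R;
  f_coef : A -> 'rV[R]_d -> R
}.

Record standing_assumptions (K lambda : R) (D : coefficients) : Prop := {
  ell_opp : forall k, ell D k = - ell D (opp_index k);
  ell_le : forall k, enorm (ell D k) <= K;
  sigma_opp : forall al k, sigma_coef D al k = sigma_coef D al (opp_index k);
  b_ge0 : forall al k x, 0 <= b_coef D al k x;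
  c_ge : forall al x, lambda <= c_coef D al x;
  sigma_continuous : forall k x, continuous (fun al : A => sigma_coef D al k x);
  b_continuous : forall k x, continuous (fun al : A => b_coef D al k x);
  c_continuous : forall x, continuous (fun al : A => c_coef D al x);
  f_continuous : forall x, continuous (fun al : A => f_coef D al x);
  sigma_bl : forall al k, bounded_lipschitz K (sigma_coef D al k);
  b_bl : forall al k, bounded_lipschitz K (b_coef D al k);
  c_bl : forall al, bounded_lipschitz K (fun x => c_coef D al x - lambda);
  f_bl : forall al, bounded_lipschitz K (f_coef D al)
}.

Variable D : coefficients.

Definition a_coef (al : A) (k : signed_index d1) x : R := 2^-1 * sigma_coef D al k x ^+ 2.

Definition L_op (al : A) u x : R :=
  \sum_(k : signed_index d1) a_coef al k x * D2l (ell D k) u x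
  + \sum_(k : signed_index d1) b_coef D al k x * Dl (ell D k) u x
  - c_coef D al x * u x.

Definition Lh_op h (al : A) u x : R :=
  \sum_(k : signed_index d1) a_coef al k x * Deltah h (ell D k) u x
  + \sum_(k : signed_index d1) b_coef D al k x * deltah h (ell D k) u x
  - c_coef D al x * u x.

(* The suprema are taken in the extended reals, where they always make sense;
   the real-valued [sup] of the library is 0 on empty or unbounded sets. *)
Definition bellman u x : \bar R :=
  ereal_sup [set (L_op al u x + f_coef D al x)%:E | al in [set: A]].

Definition bellmanh h u x : \bar R :=
  ereal_sup [set (Lh_op h al u x + f_coef D al x)%:E | al in [set: A]].

Definition viscosity_subsolution v : Prop :=
  forall phi x, C2 phi -> phi x = v x ->
    (\forall y \near x, v y <= phi y) -> (0 <= bellman phi x)%E.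

Definition viscosity_supersolution v : Prop :=
  forall phi x, C2 phi -> phi x = v x ->
    (\forall y \near x, phi y <= v y) -> (bellman phi x <= 0)%E.

Definition viscosity_solution v : Prop :=
  [/\ continuous v, viscosity_subsolution v & viscosity_supersolution v].

Definition fd_solution h u : Prop := forall x, bellmanh h u x = 0%E.

End Bellman.

(* Main.v *)
(**
The bound [v <= v_h + N h^(1/2)] is Krylov's.  Solving the scheme on
R^d x R with coefficients taken at [x + y e], [|e| <= 1], the discrete
Bernstein method applied to the sum of the squares of the negative parts of
the first differences bounds the Lipschitz constant of the solution [u] in
[(x, y)], uniformly in [h]: negative parts are what makes a supremum of linear
operators tractable.  So [u(., r)] is within [N r] of [v_h = u(., 0)], and its
translates by less than [r] are supersolutions of the unshaken linear
equations; averaging them at scale [r = h^(1/2)] gives a smooth supersolution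
[phi] of the scheme, hence one of the Bellman equation up to
[N (h^2 / r^3 + h / r)], and [v] is compared with [phi] directly.

For [v_h <= v + N h^(1/2)] no regularity or uniqueness theory for [v] is used.
One compares two systems, indexed by the controls, with a small switching cost
[kappa], for a semi-Lagrangian scheme with time step [tau]: one where the
coefficients are shaken by a supremum over a ball of radius [h^(1/2)], and one
where they are shaken by an infimum over a much smaller ball.  Coupling the two
noises shows that both are Lipschitz and within [N h^(1/2)] of each other.
Averages of the first are smooth supersolutions, which dominate [v_h]; an
average of the second, at a point where its index is nearly maximal, satisfies
the linear equation of that index with the sign of a subsolution, because the
switching cost makes switching unprofitable nearby, so that [v] dominates it.
Finally [kappa], then the small radius, then [tau] tend to 0.
*)

Require Import Defs.
From HB Require Import structures.
From mathcomp Require Import all_boot all_order all_algebra.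
From mathcomp Require Import all_classical all_reals all_analysis.
From mathcomp Require Import ring lra.
Set Implicit Arguments.
Unset Strict Implicit.
Unset Printing Implicit Defensive.
Import Order.TTheory GRing.Theory Num.Theory.
Import numFieldNormedType.Exports.
Local Open Scope classical_set_scope.
Local Open Scope ring_scope.

(** The two bounds need different proofs because averaging respects each fixed linear inequality but
    not a supremum. A supersolution satisfies the inequality of every control, and all of them
    survive averaging; the control that is nearly optimal for a subsolution changes from point to
    point and is lost. A switching system gives each control its own function, hence its own linear
    equation. Why semi-Lagrangian: in the finite-difference scheme the coefficients are jump rates,
    which differ between two points; here they are displacements, so the same random direction can
    be used at both points. The size of lambda pays twice: for the terms quadratic in the gradient
    in the Bernstein argument, and for the growth rate of the coupled distance. As [A] is not
    assumed compact, suprema need not be attained; subsolution inequalities are used up to an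
    arbitrary error and every maximum principle is run at a near-maximum. *)

(** * Box averages and their derivatives *)
Section Mean.
Variable R : realType.
Implicit Types (k P : R -> R).

Definition mean (e : R) k : R :=
  (2 * e)^-1 * \int[lebesgue_measure]_(s in `[- e, e]) k s.

Lemma integrable_segment k (a b : R) : continuous k ->
  lebesgue_measure.-integrable `[a, b] (EFin \o k).
Proof.
move=> ck; apply: continuous_compact_integrable; first exact: segment_compact.
exact: continuous_subspaceT.
Qed.

(** A primitive based at [- L] is only claimed to be differentiable inside the window; callers take
    [L] large enough. *)
Lemma antiderivative_exists k (L : R) : continuous k -> 0 < L ->
  exists P, forall x, - L < x < L -> is_derive x 1 P (k x).
Proof.
move=> ck L0; exists (fun x => \int[lebesgue_measure]_(s in `[- L, x]) k s) => x /andP[Lx xL].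
have [d1 d2] := continuous_FTC1_closed xL (integrable_segment (- L) L ck) Lx (ck x).
by apply: DeriveDef; [exact: d1|rewrite -derive1E; exact: d2].
Qed.

Lemma integral_antiderivative k P (L a b : R) : continuous k ->
  (forall x, - L < x < L -> is_derive x 1 P (k x)) -> - L < a -> a < b -> b < L ->
  \int[lebesgue_measure]_(s in `[a, b]) k s = P b - P a.
Proof.
move=> ck dP La ab bL.
have cP x : - L < x < L -> {for x, continuous P}.
  by move=> /dP dPx; apply: differentiable_continuous; apply/derivable1_diffP.
rewrite /Rintegral (@continuous_FTC2 _ k P) //.
- exact: continuous_subspaceT.
- split.
  + by move=> x; rewrite in_itv /= => /andP[ax xb]; apply: ex_derive; apply: dP; apply/andP; split; lra.
  + by apply: cvg_at_right_filter; apply: cP; apply/andP; split; lra.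
  + by apply: cvg_at_left_filter; apply: cP; apply/andP; split; lra.
- move=> x; rewrite in_itv /= => /andP[ax xb]; rewrite derive1E; apply: derive_val.
  by apply: dP; apply/andP; split; lra.
Qed.

Lemma mean_le (e : R) k1 k2 : 0 < e -> continuous k1 -> continuous k2 ->
  (forall s, `|s| <= e -> k1 s <= k2 s) -> mean e k1 <= mean e k2.
Proof.
move=> e0 c1 c2 k12; rewrite ler_pM2l ?invr_gt0 ?mulr_gt0 //.
apply: le_Rintegral; [exact: measurable_itv|exact: integrable_segment|exact: integrable_segment|].
by move=> s /=; rewrite in_itv /= -ler_norml; exact: k12.
Qed.

Lemma meanD (e : R) k1 k2 : continuous k1 -> continuous k2 ->
  mean e (fun s => k1 s + k2 s) = mean e k1 + mean e k2.
Proof.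
move=> c1 c2; rewrite /mean RintegralD;
  [ring|exact: measurable_itv|exact: integrable_segment|exact: integrable_segment].
Qed.

Lemma meanZ (e a : R) k : continuous k -> mean e (fun s => a * k s) = a * mean e k.
Proof.
move=> c1; rewrite /mean RintegralZl; [ring|exact: measurable_itv|exact: integrable_segment].
Qed.

Lemma mean_cst (e a : R) : 0 < e -> mean e (fun=> a) = a.
Proof.
move=> e0; rewrite /mean Rintegral_cst //= lebesgue_measure_itv /= lte_fin.
by rewrite ifT; [rewrite /=; field; rewrite gt_eqF | lra].
Qed.

(** Through an antiderivative [P], a shift changes the integral only at its two endpoints, and at
    each of them the mean value theorem and the Lipschitz bound leave an error [C * t ^+ 2]. So the
    mean has a central difference quotient as derivative, although [k] is only Lipschitz. *)
Lemma mean_shift (e C t : R) k : 0 < e -> 0 <= C -> continuous k ->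
  (forall x y, `|k x - k y| <= C * `|x - y|) ->
  `|mean e (fun s => k (s + t)) - mean e k - t * ((k e - k (- e)) / (2 * e))|
  <= C / e * t ^+ 2.
Proof.
move=> e0 C0 ck lk.
pose L := e + `|t| + 1.
have nt := normr_ge0 t; have [t1 t2] : - `|t| <= t /\ t <= `|t|.
  by split; [rewrite lerNl -normrN ler_norm|exact: ler_norm].
have L0 : 0 < L by rewrite /L; lra.
have [P dP] := antiderivative_exists ck L0.
have ckt : continuous (fun s => k (s + t)).
  move=> x; apply: continuous_comp; last exact: ck.
  by apply: cvgD; [exact: cvg_id|exact: cvg_cst].
have dPt x : - (e + 2^-1) < x < e + 2^-1 -> is_derive x 1 (fun s => P (s + t)) (k (x + t)).
  move=> /andP[x1 x2].
  rewrite -[k _]mulr1; apply: (is_derive1_comp (f := P) (g := shift t)).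
    by apply: dP; apply/andP; rewrite /L /=; split; lra.
  exact: is_derive_shift.
have cP x : - L < x < L -> {for x, continuous P}.
  by move=> /dP dPx; apply: differentiable_continuous; apply/derivable1_diffP.
have mvt_le a b : - L < a -> a <= b -> b < L ->
    exists2 c, a <= c <= b & P b - P a = k c * (b - a).
  move=> La ab bL.
  have d x : x \in `]a, b[%R -> is_derive x 1 P (k x).
    by rewrite in_itv /= => /andP[? ?]; apply: dP; apply/andP; split; lra.
  have cw : {within `[a, b], continuous P}.
    apply: continuous_in_subspaceT => x; rewrite inE /= in_itv /= => /andP[? ?].
    by apply: cP; apply/andP; split; lra.
  by have [c cab Pc] := MVT_segment ab d cw; exists c.
have mvt a : `|a| <= e -> `|P (a + t) - P a - t * k a| <= C * t ^+ 2.
  rewrite ler_norml => /andP[a1 a2].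
  have [c ca ->] : exists2 c, `|c - a| <= `|t| & P (a + t) - P a = k c * t.
    have [t0|t0] := leP 0 t.
      have [c /andP[c1 c2] Pc] : exists2 c, a <= c <= a + t & P (a + t) - P a = k c * (a + t - a).
        by apply: mvt_le; rewrite /L; lra.
      exists c; first by rewrite !ger0_norm; lra.
      by rewrite Pc; ring.
    have [c /andP[c1 c2] Pc] : exists2 c, a + t <= c <= a & P a - P (a + t) = k c * (a - (a + t)).
      by apply: mvt_le; rewrite /L; lra.
    exists c; first by rewrite (ltr0_norm t0) ler0_norm; lra.
    by rewrite -opprB Pc; ring.
  rewrite (_ : k c * t - t * k a = t * (k c - k a)); last by ring.
  rewrite normrM -real_normK ?num_real // expr2 mulrA mulrC ler_wpM2r //.
  by rewrite (le_trans (lk _ _)) // ler_wpM2l.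
rewrite /mean (integral_antiderivative ckt dPt); try lra.
rewrite (integral_antiderivative ck dP); try (rewrite /L; lra).
have -> : (2 * e)^-1 * (P (e + t) - P (- e + t)) - (2 * e)^-1 * (P e - P (- e)) -
   t * ((k e - k (- e)) / (2 * e)) =
   (2 * e)^-1 * ((P (e + t) - P e - t * k e) - (P (- e + t) - P (- e) - t * k (- e))).
  by field; rewrite gt_eqF.
rewrite normrM gtr0_norm ?invr_gt0 ?mulr_gt0 //.
rewrite mulrC ler_pdivrMr ?mulr_gt0 //.
have -> : C / e * t ^+ 2 * (2 * e) = C * t ^+ 2 + C * t ^+ 2 by field; rewrite gt_eqF.
rewrite (le_trans (ler_normB _ _)) // lerD ?mvt ?normrN ?gtr0_norm //.
Qed.
End Mean.

(** * Euclidean norm and Lipschitz functions *)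

Section Euclid.
Variables (R : realType) (d : nat).
Implicit Types (x y z : 'rV[R]_d).

Definition sqn x : R := \sum_(i < d) x 0 i ^+ 2.

Lemma sqn_ge0 x : 0 <= sqn x.
Proof. by apply: sumr_ge0 => i _; exact: sqr_ge0. Qed.

Lemma enorm_ge0 x : 0 <= enorm x.
Proof. exact: sqrtr_ge0. Qed.

Lemma enorm_sqr x : enorm x ^+ 2 = sqn x.
Proof. by rewrite sqr_sqrtr // sqn_ge0. Qed.

Lemma enormZ (a : R) x : enorm (a *: x) = `|a| * enorm x.
Proof.
rewrite /enorm; under eq_bigr do rewrite mxE exprMn.
by rewrite -mulr_sumr sqrtrM ?sqr_ge0 // sqrtr_sqr.
Qed.

Lemma enormN x : enorm (- x) = enorm x.
Proof. by rewrite -scaleN1r enormZ normrN1 mul1r. Qed.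

Lemma enormB x y : enorm (x - y) = enorm (y - x).
Proof. by rewrite -opprB enormN. Qed.

Lemma coord_le_enorm x i : `|x 0 i| <= enorm x.
Proof.
rewrite -(@ler_pXn2r _ 2) ?nnegrE ?enorm_ge0 // enorm_sqr real_normK ?num_real //.
by rewrite /sqn (bigD1 i) //= lerDl sumr_ge0 // => j _; exact: sqr_ge0.
Qed.

Lemma enorm_le_sum x : enorm x <= \sum_i `|x 0 i|.
Proof.
have s0 (P : pred 'I_d) : 0 <= \sum_(i | P i) `|x 0 i| by apply: sumr_ge0.
rewrite -(@ler_pXn2r _ 2) ?nnegrE ?enorm_ge0 ?s0 // enorm_sqr /sqn.
rewrite expr2 mulr_suml; apply: ler_sum => i _.
rewrite -real_normK ?num_real // expr2 ler_wpM2l // (bigD1 i) //=.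
by rewrite lerDl.
Qed.

Lemma enorm_box (r : R) x : (forall i, `|x 0 i| <= r) -> enorm x <= d%:R * r.
Proof.
move=> xr; apply: (le_trans (enorm_le_sum x)).
apply: (le_trans (ler_sum _ (fun i _ => xr i))).
by rewrite sumr_const card_ord mulr_natl.
Qed.

Lemma enorm_delta i : enorm (delta_mx 0 i : 'rV[R]_d) = 1.
Proof.
rewrite /enorm (bigD1 i) //= mxE !eqxx expr1n big1 ?addr0 ?sqrtr1 // => j ji.
by rewrite mxE (negPf ji) andbF expr0n.
Qed.

Lemma enorm_le_norm x : enorm x <= d%:R * `|x|.
Proof.
apply: enorm_box => i.
have /mapP[j Hj ->] : `|x 0 i| \in [seq `|x y.1 y.2| | y : 'I_1 * 'I_d].
  by apply/mapP; exists (0, i) => //=; rewrite mem_enum.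
by rewrite [leRHS]/Num.Def.normr /= mx_normrE; apply/bigmax_geP; right => /=; exists j.
Qed.

Definition lip (C : R) (g : 'rV[R]_d -> R) := forall x y, `|g x - g y| <= C * enorm (x - y).

Lemma lip_const C g : lip C g -> lip `|C| g.
Proof.
by move=> lg x y; rewrite (le_trans (lg x y)) // ler_wpM2r ?enorm_ge0 // ler_norm.
Qed.

Lemma lip_continuous C g : lip C g -> continuous g.
Proof.
move=> /lip_const lg x; apply/(@cvgrPdist_le _ _ _ (nbhs x)) => /= e e0.
have C1 : 0 < `|C| * d%:R + 1 by rewrite ltr_wpDl // mulr_ge0.
apply/nbhs_ballP; exists (e / (`|C| * d%:R + 1)); first by rewrite /= divr_gt0.
move=> y; rewrite -ball_normE /= ltr_pdivlMr // => /ltW; apply: le_trans.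
apply: (le_trans (lg x y)); apply: (@le_trans _ _ (`|C| * (d%:R * `|x - y|))).
  by rewrite ler_wpM2l // enorm_le_norm.
have -> : `|x - y| * (`|C| * d%:R + 1) = `|C| * (d%:R * `|x - y|) + `|x - y| by ring.
by rewrite lerDl.
Qed.

Lemma lip_shift C g w : lip C g -> lip C (fun x => g (x + w)).
Proof. by move=> lg x y; rewrite (le_trans (lg _ _)) // [y + w]addrC addrKA. Qed.

Lemma lipD C1 C2 g1 g2 : lip C1 g1 -> lip C2 g2 -> lip (C1 + C2) (fun x => g1 x + g2 x).
Proof.
move=> l1 l2 x y; rewrite (_ : _ - _ = (g1 x - g1 y) + (g2 x - g2 y)); last by ring.
by rewrite (le_trans (ler_normD _ _)) // mulrDl lerD.
Qed.

Lemma lipZ (a : R) C g : lip C g -> lip (`|a| * C) (fun x => a * g x).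
Proof. by move=> l1 x y; rewrite -mulrBr normrM -mulrA ler_wpM2l. Qed.

Lemma lip_cst (a : R) : lip 0 (fun=> a).
Proof. by move=> x y; rewrite subrr normr0 mul0r. Qed.

Lemma lip_sum (I : Type) (r : seq I) (C : I -> R) (g : I -> 'rV[R]_d -> R) :
  (forall i, lip (C i) (g i)) -> lip (\sum_(i <- r) C i) (fun x => \sum_(i <- r) g i x).
Proof.
move=> lg x y; rewrite -sumrB (le_trans (ler_norm_sum _ _ _)) // mulr_suml.
by apply: ler_sum => i _; exact: lg.
Qed.
End Euclid.

(** * Iterated coordinate averages *)

Section Mollifier.
Variables (R : realType) (d : nat) (e : R).
Hypothesis e_gt0 : 0 < e.
Implicit Types (x y z w : 'rV[R]_d) (g : 'rV[R]_d -> R) (s : seq 'I_d).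

Let dl (i : 'I_d) : 'rV[R]_d := delta_mx 0 i.

Definition avg (i : 'I_d) g x : R := mean e (fun s : R => g (x + s *: delta_mx 0 i)).

(** Convolution with a product of splines: a coordinate occurring k times in [s] is averaged k
    times, which yields k derivatives in it while using integrals in one variable only. *)
Definition mol s g := foldr avg g s.

Definition cdiff (j : 'I_d) g x : R :=
  (g (x + e *: delta_mx 0 j) - g (x - e *: delta_mx 0 j)) / (2 * e).

Lemma lip_line C g x i : lip C g ->
  forall s t : R, `|g (x + s *: dl i) - g (x + t *: dl i)| <= C * `|s - t|.
Proof.
move=> lg s t; apply: (le_trans (lg _ _)).
by rewrite opprD addrACA subrr add0r -scalerBl enormZ enorm_delta mulr1.
Qed.

Lemma continuous_line C g x i : lip C g -> continuous (fun s : R => g (x + s *: dl i)).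
Proof.
move=> lg s; apply: continuous_comp; last exact: (lip_continuous lg).
apply: cvgD; first exact: cvg_cst.
by apply: cvgZ; [exact: cvg_id|exact: cvg_cst].
Qed.

Lemma avg_le C1 C2 g1 g2 i x : lip C1 g1 -> lip C2 g2 ->
  (forall s : R, `|s| <= e -> g1 (x + s *: dl i) <= g2 (x + s *: dl i)) ->
  avg i g1 x <= avg i g2 x.
Proof.
by move=> l1 l2 g12; apply: mean_le => //; [exact: continuous_line l1|exact: continuous_line l2].
Qed.

Lemma avgD C1 C2 g1 g2 i : lip C1 g1 -> lip C2 g2 ->
  avg i (fun x => g1 x + g2 x) = fun x => avg i g1 x + avg i g2 x.
Proof.
move=> l1 l2; apply/funext => x; rewrite /avg meanD //.
- exact: continuous_line l1.
- exact: continuous_line l2.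
Qed.

Lemma avgZ (a : R) C g i : lip C g -> avg i (fun x => a * g x) = fun x => a * avg i g x.
Proof. by move=> l1; apply/funext => x; rewrite /avg meanZ //; exact: continuous_line l1. Qed.

Lemma avg_cst (a : R) i : avg i (fun=> a) = fun=> a.
Proof. by apply/funext => x; rewrite /avg mean_cst. Qed.

Lemma avg_shift g w i : avg i (fun x => g (x + w)) = fun x => avg i g (x + w).
Proof.
apply/funext => x; rewrite /avg; congr (mean _ _); apply/funext => s.
by rewrite addrAC.
Qed.

(** [g] is at most its translate by [y - x] plus [C * enorm (x - y)]; averages are monotone and
    commute with translations. *)
Lemma avg_lip C g i : lip C g -> lip C (avg i g).
Proof.
move=> lg.
have le1 x y : avg i g x <= avg i g y + C * enorm (x - y).
  pose g' z := g (z + (y - x)) + C * enorm (x - y).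
  have -> : avg i g y + C * enorm (x - y) = avg i g' x.
    rewrite /g' (avgD _ (lip_shift _ lg) (lip_cst _)) avg_cst avg_shift.
    by rewrite addrCA subrr addr0.
  apply: (avg_le lg (lipD (lip_shift _ lg) (lip_cst _))) => s _.
  rewrite /g' -lerBlDl (le_trans (ler_norm _)) // (le_trans (lg _ _)) //.
  by rewrite opprD addrA subrr add0r opprB.
move=> x y; rewrite ler_norml; apply/andP; split.
  by have := le1 y x; rewrite enormB; lra.
by have := le1 x y; lra.
Qed.

Lemma mol_lip C g s : lip C g -> lip C (mol s g).
Proof. by move=> lg; elim: s => //= i s; exact: avg_lip. Qed.

Lemma molD C1 C2 g1 g2 s : lip C1 g1 -> lip C2 g2 ->
  mol s (fun x => g1 x + g2 x) = fun x => mol s g1 x + mol s g2 x.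
Proof.
move=> l1 l2; elim: s => //= i s ->.
by rewrite (avgD _ (mol_lip s l1) (mol_lip s l2)).
Qed.

Lemma molZ (a : R) C g s : lip C g -> mol s (fun x => a * g x) = fun x => a * mol s g x.
Proof. by move=> l1; elim: s => //= i s ->; rewrite (avgZ _ _ (mol_lip s l1)). Qed.

Lemma mol_cst (a : R) s : mol s (fun=> a) = fun=> a.
Proof. by elim: s => //= i s ->; rewrite avg_cst. Qed.

Lemma mol_shift g w s : mol s (fun x => g (x + w)) = fun x => mol s g (x + w).
Proof. by elim: s => //= i s ->; rewrite avg_shift. Qed.

Lemma mol_sum (I : Type) (r : seq I) C (p : I -> R) (w : I -> 'rV[R]_d) g s : lip C g ->
  mol s (fun x => \sum_(i <- r) p i * g (x + w i))
  = fun x => \sum_(i <- r) p i * mol s g (x + w i).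
Proof.
move=> lg; have lp i := lipZ (p i) (lip_shift (w i) lg).
elim: r => [|i r IHr].
  rewrite (_ : (fun x => _) = (fun=> 0)); last by apply/funext => x; rewrite big_nil.
  by rewrite mol_cst; apply/funext => x; rewrite big_nil.
rewrite (_ : (fun x => _) = fun x => p i * g (x + w i) + \sum_(i <- r) p i * g (x + w i));
  last by apply/funext => x; rewrite big_cons.
rewrite (molD _ (lp i) (lip_sum r lp)) IHr (molZ _ _ (lip_shift (w i) lg)) mol_shift.
by apply/funext => x; rewrite big_cons.
Qed.

Lemma mol_le C1 C2 g1 g2 s x : lip C1 g1 -> lip C2 g2 ->
  (forall z, (forall i, `|z 0 i| <= (size s)%:R * e) -> g1 (x + z) <= g2 (x + z)) ->
  mol s g1 x <= mol s g2 x.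
Proof.
move=> l1 l2; elim: s x => [|i s IHs] x g12 /=.
  by have := g12 0; rewrite addr0; apply=> i; rewrite mxE normr0 mul0r.
apply: (avg_le (mol_lip s l1) (mol_lip s l2)) => t te.
apply: IHs => z ze; rewrite -addrA; apply: g12 => j.
rewrite mxE (le_trans (ler_normD _ _)) //= -natr1 mulrDl mul1r addrC lerD //.
rewrite !mxE normrM eqxx /=; case: (j == i); rewrite ?normr1 ?mulr1 //.
by rewrite normr0 mulr0 ltW.
Qed.

(** Averaging is linear, monotone and commutes with translations. The coefficients must not vary
    with [z], and this is what shaking arranges. *)
Lemma mol_ineq (I : finType) C (p : I -> R) (w : I -> 'rV[R]_d) (p0 q : R) g s x :
  lip C g ->
  (forall z, (forall i, `|z 0 i| <= (size s)%:R * e) ->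
     \sum_i p i * g (x + z + w i) + p0 * g (x + z) + q <= 0) ->
  \sum_i p i * mol s g (x + w i) + p0 * mol s g x + q <= 0.
Proof.
move=> lg H.
have lp i := lipZ (p i) (lip_shift (w i) lg).
have l1 := lip_sum (index_enum I) lp.
have l2 := lipZ p0 lg.
have := mol_le (s := s) (x := x) (lipD (lipD l1 l2) (lip_cst q)) (lip_cst 0) H.
rewrite (molD _ (lipD l1 l2) (lip_cst q)) (molD _ l1 l2) !mol_cst (molZ _ _ lg).
by rewrite (mol_sum _ _ _ _ lg).
Qed.

Lemma mol_dist C g s x : 0 <= C -> lip C g ->
  `|mol s g x - g x| <= C * (d%:R * ((size s)%:R * e)).
Proof.
move=> C0 lg; set r := C * _.
have near z : (forall i, `|z 0 i| <= (size s)%:R * e) -> `|g (x + z) - g x| <= r.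
  move=> ze; rewrite (le_trans (lg _ _)) // addrC addKr ler_wpM2l //.
  exact: enorm_box.
rewrite ler_norml; apply/andP; split.
  have : mol s (fun=> g x - r) x <= mol s g x.
    by apply: (mol_le (lip_cst _) lg) => z /near; rewrite ler_norml => /andP[? _]; lra.
  by rewrite mol_cst; lra.
have : mol s g x <= mol s (fun=> g x + r) x.
  by apply: (mol_le lg (lip_cst _)) => z /near; rewrite ler_norml => /andP[_ ?]; lra.
by rewrite mol_cst; lra.
Qed.

Lemma mol_bound C U g s x : lip C g -> (forall y, `|g y| <= U) -> `|mol s g x| <= U.
Proof.
move=> lg gU; rewrite ler_norml; apply/andP; split.
  have : mol s (fun=> - U) x <= mol s g x.
    by apply: (mol_le (lip_cst _) lg) => z _; have := gU (x + z); rewrite ler_norml => /andP[].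
  by rewrite mol_cst.
have : mol s g x <= mol s (fun=> U) x.
  by apply: (mol_le lg (lip_cst _)) => z _; have := gU (x + z); rewrite ler_norml => /andP[].
by rewrite mol_cst.
Qed.

Lemma cdiff_lip C g j : lip C g -> lip (C / e) (cdiff j g).
Proof.
move=> lg; have := lipZ (2 * e)^-1 (lipD (lip_shift (e *: dl j) lg)
  (lipZ (-1) (lip_shift (- (e *: dl j)) lg))).
rewrite normrN1 mul1r (_ : `|_| * _ = C / e); last first.
  by rewrite gtr0_norm ?invr_gt0 ?mulr_gt0 //; field; rewrite gt_eqF.
rewrite (_ : cdiff j g = fun x => (2 * e)^-1 * (g (x + e *: dl j) + (-1) * g (x + - (e *: dl j)))) //.
by apply/funext => x; rewrite /cdiff mulrC mulN1r.
Qed.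

Lemma mol_cdiff C g j s : lip C g -> mol s (cdiff j g) = cdiff j (mol s g).
Proof.
move=> lg.
rewrite (_ : cdiff j g = fun x => (2 * e)^-1 * (g (x + e *: dl j) + (-1) * g (x + - (e *: dl j)))).
  rewrite (molZ _ _ (lipD (lip_shift (e *: dl j) lg) (lipZ (-1) (lip_shift (- (e *: dl j)) lg)))).
  rewrite (molD _ (lip_shift (e *: dl j) lg) (lipZ (-1) (lip_shift (- (e *: dl j)) lg))).
  rewrite (molZ _ _ (lip_shift (- (e *: dl j)) lg)) !mol_shift.
  by apply/funext => x; rewrite /cdiff mulrC mulN1r.
by apply/funext => x; rewrite /cdiff mulrC mulN1r.
Qed.

(** One average over [j] is traded for a central difference. If the outermost average is over [j],
    [mean_shift] applies to it; otherwise the bound passes through that average, being uniform in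
    the base point. *)
Lemma mol_derive C g j s : 0 <= C -> lip C g -> j \in s -> forall x t,
  `|mol s g (x + t *: dl j) - mol s g x - t * mol (rem j s) (cdiff j g) x| <= C / e * t ^+ 2.
Proof.
move=> C0 lg; elim: s => //= i s IHs; rewrite inE => js x t.
have [ij|ij] := eqVneq i j.
  subst i; rewrite (mol_cdiff _ _ lg).
  have ls := mol_lip s lg.
  have -> : avg j (mol s g) (x + t *: dl j) = mean e (fun r => mol s g (x + (r + t) *: dl j)).
    by rewrite /avg; congr (mean _ _); apply/funext => r; rewrite -addrA -scalerDl [t + r]addrC.
  have H := mean_shift t e_gt0 C0 (continuous_line (x := x) (i := j) ls) (lip_line x j ls).
  by rewrite scaleNr in H; exact: H.
rewrite eq_sym (negPf ij) /= in js.
pose F := mol s g; pose G := mol (rem j s) (cdiff j g); set B := C / e * t ^+ 2.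
change (`|avg i F (x + t *: dl j) - avg i F x - t * avg i G x| <= B).
have lF : lip C F := mol_lip s lg.
have lG : lip (C / e) G := mol_lip _ (cdiff_lip j lg).
have lFt := lip_shift (t *: dl j) lF.
have IH y := IHs js y t.
have E : avg i (fun y => F (y + t *: dl j) + ((-1) * F y + (- t) * G y)) x =
  avg i F (x + t *: dl j) - avg i F x - t * avg i G x.
  rewrite (avgD _ lFt (lipD (lipZ (-1) lF) (lipZ (- t) lG))).
  rewrite (avgD _ (lipZ (-1) lF) (lipZ (- t) lG)) (avgZ _ _ lF) (avgZ _ _ lG) avg_shift.
  ring.
rewrite -E; have lE := lipD lFt (lipD (lipZ (-1) lF) (lipZ (- t) lG)).
have bd y : `|F (y + t *: dl j) + (-1 * F y + - t * G y)| <= B.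
  have := IH y; congr (`|_| <= _); rewrite -/F -/G; ring.
rewrite ler_norml; apply/andP; split.
  rewrite -[- B](_ : avg i (fun=> - B) x = _); last by rewrite avg_cst.
  by apply: (avg_le (lip_cst _) lE) => r _; have := bd (x + r *: dl i); rewrite ler_norml => /andP[].
rewrite -[B](_ : avg i (fun=> B) x = _); last by rewrite avg_cst.
by apply: (avg_le lE (lip_cst _)) => r _; have := bd (x + r *: dl i); rewrite ler_norml => /andP[].
Qed.
End Mollifier.

(** * Smooth functions and Taylor expansions *)

Section Smooth.
Variables (R : realType) (d : nat).
Implicit Types (x y l : 'rV[R]_d) (phi : 'rV[R]_d -> R) (psi : 'I_d -> 'rV[R]_d -> R).

(** A gradient with uniform quadratic remainder: exactly what [mol_derive] supplies, stable under
    finite sums, and strong enough to give every directional derivative. *)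
Definition qgrad phi psi := exists C : R, forall j x (t : R),
  `|phi (x + t *: delta_mx 0 j) - phi x - t * psi j x| <= C * t ^+ 2.

(** [B] bounds the derivatives of order exactly [n]; those of lower order are only required to be
    Lipschitz. *)
Fixpoint smooth (n : nat) (B : R) phi : Prop := (exists C, lip C phi) /\
  match n with
  | 0 => forall x, `|phi x| <= B
  | n'.+1 => exists psi, qgrad phi psi /\ forall j, smooth n' B (psi j)
  end.

Lemma smooth_lip n B phi : smooth n B phi -> exists C, lip C phi.
Proof. by case: n => [|n] []. Qed.

(** The first difference consumes the Lipschitz constant; each further one costs a factor 1 / e. *)
Lemma cdiff_iter_bound (e M : R) n g js x : 0 < e -> lip M g -> size js = n.+1 ->
  `|foldr (cdiff e) g js x| <= M / e ^+ n.
Proof.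
move=> e0 lg; elim: n js x => [|n IHn] [|j js] x //= [sz].
  case: js sz => //= _; rewrite expr0 divr1 /cdiff normrM normfV.
  rewrite (gtr0_norm (_ : 0 < 2 * e)) ?mulr_gt0 // ler_pdivrMr ?mulr_gt0 //.
  apply: (le_trans (lg _ _)); rewrite opprB addrC addrA subrK -scalerDl enormZ enorm_delta.
  by rewrite mulr1 gtr0_norm ?addr_gt0 // mulr2n mulrDl mul1r.
have e2 : 0 < 2 * e by rewrite mulr_gt0.
rewrite /cdiff normrM normfV (gtr0_norm e2) ler_pdivrMr //.
apply: (le_trans (ler_normB _ _)).
have -> : M / e ^+ n.+1 * (2 * e) = M / e ^+ n + M / e ^+ n.
  have := exprn_gt0 n e0; rewrite exprS; move: (e ^+ n) => E E0.
  by field; rewrite !gt_eqF.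
by rewrite lerD // IHn.
Qed.

Lemma smooth_mol n (e B C : R) s g : 0 < e -> 0 <= C -> lip C g ->
  (forall j, (n <= count_mem j s)%N) ->
  (forall js x, size js = n -> `|foldr (cdiff e) g js x| <= B) ->
  smooth n B (mol e s g).
Proof.
move=> e0; elim: n s g C => [|n IHn] s g C C0 lg cnt bd.
  split; first by exists C; exact: mol_lip.
  by move=> x; apply: (mol_bound e0 _ _ lg) => y; apply: (bd [::]).
split; first by exists C; exact: mol_lip.
exists (fun j => mol e (rem j s) (cdiff e j g)); split.
  exists (C / e) => j x t; apply: mol_derive => //.
  by rewrite -has_pred1 has_count (leq_trans _ (cnt j)).
move=> j; apply: (IHn _ _ (C / e)).
- by rewrite divr_ge0 // ltW.
- exact: cdiff_lip.
- move=> i; rewrite count_rem.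
  have := cnt i; case: (_ && _); rewrite ?subn0 ?subn1; last exact: ltnW.
  by case: (count_mem i s).
- by move=> js x sz; rewrite -[cdiff e j g]/(foldr (cdiff e) g [:: j]) -foldr_cat bd // size_cat sz addn1.
Qed.

Lemma qgrad_lin (I : finType) (a : I -> R) (phi : I -> 'rV[R]_d -> R)
    (psi : I -> 'I_d -> 'rV[R]_d -> R) :
  (forall i, qgrad (phi i) (psi i)) ->
  qgrad (fun x => \sum_i a i * phi i x) (fun j x => \sum_i a i * psi i j x).
Proof.
move=> /choice[C HC]; exists (\sum_i `|a i| * C i) => j x t.
rewrite mulr_sumr -!sumrB mulr_suml (le_trans (ler_norm_sum _ _ _)) //.
apply: ler_sum => i _.
rewrite (_ : _ - _ - _ = a i * (phi i (x + t *: delta_mx 0 j) - phi i x - t * psi i j x)); last by ring.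
by rewrite normrM -mulrA ler_wpM2l.
Qed.

Lemma smooth_lin (I : finType) n B (a : I -> R) (phi : I -> 'rV[R]_d -> R) :
  (forall i, smooth n B (phi i)) ->
  smooth n (B * \sum_i `|a i|) (fun x => \sum_i a i * phi i x).
Proof.
elim: n phi => [|n IHn] phi sm; split.
- have /choice[C HC] := fun i => smooth_lip (sm i).
  by exists (\sum_i `|a i| * C i); apply: lip_sum => i; exact: lipZ.
- move=> x; rewrite (le_trans (ler_norm_sum _ _ _)) // mulr_sumr.
  by apply: ler_sum => i _; rewrite normrM mulrC ler_wpM2r //; case: (sm i).
- have /choice[C HC] := fun i => smooth_lip (sm i).
  by exists (\sum_i `|a i| * C i); apply: lip_sum => i; exact: lipZ.
- have /choice[psi Hpsi] := fun i => (sm i).2.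
  exists (fun j x => \sum_i a i * psi i j x); split.
    by apply: qgrad_lin => i; exact: (Hpsi i).1.
  by move=> j; apply: IHn => i; exact: (Hpsi i).2.
Qed.

(** The displacement is made one coordinate at a time; each move shifts the base point of the
    remaining partial derivatives by O(t), which their Lipschitz constants absorb. *)
Lemma qgrad_line phi psi l : qgrad phi psi -> (forall j, exists C, lip C (psi j)) ->
  exists C : R, forall x t,
    `|phi (x + t *: l) - phi x - t * \sum_j psi j x * l 0 j| <= C * t ^+ 2.
Proof.
move=> [C HC] /choice[K HK].
suff H r : exists C' : R, forall x t,
    `|phi (x + t *: \sum_(j <- r) l 0 j *: delta_mx 0 j) - phi x
      - t * \sum_(j <- r) psi j x * l 0 j| <= C' * t ^+ 2.
  by have [C' HC'] := H (index_enum 'I_d); exists C' => x t; rewrite {1}[l]row_sum_delta.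
elim: r => [|j r [C' IH]].
  by exists 0 => x t; rewrite !big_nil scaler0 addr0 mulr0 !subr0 subrr normr0 mul0r.
exists (C' + C * l 0 j ^+ 2 + \sum_(i <- r) `|K i| * `|l 0 j| * `|l 0 i|) => x t.
rewrite !big_cons; set v := \sum_(i <- r) l 0 i *: _.
pose y := x + (t * l 0 j) *: delta_mx 0 j.
have -> : x + t *: (l 0 j *: delta_mx 0 j + v) = y + t *: v by rewrite scalerDr scalerA addrA.
have -> : phi (y + t *: v) - phi x - t * (psi j x * l 0 j + \sum_(i <- r) psi i x * l 0 i)
  = (phi (y + t *: v) - phi y - t * \sum_(i <- r) psi i y * l 0 i)
    + (phi y - phi x - (t * l 0 j) * psi j x)
    + t * (\sum_(i <- r) psi i y * l 0 i - \sum_(i <- r) psi i x * l 0 i) by ring.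
rewrite !mulrDl; apply: (le_trans (ler_normD _ _)); apply: lerD.
  apply: (le_trans (ler_normD _ _)); apply: lerD; first exact: IH.
  by apply: (le_trans (HC _ _ _)); rewrite exprMn; lra.
rewrite -sumrB normrM.
have -> : t ^+ 2 = `|t| * `|t| by rewrite -expr2 real_normK ?num_real.
rewrite mulrCA ler_wpM2l // (le_trans (ler_norm_sum _ _ _)) // mulr_suml.
apply: ler_sum => i _; rewrite -mulrBl normrM.
rewrite mulrAC ler_wpM2r //; apply: (le_trans (lip_const (HK i) _ _)).
by rewrite /y addrC addKr enormZ enorm_delta mulr1 normrM -mulrA [`|t| * _]mulrC.
Qed.

Lemma quadratic_is_derive (V : normedModType R) (phi : V -> R) (x l : V) (a C : R) :
  (forall t, `|t| <= 1 -> `|phi (x + t *: l) - phi x - t * a| <= C * t ^+ 2) ->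
  is_derive x l phi a.
Proof.
move=> H.
suff cv : (fun t => t^-1 *: ((phi \o shift x) (t *: l) - phi x)) @ 0^' --> a.
  by apply: DeriveDef; [apply/cvg_ex; exists a|apply/cvg_lim].
apply/cvgrPdist_le => e e0; near=> t.
have t0 : t != 0 by near: t; exact: nbhs_dnbhs_neq.
have t1 : `|t| <= 1.
  near: t; apply: dnbhs0_le; exact: ltr01.
have te : `|t| <= e / (`|C| + 1).
  by near: t; apply: dnbhs0_le; rewrite divr_gt0 // ltr_wpDl.
have tp : 0 < `|t| by rewrite normr_gt0.
rewrite /= distrC addrC [_ + x]addrC.
have -> : t^-1 *: (phi (x + t *: l) - phi x) = t^-1 * (phi (x + t *: l) - phi x) by [].
have -> : - a + t^-1 * (phi (x + t *: l) - phi x) = t^-1 * (phi (x + t *: l) - phi x - t * a).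
  by field.
rewrite normrM normfV ler_pdivrMl //.
apply: (le_trans (H _ t1)).
rewrite -real_normK ?num_real // expr2 mulrA [_ * e]mulrC ler_wpM2r //.
apply: (@le_trans _ _ ((`|C| + 1) * `|t|)).
  by rewrite ler_wpM2r // ler_wpDr // ler_norm.
by rewrite mulrC -ler_pdivlMr // ltr_wpDl.
Unshelve. all: by end_near. Qed.

Lemma qgrad_is_derive phi psi j x : qgrad phi psi -> is_derive x (delta_mx 0 j) phi (psi j x).
Proof. by move=> [C HC]; apply: quadratic_is_derive => t _; exact: HC. Qed.

Lemma qgrad_partial phi psi j : qgrad phi psi -> partial j phi = psi j.
Proof.
by move=> q; apply/funext => x; rewrite /partial; have ? := qgrad_is_derive j x q; exact: derive_val.
Qed.

Lemma qgrad_Dl phi psi l : qgrad phi psi -> Dl l phi = fun x => \sum_j psi j x * l 0 j.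
Proof. by move=> q; apply/funext => x; apply: eq_bigr => j _; rewrite (qgrad_partial _ q). Qed.

Lemma qgrad_C1 phi psi : continuous phi -> qgrad phi psi -> (forall j, continuous (psi j)) ->
  C1 phi.
Proof.
move=> cphi q cpsi; split=> // j; split.
  by move=> x; have ? := qgrad_is_derive j x q; apply: ex_derive.
by rewrite (qgrad_partial _ q).
Qed.

Lemma smooth_Dl n B phi l : smooth n.+1 B phi ->
  smooth n (B * \sum_j `|l 0 j|) (Dl l phi) /\
  exists C : R, forall x t, `|phi (x + t *: l) - phi x - t * Dl l phi x| <= C * t ^+ 2.
Proof.
move=> [_ [psi [q sm]]]; rewrite (qgrad_Dl _ q); split.
  have := smooth_lin (fun j => l 0 j) sm.
  by congr (smooth _ _ _); apply/funext => x; apply: eq_bigr => j _; rewrite mulrC.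
by apply: qgrad_line => // j; exact: smooth_lip (sm j).
Qed.

Lemma smooth_D2l n B phi l : smooth n.+2 B phi -> D2l l phi = Dl l (Dl l phi).
Proof.
move=> [_ [psi [q sm]]].
have /choice[psi2 H] := fun j => (sm j).2.
have q2 : qgrad (Dl l phi) (fun j x => \sum_i l 0 i * psi2 i j x).
  rewrite (qgrad_Dl _ q) (_ : (fun x => _) = (fun x => \sum_i l 0 i * psi i x)).
    by apply: qgrad_lin => i; exact: (H i).1.
  by apply/funext => x; apply: eq_bigr => j _; rewrite mulrC.
rewrite (qgrad_Dl _ q2); apply/funext => x; rewrite /D2l exchange_big /=.
apply: eq_bigr => j _; rewrite mulr_suml; apply: eq_bigr => i _.
by rewrite (qgrad_partial _ q) (qgrad_partial _ (H i).1) [l 0 i * _]mulrC.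
Qed.

Lemma mean_value_at0 (F F' : R -> R) : (forall s : R, is_derive s 1 F (F' s)) ->
  forall s, exists2 c, `|c| <= `|s| & F s - F 0 = F' c * s.
Proof.
move=> dF s.
have cF (a b : R) : {within `[a, b], continuous F}.
  apply: continuous_subspaceT => y; apply: differentiable_continuous.
  by apply/derivable1_diffP; have ? := dF y; exact: ex_derive.
have [s0|/ltW s0] := leP 0 s.
  have [c] := MVT_segment s0 (fun r _ => dF r) (cF _ _).
  rewrite in_itv /= => /andP[c0 cs] Fs; exists c; first by rewrite !ger0_norm.
  by rewrite Fs subr0.
have [c] := MVT_segment s0 (fun r _ => dF r) (cF _ _).
rewrite in_itv /= => /andP[c0 cs] Fs; exists c; first by rewrite !ler0_norm // lerN2.
by rewrite -opprB Fs sub0r mulrN opprK.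
Qed.

(** The mean value theorem gives up the factor 1 / (n + 1) of an integration, so the Taylor
    remainders below carry no factorial. *)
Lemma growth (F F' : R -> R) (a : R) n : 0 <= a ->
  (forall s : R, is_derive s 1 F (F' s)) -> F 0 = 0 ->
  (forall s, `|F' s| <= a * `|s| ^+ n) -> forall s, `|F s| <= a * `|s| ^+ n.+1.
Proof.
move=> a0 dF F0 HF s; have [c cs] := mean_value_at0 dF s.
rewrite F0 subr0 => ->; rewrite normrM exprSr mulrA ler_wpM2r //.
by rewrite (le_trans (HF c)) // ler_wpM2l // lerXn2r ?nnegrE.
Qed.

Definition lineder l phi0 phi1 := exists C : R, forall x (t : R),
  `|phi0 (x + t *: l) - phi0 x - t * phi1 x| <= C * t ^+ 2.

(** A single cubic serves all orders: each Taylor bound sets suitable coefficients to 0 and applies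
    [growth] to the bound of one order less. *)
Lemma lineder_poly l phi0 phi1 x (a b c e : R) : lineder l phi0 phi1 ->
  forall s : R, is_derive s 1
    (fun s => phi0 (x + s *: l) - (a + b * s + c * s ^+ 2 / 2 + e * s ^+ 3 / 6))
    (phi1 (x + s *: l) - (b + c * s + e * s ^+ 2 / 2)).
Proof.
move=> [C HC] s; apply: (@quadratic_is_derive R^o _ _ _ _ (C + (`|c| + `|e| * (`|s| + 1)))) => t t1.
rewrite [t *: 1]mulr1.
have -> : x + (s + t) *: l = x + s *: l + t *: l by rewrite scalerDl addrA.
have -> : phi0 (x + s *: l + t *: l) - (a + b * (s + t) + c * (s + t) ^+ 2 / 2 + e * (s + t) ^+ 3 / 6)
   - (phi0 (x + s *: l) - (a + b * s + c * s ^+ 2 / 2 + e * s ^+ 3 / 6))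
   - t * (phi1 (x + s *: l) - (b + c * s + e * s ^+ 2 / 2)) =
  (phi0 (x + s *: l + t *: l) - phi0 (x + s *: l) - t * phi1 (x + s *: l))
  - (c * 2^-1 + e * (s * 2^-1 + t * 6^-1)) * t ^+ 2 by field.
rewrite [X in _ <= X]mulrDl; apply: (le_trans (ler_normB _ _)); apply: lerD; first exact: HC.
rewrite normrM (ger0_norm (sqr_ge0 t)) ler_wpM2r ?sqr_ge0 //.
have n2 : `|2^-1 : R| = 2^-1 by apply: ger0_norm; lra.
have n6 : `|6^-1 : R| = 6^-1 by apply: ger0_norm; lra.
apply: (le_trans (ler_normD _ _)); rewrite !normrM n2; apply: lerD.
  by have := normr_ge0 c; lra.
rewrite ler_wpM2l // (le_trans (ler_normD _ _)) // !normrM n2 n6.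
by have := normr_ge0 s; lra.
Qed.

Lemma taylor2 l phi0 phi1 phi2 (A : R) : lineder l phi0 phi1 -> lineder l phi1 phi2 ->
  (forall x, `|phi2 x| <= A) -> forall x s,
  `|phi0 (x + s *: l) - phi0 x - s * phi1 x| <= A * `|s| ^+ 2.
Proof.
move=> d0 d1 H2 x; have A0 : 0 <= A by rewrite (le_trans _ (H2 0)).
have t1 s : `|phi1 (x + s *: l) - phi1 x| <= A * `|s| ^+ 1.
  have := growth (n := 0) A0 (lineder_poly x (phi1 x) 0 0 0 d1).
  rewrite !(mul0r, addr0, subr0) scale0r addr0 subrr => /(_ erefl) H.
  have := H _ s; rewrite !(mul0r, addr0); apply => r.
  by rewrite !(mul0r, addr0, subr0) expr0 mulr1.
move=> s; have := growth (n := 1) A0 (lineder_poly x (phi0 x) (phi1 x) 0 0 d0).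
rewrite !(mul0r, mulr0, addr0, subr0) scale0r addr0 subrr => /(_ erefl) H.
have := H _ s; rewrite !(mul0r, addr0) opprD addrA [s * _]mulrC; apply => r.
by rewrite !(mul0r, addr0); exact: t1.
Qed.

Lemma taylor3 l phi0 phi1 phi2 phi3 (A : R) : lineder l phi0 phi1 -> lineder l phi1 phi2 ->
  lineder l phi2 phi3 -> (forall x, `|phi3 x| <= A) -> forall x s,
  `|phi0 (x + s *: l) - phi0 x - s * phi1 x - s ^+ 2 / 2 * phi2 x| <= A * `|s| ^+ 3.
Proof.
move=> d0 d1 d2 H3 x s; have A0 : 0 <= A by rewrite (le_trans _ (H3 0)).
have := growth (n := 2) A0 (lineder_poly x (phi0 x) (phi1 x) (phi2 x) 0 d0).
rewrite !(mul0r, expr0n, mulr0, addr0, subr0) scale0r addr0 subrr => /(_ erefl) H.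
have := H _ s; rewrite !(mul0r, addr0).
have -> : phi0 (x + s *: l) - phi0 x - s * phi1 x - s ^+ 2 / 2 * phi2 x =
  phi0 (x + s *: l) - (phi0 x + phi1 x * s + phi2 x * s ^+ 2 / 2) by field.
apply => r; have := taylor2 d1 d2 H3 x r; congr (`|_| <= _); ring.
Qed.

Lemma taylor4 l phi0 phi1 phi2 phi3 phi4 (A : R) : lineder l phi0 phi1 -> lineder l phi1 phi2 ->
  lineder l phi2 phi3 -> lineder l phi3 phi4 -> (forall x, `|phi4 x| <= A) -> forall x s,
  `|phi0 (x + s *: l) - phi0 x - s * phi1 x - s ^+ 2 / 2 * phi2 x - s ^+ 3 / 6 * phi3 x|
  <= A * `|s| ^+ 4.
Proof.
move=> d0 d1 d2 d3 H4 x s; have A0 : 0 <= A by rewrite (le_trans _ (H4 0)).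
have := growth (n := 3) A0 (lineder_poly x (phi0 x) (phi1 x) (phi2 x) (phi3 x) d0).
rewrite !(mul0r, expr0n, mulr0, addr0, subr0) scale0r addr0 subrr => /(_ erefl) H.
have := H _ s.
have -> : phi0 (x + s *: l) - phi0 x - s * phi1 x - s ^+ 2 / 2 * phi2 x - s ^+ 3 / 6 * phi3 x =
  phi0 (x + s *: l) - (phi0 x + phi1 x * s + phi2 x * s ^+ 2 / 2 + phi3 x * s ^+ 3 / 6) by field.
by apply => r; have := taylor3 d1 d2 d3 H4 x r; congr (`|_| <= _); field.
Qed.

Section consistency.
Variables (phi : 'rV[R]_d -> R) (B La : R) (l : 'rV[R]_d).
Hypotheses (B_ge0 : 0 <= B) (l_le : \sum_j `|l 0 j| <= La).

Let S0 : 0 <= \sum_j `|l 0 j|. Proof. exact: sumr_ge0. Qed.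
Let La0 : 0 <= La. Proof. exact: le_trans S0 l_le. Qed.

Let step (D : R) : 0 <= D -> forall b, D <= b -> D * \sum_j `|l 0 j| <= b * La.
Proof. by move=> D0 b Db; rewrite ler_pM. Qed.

Lemma smooth_taylor2 : smooth 2 B phi -> forall x s,
  `|phi (x + s *: l) - phi x - s * Dl l phi x| <= B * La ^+ 2 * `|s| ^+ 2.
Proof.
move=> sm0 x s; have [sm1 d1] := smooth_Dl l sm0; have [[_ b2] d2] := smooth_Dl l sm1.
apply: (taylor2 d1 d2) => y; apply: (le_trans (b2 y)).
by rewrite expr2 mulrA; do 2 (apply: step; rewrite ?mulr_ge0 //).
Qed.

Lemma smooth_taylor3 : smooth 3 B phi -> forall x s,
  `|phi (x + s *: l) - phi x - s * Dl l phi x - s ^+ 2 / 2 * D2l l phi x|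
  <= B * La ^+ 3 * `|s| ^+ 3.
Proof.
move=> sm0 x s; rewrite (smooth_D2l _ sm0).
have [sm1 d1] := smooth_Dl l sm0; have [sm2 d2] := smooth_Dl l sm1.
have [[_ b3] d3] := smooth_Dl l sm2.
apply: (taylor3 d1 d2 d3) => y; apply: (le_trans (b3 y)).
by rewrite !exprS expr0 mulr1 !mulrA; do 3 (apply: step; rewrite ?mulr_ge0 //).
Qed.

Lemma deltah_consistent h : 0 < h -> smooth 2 B phi -> forall x,
  `|deltah h l phi x - Dl l phi x| <= B * La ^+ 2 * h.
Proof.
move=> h0 sm x; have := smooth_taylor2 sm x h.
have -> : deltah h l phi x - Dl l phi x = h^-1 * (phi (x + h *: l) - phi x - h * Dl l phi x).
  by rewrite /deltah; field; rewrite gt_eqF.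
have h1 : 0 < h^-1 by rewrite invr_gt0.
rewrite normrM (gtr0_norm h1) (gtr0_norm h0) ler_pdivrMl // => /le_trans; apply.
by rewrite le_eqVlt; apply/orP; left; apply/eqP; ring.
Qed.

(** Adding the expansions at [h] and [- h] cancels the odd terms and leaves two fourth-order
    remainders. *)
Lemma Deltah_consistent h : 0 < h -> smooth 4 B phi -> forall x,
  `|Deltah h l phi x - D2l l phi x| <= 2 * B * La ^+ 4 * h ^+ 2.
Proof.
move=> h0 sm0 x; rewrite (smooth_D2l _ sm0).
have [sm1 d1] := smooth_Dl l sm0; move: (Dl l phi) sm1 d1 => phi1 sm1 d1.
have [sm2 d2] := smooth_Dl l sm1; move: (Dl l phi1) sm2 d2 => phi2 sm2 d2.
have [sm3 d3] := smooth_Dl l sm2; move: (Dl l phi2) sm3 d3 => phi3 sm3 d3.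
have [[_ b4] d4] := smooth_Dl l sm3; move: (Dl l phi3) b4 d4 => phi4 b4 d4.
have b4' y : `|phi4 y| <= B * La ^+ 4.
  apply: (le_trans (b4 y)).
  by rewrite !exprS expr0 mulr1 !mulrA; do 4 (apply: step; rewrite ?mulr_ge0 //).
have T s := taylor4 d1 d2 d3 d4 b4' x s.
have Tp := T h; have Tm := T (- h).
have -> : Deltah h l phi x - phi2 x = (h ^+ 2)^-1 *
   ((phi (x + h *: l) - phi x - h * phi1 x - h ^+ 2 / 2 * phi2 x - h ^+ 3 / 6 * phi3 x)
   + (phi (x + - h *: l) - phi x - - h * phi1 x - (- h) ^+ 2 / 2 * phi2 x - (- h) ^+ 3 / 6 * phi3 x)).
  by rewrite /Deltah scaleNr; field; rewrite gt_eqF.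
have h2 : 0 < h ^+ 2 by rewrite exprn_gt0.
rewrite normrM gtr0_norm ?invr_gt0 // ler_pdivrMl //.
apply: (le_trans (ler_normD _ _)).
move: Tp Tm; rewrite normrN (gtr0_norm h0).
have -> : h ^+ 2 * (2 * B * La ^+ 4 * h ^+ 2) = B * La ^+ 4 * h ^+ 4 + B * La ^+ 4 * h ^+ 4 by ring.
by move=> ? ?; exact: lerD.
Qed.
End consistency.
End Smooth.

(** * The discrete gradient estimate *)

Section Bernstein.
Variable R : realType.

(* The contribution of one pair of directions (r, k) to the differentiated
   equation, multiplied by q = (delta_r u)^-: [g0], [g1] are the values of
   delta_r u at x and x + w_k, and [E] is delta_k u at x. *)
Lemma bernstein_pointwise (h hr s th b be g0 g1 E K1 M : R) :
  0 < hr -> hr <= h -> 0 <= b -> `|th| <= K1 -> `|be| <= K1 -> 1 <= K1 ->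
  let q := Num.max 0 (- g0) in let qk := Num.max 0 (- g1) in
  let E' := E + hr * (g1 - g0) / h in
  q <= M -> g1 <= M -> `|E'| <= M ->
  (s ^+ 2 / h + b) / h * 2^-1 * (q ^+ 2 - qk ^+ 2)
  + 4^-1 * (s / h) ^+ 2 * (qk - q) ^+ 2 + 2 * (s / h) * th * q * E
  - 7 * K1 ^+ 2 * M ^+ 2
  <= q / hr * (((s + hr * th) ^+ 2 / h + (b + hr * be)) * E'
               - (s ^+ 2 / h + b) * E).
Proof.
move=> hr0 hrh b0 thK beK K11 q qk E' qM g1M E'M.
have h0 : 0 < h by apply: lt_le_trans hrh.
have q0 : 0 <= q by rewrite /q le_max lexx.
have M0 : 0 <= M by apply: le_trans qM.
pose z := Num.max 0 g1.
have z0 : 0 <= z by rewrite /z le_max lexx.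
have zM : z <= M by rewrite /z ge_max M0.
have g1E : g1 = z - qk.
  rewrite /z /qk; case: (leP 0 g1) => g10.
    by rewrite (_ : Num.max 0 (- g1) = 0) ?subr0 //; apply/max_idPl; rewrite oppr_le0.
  by rewrite (_ : Num.max 0 (- g1) = - g1); [ring | apply/max_idPr; rewrite oppr_ge0 ltW].
(* Where [q] does not vanish, [g0 = - q]. The increment is thus expressed through negative parts and
   the nonnegative [z]. *)
have qg : q * (g1 - g0) = q * (z - qk + q).
  rewrite -g1E; case: (leP g0 0) => g00.
    by rewrite /q (_ : Num.max 0 (- g0) = - g0) //; apply/max_idPr; rewrite oppr_ge0.
  by rewrite /q (_ : Num.max 0 (- g0) = 0) ?mul0r //; apply/max_idPl; rewrite oppr_le0 ltW.
pose t := hr / h; pose sg := s / h.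
have t0 : 0 < t by rewrite divr_gt0.
have t1 : t <= 1 by rewrite ler_pdivrMr // mul1r.
have -> : q / hr * (((s + hr * th) ^+ 2 / h + (b + hr * be)) * E'
               - (s ^+ 2 / h + b) * E) =
    (sg ^+ 2 + b / h) * (q * (z - qk + q)) + 2 * sg * th * q * E
    + 2 * sg * th * t * (q * (z - qk + q)) + (t * th ^+ 2 + be) * (q * E').
  rewrite -qg /E' /sg /t; field.
  by rewrite !gt_eqF.
have -> : (s ^+ 2 / h + b) / h = sg ^+ 2 + b / h by rewrite /sg; field; rewrite gt_eqF.
rewrite -/sg.
have bh : 0 <= b / h by rewrite divr_ge0 // ltW.
move: (b / h) bh => bb bb0.
have th2 : th ^+ 2 <= K1 ^+ 2 by rewrite -real_normK ?num_real // lerXn2r ?nnegrE ?(le_trans _ thK).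
have tth2 : (t * th) ^+ 2 <= K1 ^+ 2.
  rewrite exprMn (le_trans _ th2) // ler_piMl ?sqr_ge0 //.
  by rewrite exprn_ile1 // ltW.
have M2 : 0 <= M ^+ 2 by exact: sqr_ge0.
have K2 : K1 <= K1 ^+ 2 by rewrite expr2 ler_peMl // (le_trans ler01).
have qz : q * z <= M ^+ 2 by rewrite expr2 ler_pM.
have qz0 : 0 <= q * z by rewrite mulr_ge0.
have q2 : q ^+ 2 <= M ^+ 2 by rewrite lerXn2r ?nnegrE.
(* The 7 of the statement is 1 + 4 + 2: here a square is completed against [q * z]; in [Bq] against
   [q - qk], spending half of the available squared increment; [C] bounds the terms in which the
   coefficients themselves are differenced. *)
have A : - (K1 ^+ 2 * M ^+ 2) <= sg ^+ 2 * (q * z) + 2 * sg * th * t * (q * z).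
  have -> : sg ^+ 2 * (q * z) + 2 * sg * th * t * (q * z)
    = (sg + t * th) ^+ 2 * (q * z) - (t * th) ^+ 2 * (q * z) by ring.
  have : (t * th) ^+ 2 * (q * z) <= K1 ^+ 2 * M ^+ 2 by rewrite ler_pM // sqr_ge0.
  have : 0 <= (sg + t * th) ^+ 2 * (q * z) by rewrite mulr_ge0 ?sqr_ge0.
  lra.
have Bq : - (4 * K1 ^+ 2 * M ^+ 2) <= 4^-1 * sg ^+ 2 * (qk - q) ^+ 2
     + 2 * sg * th * t * (q * (q - qk)).
  have -> : 4^-1 * sg ^+ 2 * (qk - q) ^+ 2 + 2 * sg * th * t * (q * (q - qk))
    = (2^-1 * sg * (q - qk) + 2 * (t * th) * q) ^+ 2 - 4 * ((t * th) ^+ 2 * q ^+ 2).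
    by field.
  have : (t * th) ^+ 2 * q ^+ 2 <= K1 ^+ 2 * M ^+ 2 by rewrite ler_pM // sqr_ge0.
  have : 0 <= (2^-1 * sg * (q - qk) + 2 * (t * th) * q) ^+ 2 by exact: sqr_ge0.
  lra.
have C : - (2 * K1 ^+ 2 * M ^+ 2) <= (t * th ^+ 2 + be) * (q * E').
  rewrite lerNl -mulNr; apply: (le_trans (ler_norm _)).
  rewrite mulNr normrN normrM expr2 -expr2 [M ^+ 2]expr2.
  apply: ler_pM => //; last first.
    by rewrite normrM ger0_norm // ler_pM.
  apply: (le_trans (ler_normD _ _)).
  have : `|t * th ^+ 2| <= K1 ^+ 2.
    rewrite ger0_norm; last by rewrite mulr_ge0 ?sqr_ge0 // ltW.
    by rewrite (le_trans _ th2) // ler_piMl ?sqr_ge0.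
  lra.
have D : 0 <= bb * (q * z) + bb * 2^-1 * (q - qk) ^+ 2.
  by apply: addr_ge0; [exact: mulr_ge0 | apply: mulr_ge0; [lra | exact: sqr_ge0]].
have -> : (sg ^+ 2 + bb) * (q * (z - qk + q)) =
   sg ^+ 2 * (q * z) + (sg ^+ 2 + bb) * 2^-1 * (q ^+ 2 - qk ^+ 2)
   + sg ^+ 2 * 2^-1 * (qk - q) ^+ 2 + (bb * (q * z) + bb * 2^-1 * (q - qk) ^+ 2).
  by field.
have -> : 2 * sg * th * t * (q * (z - qk + q)) = 2 * sg * th * t * (q * z)
   + 2 * sg * th * t * (q * (q - qk)) by ring.
lra.
Qed.

(* As [w] is odd and [sg] is even in [k], the second differences of [L_h] fold
   into first differences with weights [sg ^+ 2 / h]. *)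
Definition fd_op (V : zmodType) (B : Type) (I : finType) (w : I -> V) (h : R)
    (sg b : B -> I -> V -> R) (c f : B -> V -> R) (be : B) (u : V -> R) (x : V) : R :=
  \sum_k (sg be k x ^+ 2 / h + b be k x) * ((u (x + w k) - u x) / h)
  - c be x * u x + f be x.

Section gradient.
Variables (V : zmodType) (B : Type) (I : finType) (opp : I -> I) (w : I -> V).
Variables (w0 : V) (h h0 : R) (sg b : B -> I -> V -> R) (c f : B -> V -> R).
Variables (u : V -> R) (K1 U la : R).
Hypotheses (oppK : involutive opp) (w_opp : forall k, w (opp k) = - w k).
Hypotheses (h_gt0 : 0 < h) (h0_gt0 : 0 < h0) (h0h : h0 <= h).
Hypothesis sg_opp : forall be k x, sg be (opp k) x = sg be k x.
Hypothesis sg_le : forall be k x, `|sg be k x| <= K1.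
Hypothesis b_ge0 : forall be k x, 0 <= b be k x.
Hypothesis b_le : forall be k x, b be k x <= K1.
Hypothesis c_ge : forall be x, la <= c be x.
Hypothesis K1_ge1 : 1 <= K1.
Hypothesis u_le : forall x, `|u x| <= U.
Let slow (psi : V -> R) := forall x,
  (forall k, `|psi (x + w k) - psi x| <= K1 * h) /\ `|psi (x + w0) - psi x| <= K1 * h0.
Hypothesis sg_slow : forall be k, slow (sg be k).
Hypothesis b_slow : forall be k, slow (b be k).
Hypothesis c_slow : forall be, slow (c be).
Hypothesis f_slow : forall be, slow (f be).
Hypothesis super : forall be x, fd_op w h sg b c f be u x <= 0.
Hypothesis sub : forall x e, 0 < e -> exists be, - e <= fd_op w h sg b c f be u x.

Let J := (I + bool)%type.
Let wJ (r : J) : V := match r with inl k => w k | inr true => w0 | inr false => - w0 end.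
Let hJ (r : J) : R := match r with inl _ => h | inr _ => h0 end.
Let oJ (r : J) : J := match r with inl k => inl (opp k) | inr e => inr (~~ e) end.
Let g (r : J) x := (u (x + wJ r) - u x) / hJ r.
Let q (r : J) x := Num.max 0 (- g r x).
Let W x := \sum_r q r x ^+ 2.
Let m : R := #|{: I + bool}|%:R.
Let n : R := #|I|%:R.

Let sum_cst (a : R) : \sum_(r : J) a = a * m.
Proof. by rewrite sumr_const -mulr_natr /m; congr (_ * _%:R); apply: eq_card. Qed.
Let sumI_cst (a : R) : \sum_(k : I) a = a * n.
Proof. by rewrite sumr_const -mulr_natr /n. Qed.
Let hJ_gt0 r : 0 < hJ r. Proof. by case: r. Qed.
Let hJh r : hJ r <= h. Proof. by case: r => //=. Qed.
Let wJ_oJ r : wJ (oJ r) = - wJ r.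
Proof. by case: r => [k|[]] //=; rewrite opprK. Qed.
Let hJ_oJ r : hJ (oJ r) = hJ r. Proof. by case: r. Qed.

Let slowJ psi r x : slow psi -> `|psi (x + wJ r) - psi x| <= K1 * hJ r.
Proof.
move=> sp; case: r => [k|[]] /=; [exact: (sp x).1 | exact: (sp x).2 |].
by have := (sp (x - w0)).2; rewrite subrK distrC.
Qed.

Let q_ge0 r x : 0 <= q r x. Proof. by rewrite /q le_max lexx. Qed.

(** Positive parts are negative parts of the opposite direction at the shifted point, so [M], built
    from negative parts alone, bounds first differences from both sides. *)
Let g_oJ r x : g (oJ r) (x + wJ r) = - g r x.
Proof. by rewrite /g hJ_oJ wJ_oJ addrK -mulNr opprB. Qed.

Let g_le r x : `|g r x| <= 2 * U / hJ r.
Proof.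
rewrite /g normrM normfV (gtr0_norm (hJ_gt0 r)) ler_pM2r ?invr_gt0 //.
by rewrite (le_trans (ler_normB _ _)) // mulr2n mulrDl mul1r lerD.
Qed.

Let U_ge0 : 0 <= U. Proof. by rewrite (le_trans _ (u_le 0)). Qed.

Let has_supW : has_sup (range W).
Proof.
split; first by exists (W 0); exists 0.
exists (\sum_r (2 * U / hJ r) ^+ 2) => _ [x _ <-].
apply: ler_sum => r _; rewrite lerXn2r ?nnegrE ?divr_ge0 ?mulr_ge0 // ?(ltW (hJ_gt0 r)) //.
rewrite /q ge_max divr_ge0 ?mulr_ge0 // ?(ltW (hJ_gt0 r)) //=.
by rewrite (le_trans _ (g_le r x)) // -normrN ler_norm.
Qed.

Let S := sup (range W).
Let M := Num.sqrt S.
Let W_le x : W x <= S.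
Proof. by apply: (ub_le_sup has_supW.2); exists x. Qed.
Let W_ge0 x : 0 <= W x.
Proof. by apply: sumr_ge0 => r _; exact: sqr_ge0. Qed.
Let S_ge0 : 0 <= S. Proof. exact: le_trans (W_ge0 0) (W_le 0). Qed.
Let ME : M ^+ 2 = S. Proof. by rewrite sqr_sqrtr. Qed.
Let M_ge0 : 0 <= M. Proof. exact: sqrtr_ge0. Qed.
Let q_le r x : q r x <= M.
Proof.
rewrite -(@ler_pXn2r _ 2) ?nnegrE // ME (le_trans _ (W_le x)) // /W (bigD1 r) //=.
by rewrite lerDl sumr_ge0 // => i _; exact: sqr_ge0.
Qed.
Let g_ge r x : - M <= g r x.
Proof. by rewrite lerNl (le_trans _ (q_le r x)) // /q le_max lexx orbT. Qed.
Let g_leM r x : g r x <= M.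
Proof. by have := g_ge (oJ r) (x + wJ r); rewrite g_oJ lerN2. Qed.
Let g_normM r x : `|g r x| <= M. Proof. by rewrite ler_norml g_ge g_leM. Qed.

Let max0 (a : R) : a = Num.max 0 a - Num.max 0 (- a).
Proof.
case: (leP 0 a) => a0.
  by rewrite (_ : Num.max 0 (- a) = 0) ?subr0 //; apply/max_idPl; rewrite oppr_le0.
by rewrite (_ : Num.max 0 (- a) = - a); [ring | apply/max_idPr; rewrite oppr_ge0 ltW].
Qed.

(** [q (inl (opp k))] at [x + w k] is the positive part of [g (inl k) x]. Hence [G] differs from the
    first difference by a term antisymmetric in [k], invisible to even weights, and its square is
    among the good terms of the direction [inl (opp k)]. *)
Let G k x := q (inl (opp k)) (x + w k) - q (inl (opp k)) x.

Let g_G k x : g (inl k) x = G k x + (q (inl (opp k)) x - q (inl k) x).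
Proof.
rewrite /G {1}(max0 (g (inl k) x)) /q.
have /= -> := g_oJ (inl k) x.
by rewrite opprK; ring.
Qed.

Let sum_g_G (a : I -> R) x : (forall k, a (opp k) = a k) ->
  \sum_k a k * g (inl k) x = \sum_k a k * G k x.
Proof.
move=> aE; under eq_bigr do rewrite g_G mulrDr.
rewrite big_split /= [X in _ + X](_ : _ = 0) ?addr0 //.
under eq_bigr do rewrite mulrBr.
rewrite big_split /= (reindex_inj (can_inj oppK)) /=.
under eq_bigr do rewrite aE oppK.
by rewrite -big_split /= big1 // => k _; rewrite subrr.
Qed.

Let N := 7 * n * m * K1 ^+ 2 + 4 * m * m * n * K1 ^+ 2.

(** The equation of [be] is differenced between [x] and [x + wJ r] and multiplied by [q r x / hJ r].
    Each direction may spend only the share [(4 * m)^-1] of the squares of [G], since all [m] of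
    them draw on the same good terms. *)
Let per_direction x be r e : 0 < e -> - e <= fd_op w h sg b c f be u x ->
  c be x * q r x ^+ 2
  + \sum_k ((sg be k x ^+ 2 / h + b be k x) / h * 2^-1 * (q r x ^+ 2 - q r (x + w k) ^+ 2)
     + 4^-1 * (sg be k x / h) ^+ 2 * (q r (x + w k) - q r x) ^+ 2)
  - (4 * m)^-1 * (\sum_k (sg be k x / h) ^+ 2 * G k x ^+ 2)
  <= (7 * n * K1 ^+ 2 + 4 * m * n * K1 ^+ 2) * M ^+ 2 + M * (K1 * (U + 1)) + M / hJ r * e.
Proof.
move=> e0 xe; pose hr := hJ r; pose y := x + wJ r.
have hr0 : 0 < hr := hJ_gt0 r.
pose th k := (sg be k y - sg be k x) / hr.
pose bb k := (b be k y - b be k x) / hr.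
pose E k := g (inl k) x; pose E' k := g (inl k) y.
have E'E k : E' k = E k + hr * (g r (x + w k) - g r x) / h.
  rewrite /E' /E /g /= -/hr /y addrAC; field; rewrite !gt_eqF //.
have quot psi : slow psi -> `|(psi y - psi x) / hr| <= K1.
  move=> sp; rewrite normrM normfV (gtr0_norm hr0) ler_pdivrMr //; exact: slowJ.
have sgE k : sg be k y = sg be k x + hr * th k by rewrite /th; field; rewrite gt_eqF.
have bE k : b be k y = b be k x + hr * bb k by rewrite /bb; field; rewrite gt_eqF.
pose P k := sg be k x ^+ 2 / h + b be k x.
pose P' k := sg be k y ^+ 2 / h + b be k y.
have pw k : (P k) / h * 2^-1 * (q r x ^+ 2 - q r (x + w k) ^+ 2)
  + 4^-1 * (sg be k x / h) ^+ 2 * (q r (x + w k) - q r x) ^+ 2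
  + 2 * (sg be k x / h) * th k * q r x * E k - 7 * K1 ^+ 2 * M ^+ 2
  <= q r x / hr * (P' k * E' k - P k * E k).
  have := @bernstein_pointwise h hr (sg be k x) (th k) (b be k x) (bb k) (g r x)
    (g r (x + w k)) (E k) K1 M hr0 (hJh r) (b_ge0 be k x) (quot _ (sg_slow be k))
    (quot _ (b_slow be k)) K1_ge1 (q_le r x) (g_leM r _).
  rewrite -E'E => /(_ (g_normM _ _)); rewrite -sgE -bE; exact.
have := ler_sum (index_enum I) (fun k (_ : xpredT k) => pw k).
rewrite -[X in _ <= X]mulr_sumr [X in _ <= _ * X]sumrB.
set T := \sum_k P' k * E' k - \sum_k P k * E k.
have Tle : q r x / hr * T <= - c be x * q r x ^+ 2 + M * (K1 * (U + 1)) + M / hr * e.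
  (* One control serves both points: optimal up to [e] at [x], merely admissible at [y]. This has
     the right sign because [q] is a negative part and so nonnegative. *)
  have T1 : T <= c be y * u y - c be x * u x - (f be y - f be x) + e.
    have := super be y; rewrite /fd_op; under eq_bigr do rewrite -/(P' _) -/(E' _).
    move: xe; rewrite /fd_op; under eq_bigr do rewrite -/(P _) -/(E _).
    by rewrite /T; lra.
  have qhr : 0 <= q r x / hr by rewrite divr_ge0 // ltW.
  apply: (le_trans (ler_wpM2l qhr T1)).
  have -> : c be y * u y - c be x * u x - (f be y - f be x) + e =
     hr * (c be x * g r x + (c be y - c be x) / hr * u y - (f be y - f be x) / hr) + e.
    by rewrite /g -/hr -/y; field; rewrite gt_eqF.
  have -> : q r x / hr * (hr * (c be x * g r x + (c be y - c be x) / hr * u y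
       - (f be y - f be x) / hr) + e) =
     c be x * (q r x * g r x) + q r x * ((c be y - c be x) / hr * u y - (f be y - f be x) / hr)
     + q r x / hr * e.
    by field; rewrite gt_eqF.
  have -> : q r x * g r x = - q r x ^+ 2.
    rewrite [g r x]max0 -/(q r x) mulrBr [X in X - _](_ : _ = 0); first by rewrite sub0r expr2.
    rewrite /q; case: (leP 0 (g r x)) => g0.
      by rewrite (_ : Num.max 0 (- g r x) = 0) ?mul0r //; apply/max_idPl; rewrite oppr_le0.
    by rewrite mulr0.
  rewrite mulrN -mulNr; apply: lerD; last first.
    by rewrite ler_pM2r // ler_pM2r ?invr_gt0.
  rewrite lerD2l.
  apply: (le_trans (ler_norm _)); rewrite normrM ger0_norm //.
  apply: ler_pM => //; apply: (le_trans (ler_normB _ _)); rewrite mulrDr mulr1 lerD ?quot //.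
  by rewrite normrM ler_pM // quot.
move=> pws; have {pws Tle} := le_trans pws Tle.
have -> : \sum_k (P k / h * 2^-1 * (q r x ^+ 2 - q r (x + w k) ^+ 2)
  + 4^-1 * (sg be k x / h) ^+ 2 * (q r (x + w k) - q r x) ^+ 2
  + 2 * (sg be k x / h) * th k * q r x * E k - 7 * K1 ^+ 2 * M ^+ 2) =
  \sum_k (P k / h * 2^-1 * (q r x ^+ 2 - q r (x + w k) ^+ 2)
  + 4^-1 * (sg be k x / h) ^+ 2 * (q r (x + w k) - q r x) ^+ 2)
  + \sum_k (2 * (sg be k x / h) * th k * q r x * E k) - 7 * n * K1 ^+ 2 * M ^+ 2.
  rewrite sumrB big_split /= sumI_cst; ring.
have thE k : th (opp k) = th k by rewrite /th !sg_opp.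
rewrite sum_g_G; last by move=> k; rewrite thE sg_opp.
have m0 : 0 < m by rewrite ltr0n card_sum card_bool addn2.
(* Young's inequality with weight [4 * m], where [th k * q r x] is at most [K1 * M] in absolute
   value. *)
have AG : - ((4 * m)^-1 * (\sum_k (sg be k x / h) ^+ 2 * G k x ^+ 2) + 4 * m * n * K1 ^+ 2 * M ^+ 2)
   <= \sum_k (2 * (sg be k x / h) * th k * q r x * G k x).
  have -> : 4 * m * n * K1 ^+ 2 * M ^+ 2 = \sum_(k : I) 4 * m * (K1 ^+ 2 * M ^+ 2).
    by rewrite sumI_cst; ring.
  rewrite mulr_sumr -big_split /= -sumrN; apply: ler_sum => k _.
  have tq : (th k * q r x) ^+ 2 <= K1 ^+ 2 * M ^+ 2.
    rewrite -exprMn -real_normK ?num_real // lerXn2r ?nnegrE ?mulr_ge0 //; first by rewrite (le_trans ler01).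
    by rewrite normrM ler_pM // ?(ger0_norm (q_ge0 _ _)) ?quot.
  have mtq : 4 * m * (th k * q r x) ^+ 2 <= 4 * m * (K1 ^+ 2 * M ^+ 2).
    by rewrite ler_pM2l // mulr_gt0.
  have : 0 <= (4 * m)^-1 * ((sg be k x / h) * G k x + 4 * m * (th k * q r x)) ^+ 2.
    by rewrite mulr_ge0 ?sqr_ge0 // invr_ge0 mulr_ge0 // ltW.
  have -> : (4 * m)^-1 * ((sg be k x / h) * G k x + 4 * m * (th k * q r x)) ^+ 2 =
    (4 * m)^-1 * ((sg be k x / h) ^+ 2 * G k x ^+ 2) + 2 * (sg be k x / h) * th k * q r x * G k x
    + 4 * m * (th k * q r x) ^+ 2.
    by field; rewrite !gt_eqF.
  lra.
rewrite /P /hr; lra.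
Qed.

(** Once [la] exceeds [N] by 1, the terms quadratic in [M] are absorbed and
    [M ^+ 2 <= m * M * K1 * (U + 1)] remains, free of [h]. *)
Lemma gradient_bound : N + 1 <= la -> forall x, `|u (x + w0) - u x| <= m * K1 * (U + 1) * h0.
Proof.
move=> laN.
have K10 : 0 <= K1 by rewrite (le_trans ler01).
have n0 : 0 <= n by [].
have m0 : 0 < m by rewrite ltr0n card_sum card_bool addn2.
pose C1 := n * ((K1 ^+ 2 / h + K1) / h * 2^-1).
have K2h : 0 <= K1 ^+ 2 / h by rewrite divr_ge0 ?sqr_ge0 // ltW.
have C10 : 0 <= C1.
  by rewrite mulr_ge0 // mulr_ge0 ?invr_ge0 // divr_ge0 ?(ltW h_gt0) // addr_ge0.
pose C2' := \sum_r (M / hJ r).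
have key e : 0 < e -> la * (S - e) <= N * S + m * (M * (K1 * (U + 1))) + C2' * e + C1 * e.
  move=> e0.
  have [_ [x _ <-] Wx] : exists2 y, range W y & S - e < y.
    by apply: sup_adherent.
  have [be xe] := sub x e0.
  have := ler_sum (index_enum (I + bool)%type) (fun r (_ : xpredT r) => per_direction r e0 xe).
  set Z := \sum_k (sg be k x / h) ^+ 2 * G k x ^+ 2.
  pose sA := \sum_r \sum_k (sg be k x ^+ 2 / h + b be k x) / h / 2
    * (q r x ^+ 2 - q r (x + w k) ^+ 2).
  pose sB := \sum_r \sum_k 4^-1 * (sg be k x / h) ^+ 2 * (q r (x + w k) - q r x) ^+ 2.
  rewrite [X in X <= _ -> _](_ : _ = c be x * W x + (sA + sB) - (4 * m)^-1 * Z * m); last first.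
    rewrite sumrB big_split /=; congr (_ + _ - _).
    - by rewrite /W mulr_sumr.
    - rewrite /sA /sB -big_split /=; apply: eq_bigr => r _; exact: big_split.
    - exact: sum_cst.
  rewrite [X in _ <= X -> _](_ : _ = ((7 * n * K1 ^+ 2 + 4 * m * n * K1 ^+ 2) * M ^+ 2
      + M * (K1 * (U + 1))) * m + C2' * e); last first.
    by rewrite big_split /= sum_cst /C2' mulr_suml.
  (* [x] nearly maximizes [W], so the differences of [W] are at least [- e]. [C1] blows up as [h]
     tends to 0, but [e] is sent to 0 at fixed [h]. *)
  have sA_ge : - (C1 * e) <= sA.
    rewrite /sA exchange_big /=.
    have -> : - (C1 * e) = \sum_(k : I) - ((K1 ^+ 2 / h + K1) / h * 2^-1 * e).
      by rewrite sumI_cst /C1; ring.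
    apply: ler_sum => k _; rewrite -mulr_sumr sumrB -/(W x) -/(W (x + w k)).
    have P0 : 0 <= (sg be k x ^+ 2 / h + b be k x) / h / 2.
      rewrite mulr_ge0 ?invr_ge0 // divr_ge0 ?(ltW h_gt0) // addr_ge0 //.
      by rewrite divr_ge0 ?sqr_ge0 // ltW.
    have PK : (sg be k x ^+ 2 / h + b be k x) / h / 2 <= (K1 ^+ 2 / h + K1) / h / 2.
      rewrite ler_pM2r ?invr_gt0 // ler_pM2r ?invr_gt0 // lerD //.
      rewrite ler_pM2r ?invr_gt0 // -real_normK ?num_real // lerXn2r ?nnegrE //.
    have We : - e <= W x - W (x + w k) by have := W_le (x + w k); lra.
    apply: le_trans (ler_wpM2l P0 We).
    by rewrite mulrN lerN2 ler_pM2r.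
  (* For each [k] only the direction [inl (opp k)] is kept, whose increment is [G k x]. *)
  have sB_ge : 4^-1 * Z <= sB.
    rewrite /sB exchange_big /= /Z mulr_sumr; apply: ler_sum => k _.
    rewrite (bigD1 (inl (opp k))) //= -/(G k x) mulrA lerDl.
    by apply: sumr_ge0 => r _; apply: mulr_ge0 (sqr_ge0 _); apply: mulr_ge0 (sqr_ge0 _); rewrite invr_ge0.
  have cW : la * (S - e) <= c be x * W x.
    have la0 : 0 <= la.
      rewrite (le_trans _ laN) // addr_ge0 // addr_ge0 ?mulr_ge0 ?sqr_ge0 // ltW //.
    apply: (@le_trans _ _ (la * W x)); first by rewrite ler_wpM2l // ltW.
    by rewrite ler_wpM2r.
  have -> : (4 * m)^-1 * Z * m = 4^-1 * Z by field; rewrite !gt_eqF.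
  rewrite ME /N; lra.
have lS : la * S <= N * S + m * (M * (K1 * (U + 1))).
  apply/ler_addgt0Pr => e e0.
  pose C := la + C2' + C1 + 1.
  have C0 : 0 < C.
    have : 0 <= C2' by apply: sumr_ge0 => r _; rewrite divr_ge0 // ltW.
    have : 0 <= N by rewrite /N addr_ge0 // ?mulr_ge0 ?sqr_ge0 // ltW.
    by rewrite /C; lra.
  have e'0 := divr_gt0 e0 C0.
  have eE : C * (e / C) = e by field; rewrite gt_eqF.
  rewrite -[X in _ <= _ + X]eE; have := key _ e'0.
  move: (e / C) e'0 => e' e'0; rewrite /C; lra.
have MM : M <= m * (K1 * (U + 1)).
  have [M0|] := ltP 0 M; last first.
    by move=> /le_trans -> //; rewrite mulr_ge0 ?(ltW m0) // mulr_ge0 // addr_ge0.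
  rewrite -(ler_pM2r M0) -expr2 ME.
  have : (N + 1) * S <= la * S by rewrite ler_wpM2r.
  lra.
move=> x; have := g_normM (inr true) x; rewrite /g /= normrM normfV (gtr0_norm h0_gt0).
rewrite ler_pdivrMr // => /le_trans -> //; rewrite ler_pM2r //.
by rewrite -mulrA.
Qed.
End gradient.
End Bernstein.

(** * Isaacs equations and switching systems *)

Section Isaacs.
Variable R : realType.

(* Perron's method: the supremum of all subsolutions cannot be increased at a
   single point. *)
Lemma isaacs_exists (X B E : Type) (T : B -> E -> (X -> R) -> X -> R) (C : R) :
  0 <= C -> inhabited E ->
  (forall b e u v, (forall x, u x <= v x) -> forall x, T b e u x <= T b e v x) ->
  (forall b e x, T b e (fun=> C) x <= C) ->
  (forall x, exists b, forall e, - C <= T b e (fun=> - C) x) ->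
  exists u : X -> R,
    [/\ forall x, `|u x| <= C,
        forall x eta, 0 < eta -> exists b, forall e, u x <= T b e u x + eta &
        forall x b eta, 0 < eta -> exists e, T b e u x <= u x + eta].
Proof.
move=> C0 [e0] mono Tup Tlo.
pose subsol (v : X -> R) := (forall x, - C <= v x <= C) /\
  (forall x eta, 0 < eta -> exists b, forall e, v x <= T b e v x + eta).
have subC : subsol (fun=> - C).
  split=> [x|x eta eta0]; first by rewrite lexx /=; lra.
  have [b Tb] := Tlo x; exists b => e; have := Tb e; lra.
pose vals x := [set v x | v in subsol].
have hs x : has_sup (vals x).
  split; first by exists (- C), (fun=> - C).
  by exists C => _ [v [vC _] <-]; case/andP: (vC x).
pose u x := sup (vals x).
have uge v x : subsol v -> v x <= u x.
  by move=> sv; apply: (ub_le_sup (hs x).2); exists v.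
have ule x : u x <= C.
  apply: ge_sup; first exact: (hs x).1.
  by move=> _ [v [vC _] <-]; case/andP: (vC x).
have ulo x : - C <= u x by exact: (uge (fun=> - C)).
have usub x eta : 0 < eta -> exists b, forall e, u x <= T b e u x + eta.
  move=> eta0; have eta2 : 0 < eta / 2 by rewrite divr_gt0.
  have [_ [v sv <-] vx] : exists2 y, vals x y & u x - eta / 2 < y by apply: sup_adherent.
  have [b vb] := sv.2 x _ eta2; exists b => e.
  have := vb e; have := mono b e v u (fun y => uge v y sv) x; lra.
exists u; split => // [x|x0 b eta eta0]; first by rewrite ler_norml ulo ule.
apply: contrapT => /forallNP noe.
have big e : u x0 + eta < T b e u x0 by rewrite ltNge; apply/negP/noe.
pose v x := if `[< x = x0 >] then u x0 + eta else u x.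
have uv x : u x <= v x by rewrite /v; case: asboolP => [->|//]; lra.
have sv : subsol v.
  split=> [x|x e e_gt0].
    rewrite /v; case: asboolP => _; last by rewrite ulo ule.
    (* The raised value stays below [C]: it lies below a value of [T] at [u], hence below [T] at the
       constant [C]. *)
    have := big e0; have := mono b e0 _ _ ule x0; have := Tup b e0 x0; have := ulo x0.
    by move=> ? ? ? ?; apply/andP; split; lra.
  rewrite {1}/v; case: asboolP => [->|_].
    by exists b => e'; have := big e'; have := mono b e' _ _ uv x0; lra.
  have [b' ub'] := usub x e e_gt0; exists b' => e'.
  by have := ub' e'; have := mono b' e' _ _ uv x; lra.
have := uge v x0 sv; rewrite /v; case: asboolP => // _; lra.
Qed.
End Isaacs.

(** * Semi-Lagrangian scheme, coupling, and existence for the switching systems *)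

Section SemiLagrangian.
Variables (R : realType) (d d1 : nat) (A : metricType R).
Variables (D : coefficients d d1 A) (K lambda : R).
Hypotheses (sa : standing_assumptions K lambda D) (K_ge1 : 1 <= K) (d1_gt0 : (0 < d1)%N).
Implicit Types (x y z e : 'rV[R]_d) (u : 'rV[R]_d -> R) (al be : A).

Local Notation I := (signed_index d1).
Let n : R := #|{: bool * 'I_d1}|%:R.

Lemma card_signed_gt0 : 0 < n.
Proof. by rewrite ltr0n card_prod card_bool card_ord muln_gt0. Qed.
Let n0 := card_signed_gt0.

Let K0 : 0 <= K. Proof. exact: le_trans ler01 K_ge1. Qed.

Let sum_cst (a : R) : \sum_(k : I) a = a * n.
Proof. by rewrite sumr_const -mulr_natr /n; congr (_ * _%:R); apply: eq_card. Qed.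

Lemma opp_indexK : involutive (@opp_index d1).
Proof. by case=> b i; rewrite /opp_index /= negbK. Qed.

Variable tau : R.
Hypotheses (tau_gt0 : 0 < tau) (tau_n : n * tau <= 1) (tau_c : tau * (lambda + K) <= 1).

Definition step al (k : I) y : R := Num.sqrt (n * tau) * sigma_coef D al k y + n * tau * b_coef D al k y.

(* One step of the semi-Lagrangian scheme at [x], with coefficients frozen at [y]. *)
Definition SL al y u x : R :=
  (1 - tau * c_coef D al y) * (n^-1 * \sum_(k : I) u (x + step al k y *: ell D k))
  + tau * f_coef D al y.

Let c_le al y : tau * c_coef D al y <= 1.
Proof.
apply: le_trans tau_c; rewrite ler_pM2l //.
by have [+ _] := c_bl sa al => /(_ y); rewrite ler_norml => /andP[_]; lra.
Qed.

Lemma SL_mono al y u v : (forall x, u x <= v x) -> forall x, SL al y u x <= SL al y v x.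
Proof.
move=> uv x; rewrite lerD2r ler_wpM2l ?subr_ge0 // ler_pM2l ?invr_gt0 //.
by apply: ler_sum.
Qed.

Lemma SL_cst al y (a : R) x : SL al y (fun=> a) x = a - tau * (c_coef D al y * a - f_coef D al y).
Proof. by rewrite /SL sum_cst; field; rewrite gt_eqF. Qed.

(** Barriers for Perron's method: [c >= lambda >= 1] makes [c * K] dominate [f]. *)
Lemma SL_box al y x (la1 : 1 <= lambda) :
  SL al y (fun=> K) x <= K /\ - K <= SL al y (fun=> - K) x.
Proof.
have [+ _] := f_bl sa al => /(_ y); rewrite ler_norml => /andP[f1 f2].
have := c_ge sa al y => cl.
have cK : K <= c_coef D al y * K by rewrite ler_peMl //; lra.
have t0 := ltW tau_gt0; rewrite !SL_cst; split.
  have : 0 <= tau * (c_coef D al y * K - f_coef D al y) by rewrite mulr_ge0 //; lra.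
  lra.
have : 0 <= tau * (c_coef D al y * K + f_coef D al y) by rewrite mulr_ge0 //; lra.
lra.
Qed.

Definition dot x y : R := \sum_(i < d) x 0 i * y 0 i.

Lemma sqn_line z (r : R) l : sqn (z + r *: l) = sqn z + 2 * r * dot z l + r ^+ 2 * sqn l.
Proof.
rewrite /sqn /dot !mulr_sumr -!big_split /=; apply: eq_bigr => i _.
by rewrite !mxE; ring.
Qed.

Lemma sqnD z w : sqn (z + w) <= 2 * sqn z + 2 * sqn w.
Proof.
rewrite /sqn !mulr_sumr -big_split /=; apply: ler_sum => i _; rewrite mxE.
have := sqr_ge0 (z 0 i - w 0 i); nra.
Qed.

Lemma dot_le z l : 2 * dot z l <= sqn z + sqn l.
Proof.
rewrite /sqn /dot mulr_sumr -big_split /=; apply: ler_sum => i _.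
have := sqr_ge0 (z 0 i - l 0 i); nra.
Qed.

Lemma dotNr z l : dot z (- l) = - dot z l.
Proof. by rewrite /dot -sumrN; apply: eq_bigr => i _; rewrite mxE mulrN. Qed.

Lemma dotZr z l (r : R) : dot z (r *: l) = r * dot z l.
Proof. by rewrite /dot mulr_sumr; apply: eq_bigr => i _; rewrite mxE mulrCA. Qed.

Lemma sum_odd0 (F : I -> R) : (forall k, F (opp_index k) = - F k) -> \sum_(k : I) F k = 0.
Proof.
move=> FN; have H : \sum_(k : I) F k = - \sum_(k : I) F k.
  rewrite {1}(reindex_inj (can_inj opp_indexK)) /= -sumrN.
  by apply: eq_bigr => k _; rewrite FN.
lra.
Qed.

Let sqn_ell k : sqn (ell D k) <= K ^+ 2.
Proof. by rewrite -enorm_sqr lerXn2r ?nnegrE ?enorm_ge0 ?(ell_le sa). Qed.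

(* Coupling the schemes started at [x] and [y] through the same noise. *)
Lemma coupling al x y e1 e2 (rho : R) : sqn (e1 - e2) <= rho ^+ 2 ->
  n^-1 * \sum_(k : I) (sqn ((x + step al k (x + e1) *: ell D k)
         - (y + step al k (y + e2) *: ell D k)) + rho ^+ 2)
  <= (sqn (x - y) + rho ^+ 2) * (1 + 11 * n * K ^+ 4 * tau).
Proof.
move=> er; set P := sqn (x - y) + _.
have P0 : 0 <= P by rewrite addr_ge0 ?sqn_ge0 ?sqr_ge0.
have inc psi : bounded_lipschitz K psi -> (psi (x + e1) - psi (y + e2)) ^+ 2 <= 2 * K ^+ 2 * P.
  move=> [_ lpsi]; rewrite -real_normK ?num_real //.
  apply: (@le_trans _ _ ((K * enorm (x + e1 - (y + e2))) ^+ 2)).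
    by rewrite lerXn2r ?nnegrE ?mulr_ge0 ?enorm_ge0.
  rewrite exprMn enorm_sqr opprD addrACA (_ : 2 * K ^+ 2 * P = K ^+ 2 * (2 * P)); last by ring.
  rewrite ler_wpM2l ?sqr_ge0 //.
  by apply: (le_trans (sqnD _ _)); rewrite /P; lra.
pose s1 := Num.sqrt (n * tau); pose s2 := n * tau.
have s20 : 0 <= s2 by rewrite mulr_ge0 // ltW.
have s1E : s1 ^+ 2 = s2 by rewrite sqr_sqrtr.
pose ds k := sigma_coef D al k (x + e1) - sigma_coef D al k (y + e2).
pose db k := b_coef D al k (x + e1) - b_coef D al k (y + e2).
pose z := x - y.
have odd0 : \sum_(k : I) 2 * s1 * ds k * dot z (ell D k) = 0.
  apply: sum_odd0 => k.
  have -> : ell D (opp_index k) = - ell D k by rewrite (ell_opp sa k) opprK.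
  by rewrite dotNr mulrN /ds -!(sigma_opp sa).
rewrite mulrC ler_pdivrMr //.
apply: (@le_trans _ _ (\sum_(k : I) (2 * s1 * ds k * dot z (ell D k) + P * (1 + 11 * K ^+ 4 * s2)))).
  apply: ler_sum => k _.
  have -> : x + step al k (x + e1) *: ell D k - (y + step al k (y + e2) *: ell D k)
     = z + (s1 * ds k + s2 * db k) *: ell D k.
    rewrite opprD addrACA -scalerBl /z; congr (_ + _ *: _).
    by rewrite /step -/s1 -/s2 /ds /db; ring.
  rewrite sqn_line.
  have ds2 : ds k ^+ 2 <= 2 * K ^+ 2 * P := inc _ (sigma_bl sa al k).
  have db2 : db k ^+ 2 <= 2 * K ^+ 2 * P := inc _ (b_bl sa al k).
  have l2 := sqn_ell k; have l20 := sqn_ge0 (ell D k).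
  set L := sqn (ell D k) in l2 l20 *; set dz := dot z (ell D k).
  have zP : sqn z <= P by rewrite lerDl sqr_ge0.
  have K2 : 0 <= K ^+ 2 := sqr_ge0 K.
  have dzb : 2 * (s2 * db k) * dz <= s2 * (P + 2 * K ^+ 4 * P).
    have -> : 2 * (s2 * db k) * dz = s2 * (2 * dot z (db k *: ell D k)).
      by rewrite dotZr -/dz; ring.
    rewrite ler_wpM2l //; apply: (le_trans (dot_le _ _)).
    rewrite lerD //; rewrite -enorm_sqr enormZ exprMn real_normK ?num_real // enorm_sqr.
    apply: (le_trans (ler_pM (sqr_ge0 _) l20 db2 l2)).
    by rewrite le_eqVlt; apply/orP; left; apply/eqP; ring.
  have sq : (s1 * ds k + s2 * db k) ^+ 2 * L <= s2 * (8 * K ^+ 4 * P).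
    apply: (@le_trans _ _ ((2 * s2 * (2 * K ^+ 2 * P) + 2 * s2 * (2 * K ^+ 2 * P)) * K ^+ 2)); last first.
      by rewrite le_eqVlt; apply/orP; left; apply/eqP; ring.
    rewrite ler_pM ?sqr_ge0 //.
    apply: (@le_trans _ _ (2 * s2 * ds k ^+ 2 + 2 * s2 * db k ^+ 2)).
      have s22 : s2 ^+ 2 <= s2 by rewrite expr2 ler_piMl.
      have := sqr_ge0 (s1 * ds k - s2 * db k).
      have : s2 ^+ 2 * db k ^+ 2 <= s2 * db k ^+ 2 by rewrite ler_wpM2r ?sqr_ge0.
      rewrite -s1E; nra.
    by rewrite lerD // ler_wpM2l // mulr_ge0.
  (* Collecting terms, 11 = 1 + 2 + 8, after the lone [s2 * P] is multiplied by [K ^+ 4]. *)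
  have K4 : 1 <= K ^+ 4 by rewrite exprn_ege1.
  have : s2 * P <= s2 * P * K ^+ 4 by rewrite ler_peMr // mulr_ge0.
  have PE : P = sqn z + rho ^+ 2 by [].
  clearbody P; lra.
rewrite big_split /= odd0 add0r sum_cst /s2.
by rewrite le_eqVlt; apply/orP; left; apply/eqP; ring.
Qed.

(** Both inequalities use the same control [be] and the same cost [p], which cancels, so only
    coefficients at two nearby points are compared. The increments of [c] and [f] cost
    [tau * (2 * K * (U + 1))] times the smoothed distance, whence the slope; lambda beats the growth
    rate of that distance. *)
Lemma doubling (u1 u2 : A -> 'rV[R]_d -> R) (U rho : R) :
  0 < rho -> (forall al x, `|u1 al x| <= U) -> (forall al x, `|u2 al x| <= U) ->
  6 * n * K ^+ 4 + 1 <= lambda ->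
  (forall al x y eta, 0 < eta -> exists be e1 e2 (p : R), [/\ sqn (e1 - e2) <= rho ^+ 2,
     u1 al x <= SL be (x + e1) (u1 be) x - p + eta &
     SL be (y + e2) (u2 be) y - p <= u2 al y + eta]) ->
  forall al x y, u1 al x - u2 al y <= 2 * K * (U + 1) * Num.sqrt (sqn (x - y) + rho ^+ 2).
Proof.
move=> rho0 u1U u2U laG H al0 x0 y0.
have U0 : 0 <= U by rewrite (le_trans _ (u1U al0 x0)).
pose M := 2 * K * (U + 1); have M0 : 0 <= M by rewrite mulr_ge0 ?mulr_ge0 // addr_ge0.
pose Phi z := sqn z + rho ^+ 2; pose phi z := Num.sqrt (Phi z).
have Phi0 z : 0 < Phi z by rewrite ltr_wpDl ?sqn_ge0 // exprn_gt0.
have phi0 z : 0 < phi z by rewrite sqrtr_gt0.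
have phiE z : phi z ^+ 2 = Phi z by rewrite sqr_sqrtr // ltW.
pose val (t : A * ('rV[R]_d * 'rV[R]_d)) := u1 t.1 t.2.1 - u2 t.1 t.2.2 - M * phi (t.2.1 - t.2.2).
rewrite -subr_le0 -/M -/(phi _) leNgt; apply/negP => val0.
have hs : has_sup (range val).
  split; first by exists (val (al0, (x0, y0))), (al0, (x0, y0)).
  exists (2 * U) => _ [t _ <-]; rewrite /val.
  have := u1U t.1 t.2.1; have := u2U t.1 t.2.2; rewrite !ler_norml => /andP[? ?] /andP[? ?].
  have : 0 <= M * phi (t.2.1 - t.2.2) by rewrite mulr_ge0 // ltW.
  lra.
set S := sup (range val).
have S_ge t : val t <= S by apply: (ub_le_sup hs.2); exists t.
have S0 : 0 < S by apply: lt_le_trans val0 (S_ge (al0, (x0, y0))).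
have la0 : 0 < lambda.
  apply: lt_le_trans laG; rewrite ltr_wpDl // mulr_ge0 ?exprn_ge0 //.
  by rewrite mulr_ge0 // ltW.
(* Three errors [eta] occur, one from near-maximality and two from the equations; together they stay
   below [tau * lambda * S]. *)
pose eta := tau * lambda * S / 4.
have eta0 : 0 < eta by rewrite divr_gt0 // !mulr_gt0.
have [_ [[al [x y]] _ <-] Sval] : exists2 v, range val v & S - eta < v by apply: sup_adherent.
have [be [e1 [e2 [p [e12 h1 h2]]]]] := H al x y _ eta0.
set c1 := c_coef D be (x + e1); set c2 := c_coef D be (y + e2).
set f1 := f_coef D be (x + e1); set f2 := f_coef D be (y + e2).
pose X k := x + step be k (x + e1) *: ell D k.
pose Y k := y + step be k (y + e2) *: ell D k.
pose a1 := n^-1 * \sum_(k : I) u1 be (X k); pose a2 := n^-1 * \sum_(k : I) u2 be (Y k).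
pose F := phi (x - y); have F0 : 0 < F := phi0 _.
have ni : 0 < n^-1 by rewrite invr_gt0.
have inc psi : bounded_lipschitz K psi -> `|psi (x + e1) - psi (y + e2)| <= 2 * K * F.
  move=> [_ lpsi]; apply: (le_trans (lpsi _ _)).
  rewrite [2 * K]mulrC -mulrA ler_wpM2l //.
  rewrite -(@ler_pXn2r _ 2) ?nnegrE ?enorm_ge0 ?mulr_ge0 ?(ltW (phi0 _)) //.
  rewrite exprMn phiE enorm_sqr opprD addrACA; apply: (le_trans (sqnD _ _)).
  by have := sqn_ge0 (x - y); have := sqr_ge0 rho; rewrite /Phi; lra.
have c12 : `|c1 - c2| <= 2 * K * F.
  by have := inc _ (c_bl sa be); congr (`|_| <= _); rewrite /c1 /c2; ring.
have f12 : `|f1 - f2| <= 2 * K * F := inc _ (f_bl sa be).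
have a2U : `|a2| <= U.
  rewrite normrM (gtr0_norm ni) mulrC ler_pdivrMr // (le_trans (ler_norm_sum _ _ _)) //.
  by rewrite -sum_cst; apply: ler_sum => k _; exact: u2U.
(* Half of the 11 of [coupling], since the square root is linearized at [F]; the 6 in the bound on
   lambda exceeds 11 / 2. *)
pose G := 11 / 2 * n * K ^+ 4.
have G0 : 0 <= G by rewrite mulr_ge0 ?exprn_ge0 // mulr_ge0 // ltW.
have avg_phi : n^-1 * \sum_(k : I) phi (X k - Y k) <= F * (1 + G * tau).
  have F2 : 0 < 2 * F by rewrite mulr_gt0.
  apply: (@le_trans _ _ (n^-1 * \sum_(k : I) ((2 * F)^-1 * (Phi (X k - Y k) + F ^+ 2)))).
    rewrite ler_pM2l //; apply: ler_sum => k _.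
    rewrite mulrC ler_pdivlMr // -phiE.
    by have := sqr_ge0 (phi (X k - Y k) - F); nra.
  rewrite -mulr_sumr mulrCA big_split /= mulrDr sum_cst [F ^+ 2 * n]mulrC mulKf ?gt_eqF //.
  rewrite mulrC ler_pdivrMr //.
  have := coupling be x y e12; rewrite -/(Phi (x - y)) -phiE -/F.
  move=> /(lerD (lexx (F ^+ 2))); rewrite addrC => /le_trans; apply.
  by rewrite /G le_eqVlt; apply/orP; left; apply/eqP; field.
have a12 : a1 - a2 <= S + M * (F * (1 + G * tau)).
  apply: (@le_trans _ _ (S + M * (n^-1 * \sum_(k : I) phi (X k - Y k)))); last first.
    by rewrite lerD2l ler_wpM2l.
  rewrite /a1 /a2 -mulrBr -sumrB; set Z := \sum_(k : I) phi _.
  have -> : S + M * (n^-1 * Z) = n^-1 * (S * n + M * Z) by field; rewrite gt_eqF.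
  rewrite ler_pM2l // /Z.
  rewrite -sum_cst mulr_sumr -big_split /=; apply: ler_sum => k _.
  by have := S_ge (be, (X k, Y k)); rewrite /val /=; lra.
have tc1 : 0 <= 1 - tau * c1 by rewrite subr_ge0; exact: c_le.
have tcl : 1 - tau * c1 <= 1 - tau * lambda by rewrite lerD2l lerN2 ler_pM2l //; exact: (c_ge sa).
set Q := S + _ in a12.
have Q0 : 0 <= Q.
  rewrite addr_ge0 ?(ltW S0) // mulr_ge0 // mulr_ge0 ?(ltW (phi0 _)) //.
  by rewrite addr_ge0 // mulr_ge0 // ltW.
have T1 : (1 - tau * c1) * (a1 - a2) <= (1 - tau * lambda) * Q.
  by apply: (le_trans (ler_wpM2l tc1 a12)); rewrite ler_wpM2r.
have T2 : - (tau * (c1 - c2) * a2) <= tau * (2 * K * F * U).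
  rewrite -mulrA -mulrN ler_pM2l // (le_trans (ler_norm _)) // normrN normrM ler_pM //.
have T3 : tau * (f1 - f2) <= tau * (2 * K * F) by rewrite ler_pM2l // (le_trans (ler_norm _)).
have E1 : SL be (x + e1) (u1 be) x = (1 - tau * c1) * a1 + tau * f1 by [].
have E2 : SL be (y + e2) (u2 be) y = (1 - tau * c2) * a2 + tau * f2 by [].
move: Sval; rewrite /val /= -/F => Sval.
have key : tau * lambda * S <= 3 * eta + M * F * (tau * (1 + G - lambda) - tau ^+ 2 * lambda * G).
  have ME : M = 2 * K * (U + 1) by [].
  rewrite E1 in h1; rewrite E2 in h2; rewrite /Q in T1.
  have -> : M * F * (tau * (1 + G - lambda) - tau ^+ 2 * lambda * G)
    = (1 - tau * lambda) * (M * (F * (1 + G * tau))) - M * F + tau * (2 * K * F * U) + tau * (2 * K * F).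
    by rewrite ME; ring.
  lra.
have : M * F * (tau * (1 + G - lambda) - tau ^+ 2 * lambda * G) <= 0.
  apply: mulr_ge0_le0; first by rewrite mulr_ge0 // ltW.
  rewrite subr_le0; apply: (@le_trans _ _ 0).
    apply: mulr_ge0_le0; first exact: ltW.
    have : 0 <= n * K ^+ 4 by rewrite mulr_ge0 ?exprn_ge0 // ltW.
    rewrite /G; lra.
  by rewrite mulr_ge0 // mulr_ge0 ?sqr_ge0 // ltW.
have : 0 < tau * lambda * S by rewrite !mulr_gt0.
rewrite /eta in key; lra.
Qed.

(** A type rather than a predicate, so that displacements can be moves of a player in
    [isaacs_exists]. *)
Definition ball_of (rho : R) := {e : 'rV[R]_d | enorm e <= rho}.

Lemma ball0 rho : 0 <= rho -> ball_of rho.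
Proof. by move=> r0; exists 0; rewrite /enorm big1 ?sqrtr0 // => i _; rewrite mxE expr0n. Qed.

Definition switch_cost (kappa : R) al be : R := if `[< be = al >] then 0 else kappa.

Hypothesis lambda_ge1 : 1 <= lambda.

(** The current index is made part of the state, which turns the system into one scalar equation.
    The maximizer chooses both [be] and the displacement; the other player is trivial. *)
Lemma switching_sup (kappa rho : R) : 0 <= kappa -> 0 <= rho -> exists u : A -> 'rV[R]_d -> R,
  [/\ forall al x, `|u al x| <= K,
      forall al x eta, 0 < eta -> exists be, exists e : ball_of rho,
        u al x <= SL be (x + sval e) (u be) x - switch_cost kappa al be + eta &
      forall al x be (e : ball_of rho),
        SL be (x + sval e) (u be) x - switch_cost kappa al be <= u al x].
Proof.
move=> k0 r0.
pose T (b : A * ball_of rho) (_ : unit) (u : A * 'rV[R]_d -> R) (z : A * 'rV[R]_d) :=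
  SL b.1 (z.2 + sval b.2) (fun y => u (b.1, y)) z.2 - switch_cost kappa z.1 b.1.
have sc0 al be : 0 <= switch_cost kappa al be by rewrite /switch_cost; case: asboolP.
have [|||u [uK sub sup]] := @isaacs_exists R _ _ _ T K K0 (inhabits tt).
- by move=> b e u v uv x; rewrite lerD2r; apply: SL_mono => y; exact: uv.
- move=> b e x; have [+ _] := SL_box b.1 (x.2 + sval b.2) x.2 lambda_ge1.
  by have := sc0 x.1 b.1; rewrite /T; lra.
- move=> x; exists (x.1, ball0 r0) => e; rewrite /T /switch_cost asboolT // subr0.
  exact: (SL_box _ _ _ lambda_ge1).2.
exists (fun al x => u (al, x)); split => [al x|al x eta eta0|al x be e]; first exact: uK.
- by have [b ub] := sub (al, x) eta eta0; exists b.1, b.2; exact: (ub tt).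
- by apply/ler_addgt0Pr => eta eta0; have [[] ?] := sup (al, x) (be, e) eta eta0.
Qed.

(** Here [be] is chosen before the displacement, so the inequality of the chosen control holds for
    every displacement in the ball at once. *)
Lemma switching_inf (kappa rho : R) : 0 <= kappa -> 0 <= rho -> exists u : A -> 'rV[R]_d -> R,
  [/\ forall al x, `|u al x| <= K,
      forall al x eta, 0 < eta -> exists be, forall e : ball_of rho,
        u al x <= SL be (x + sval e) (u be) x - switch_cost kappa al be + eta &
      forall al x be eta, 0 < eta -> exists e : ball_of rho,
        SL be (x + sval e) (u be) x - switch_cost kappa al be <= u al x + eta].
Proof.
move=> k0 r0.
pose T (be : A) (e : ball_of rho) (u : A * 'rV[R]_d -> R) (z : A * 'rV[R]_d) :=
  SL be (z.2 + sval e) (fun y => u (be, y)) z.2 - switch_cost kappa z.1 be.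
have sc0 al be : 0 <= switch_cost kappa al be by rewrite /switch_cost; case: asboolP.
have [|||u [uK sub sup]] := @isaacs_exists R _ _ _ T K K0 (inhabits (ball0 r0)).
- by move=> b e u v uv x; rewrite lerD2r; apply: SL_mono => y; exact: uv.
- move=> b e x; have [+ _] := SL_box b (x.2 + sval e) x.2 lambda_ge1.
  by have := sc0 x.1 b; rewrite /T; lra.
- move=> x; exists x.1 => e; rewrite /T /switch_cost asboolT // subr0.
  exact: (SL_box _ _ _ lambda_ge1).2.
exists (fun al x => u (al, x)); split => [al x|al x eta eta0|al x be eta eta0]; first exact: uK.
- by have [b ub] := sub (al, x) eta eta0; exists b.
- by have [e ?] := sup (al, x) be eta eta0; exists e.
Qed.
End SemiLagrangian.

(** * Comparison of viscosity solutions with smooth functions *)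

Section ViscosityComparison.
Variables (R : realType) (d d1 : nat) (A : metricType R).
Variables (D : coefficients d d1 A) (K lambda : R).
Hypotheses (sa : standing_assumptions K lambda D) (K_ge1 : 1 <= K).
Hypothesis lambda_ge1 : 1 <= lambda.
Implicit Types (x y z : 'rV[R]_d) (u v phi : 'rV[R]_d -> R) (al be : A).

Local Notation I := (signed_index d1).
Let n : R := #|{: bool * 'I_d1}|%:R.

Lemma coord_lip (i : 'I_d) : lip 1 (fun y : 'rV[R]_d => y 0 i).
Proof.
by move=> x y; rewrite mul1r; have := coord_le_enorm (x - y) i; rewrite !mxE.
Qed.

Lemma fun_continuousD u v : continuous u -> continuous v -> continuous (fun y => u y + v y).
Proof. by move=> cu cv y; apply: continuousD; [exact: cu|exact: cv]. Qed.

Lemma fun_continuousM u v : continuous u -> continuous v -> continuous (fun y => u y * v y).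
Proof. by move=> cu cv y; apply: continuousM; [exact: cu|exact: cv]. Qed.

Lemma fun_continuous_cst (a : R) : continuous (fun _ : 'rV[R]_d => a).
Proof. exact: (lip_continuous (lip_cst a)). Qed.

Lemma continuous_sqnB x0 : continuous (fun y => sqn (y - x0)).
Proof.
have c i : continuous (fun y : 'rV[R]_d => (y - x0) 0 i ^+ 2).
  have ci : continuous (fun y : 'rV[R]_d => (y - x0) 0 i).
    by apply: (lip_continuous (lip_shift (- x0) (@coord_lip i))).
  by under eq_fun do rewrite expr2; exact: fun_continuousM.
rewrite /sqn; elim: (index_enum _) => [|i r IH].
  by under eq_fun do rewrite big_nil; exact: fun_continuous_cst.
by under eq_fun do rewrite big_cons; exact: fun_continuousD.
Qed.

(** The space is not compact; outside a box around [x0] the penalty exceeds the oscillation [2 * U]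
    of [g], so the minimum over the box is global. *)
Lemma penalized_min (g : 'rV[R]_d -> R) (U q : R) x0 : 0 < q -> continuous g ->
  (forall x, `|g x| <= U) ->
  exists x1, forall y, g x1 + q * sqn (x1 - x0) <= g y + q * sqn (y - x0).
Proof.
move=> q0 cg gU.
have U0 : 0 <= U by rewrite (le_trans _ (gU x0)).
pose r := 2 * U / q + 1.
have r1 : 1 <= r by rewrite lerDr divr_ge0 // ?mulr_ge0 // ltW.
pose box := [set y : 'rV[R]_d | forall i, `[x0 0 i - r, x0 0 i + r]%classic (y ord0 i)].
have cbox : compact box.
  apply: (@rV_compact _ _ (fun i => `[x0 0 i - r, x0 0 i + r]%classic)) => i.
  exact: segment_compact.
have box0 : box !=set0.
  by exists x0 => i /=; rewrite in_itv /=; apply/andP; split; lra.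
have cG : continuous (fun y => g y + q * sqn (y - x0)).
  apply: fun_continuousD => //.
  by apply: fun_continuousM; [exact: fun_continuous_cst|exact: continuous_sqnB].
have [x1 _ Hx1] := EVT_min_rV box0 cbox (continuous_subspaceT cG).
exists x1 => y; have [/mem_set/Hx1//|ny] := pselect (box y).
have Hx0 : g x1 + q * sqn (x1 - x0) <= g x0.
  have := Hx1 x0; rewrite subrr [sqn 0](_ : _ = 0) ?mulr0 ?addr0.
    by apply; apply/mem_set => i /=; rewrite in_itv /=; apply/andP; split; lra.
  by rewrite /sqn big1 // => i _; rewrite mxE expr0n.
apply: (le_trans Hx0).
have [i yi] : exists i, r < `|y 0 i - x0 0 i|.
  apply: contrapT => /forallNP H; apply: ny => i /=; rewrite in_itv /= lerBlDl -lerBlDr.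
  have := H i => /negP; rewrite -leNgt ler_norml => /andP[? ?]; apply/andP; split; lra.
have : 2 * U <= q * sqn (y - x0).
  have -> : 2 * U = q * (2 * U / q) by field; rewrite gt_eqF.
  rewrite ler_pM2l //; apply: (@le_trans _ _ (r ^+ 2)).
    by rewrite expr2; apply: (@le_trans _ _ (r * 1)); [rewrite mulr1 /r; lra|rewrite ler_pM2l //; lra].
  rewrite -enorm_sqr lerXn2r ?nnegrE ?enorm_ge0 //; first lra.
  by have := coord_le_enorm (y - x0) i; rewrite !mxE => /(le_trans (ltW yi)).
have := gU x0; have := gU y; rewrite !ler_norml => /andP[? ?] /andP[? ?]; lra.
Qed.

Lemma dot_abs z l : 2 * `|dot z l| <= sqn z + sqn l.
Proof.
have sN : sqn (- l) = sqn l by rewrite /sqn; apply: eq_bigr => i _; rewrite mxE sqrrN.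
have h1 := dot_le z l; have := dot_le z (- l); rewrite dotNr sN => h2.
by case: (ger0P (dot z l)) => _; lra.
Qed.

Section test_function.
Variables (phi : 'rV[R]_d -> R) (B s k : R) (x0 : 'rV[R]_d).
Hypothesis sm : smooth 2 B phi.

Let psi y := phi y + s * sqn (y - x0) + k.

Let gradients : exists g1 g2,
  [/\ forall x l, Dl l phi x = \sum_j g1 j x * l 0 j,
      forall x l, Dl l psi x = \sum_j (g1 j x + s * (2 * (x 0 j - x0 0 j))) * l 0 j,
      forall x l, D2l l phi x = \sum_i \sum_j g2 i j x * l 0 i * l 0 j,
      forall x l, D2l l psi x = \sum_i \sum_j (g2 i j x + s * (2 * (i == j)%:R)) * l 0 i * l 0 j &
      C2 psi].
Proof.
have [[Cp lphi] [g1 [[C1 q1] sm1]]] := sm.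
have /choice[g2 Hg2] := fun j => (sm1 j).2.
exists g1, g2.
have q1' : qgrad psi (fun j x => g1 j x + s * (2 * (x 0 j - x0 0 j))).
  exists (C1 + `|s|) => j x t; rewrite /psi.
  have -> : sqn (x + t *: delta_mx 0 j - x0) = sqn (x - x0) + 2 * t * (x 0 j - x0 0 j) + t ^+ 2.
    rewrite addrAC sqn_line; congr (_ + _ + _).
      rewrite /dot (bigD1 j) //= big1 ?addr0; first by rewrite !mxE !eqxx mulr1.
      by move=> i ij; rewrite [delta_mx _ _ _ _]mxE (negPf ij) andbF mulr0.
    by rewrite -enorm_sqr enorm_delta expr1n mulr1.
  rewrite (_ : _ - _ - _ = (phi (x + t *: delta_mx 0 j) - phi x - t * g1 j x) + s * t ^+ 2);
    last by ring.
  rewrite mulrDl (le_trans (ler_normD _ _)) // lerD ?q1 //.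
  by rewrite normrM [`|t ^+ 2|]ger0_norm ?sqr_ge0.
have q2 i : qgrad (g1 i) (g2 i) := (Hg2 i).1.
have q2' i : qgrad (fun x => g1 i x + s * (2 * (x 0 i - x0 0 i)))
    (fun j x => g2 i j x + s * (2 * (i == j)%:R)).
  have [C2 q2i] := q2 i; exists C2 => j x t.
  have := q2i j x t; congr (`|_| <= _); rewrite !mxE /=; ring.
split.
- by move=> x l; rewrite (qgrad_Dl _ (ex_intro _ C1 q1)).
- by move=> x l; rewrite (qgrad_Dl _ q1').
- move=> x l; rewrite /D2l; apply: eq_bigr => i _; apply: eq_bigr => j _.
  by rewrite (qgrad_partial _ (ex_intro _ C1 q1)) (qgrad_partial _ (q2 i)).
- move=> x l; rewrite /D2l; apply: eq_bigr => i _; apply: eq_bigr => j _.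
  by rewrite (qgrad_partial _ q1') (qgrad_partial _ (q2' i)).
have cg1 i : continuous (fun x => g1 i x + s * (2 * (x 0 i - x0 0 i))).
  have [K1 lK1] := (sm1 i).1.
  apply: fun_continuousD; first exact: (lip_continuous lK1).
  apply: fun_continuousM; first exact: fun_continuous_cst.
  apply: fun_continuousM; first exact: fun_continuous_cst.
  apply: fun_continuousD; last exact: fun_continuous_cst.
  exact: (lip_continuous (@coord_lip i)).
have cpsi : continuous psi.
  apply: fun_continuousD; last exact: fun_continuous_cst.
  apply: fun_continuousD; first exact: (lip_continuous lphi).
  by apply: fun_continuousM; [exact: fun_continuous_cst|exact: continuous_sqnB].
split; first exact: (qgrad_C1 cpsi q1' cg1).
move=> i; rewrite (qgrad_partial _ q1'); apply: (qgrad_C1 (cg1 i) (q2' i)) => j.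
have [K1 lK1] := ((Hg2 i).2 j).1.
by apply: fun_continuousD; [exact: (lip_continuous lK1)|exact: fun_continuous_cst].
Qed.

Lemma test_function_C2 : C2 psi.
Proof. by have [g1 [g2 []]] := gradients. Qed.

Lemma L_op_test al x :
  `|L_op D al psi x - (L_op D al phi x - c_coef D al x * (psi x - phi x))|
  <= `|s| * (2 * n * K ^+ 4 * (1 + sqn (x - x0))).
Proof.
have [g1 [g2 [E1 E2 E3 E4 _]]] := gradients.
have D1 l : Dl l psi x = Dl l phi x + s * (2 * dot (x - x0) l).
  rewrite E1 E2 /dot !mulr_sumr -big_split /=; apply: eq_bigr => j _.
  by rewrite !mxE mulrDl -!mulrA.
have D2 l : D2l l psi x = D2l l phi x + s * (2 * sqn l).
  rewrite E3 E4 /sqn !mulr_sumr -big_split /=; apply: eq_bigr => i _.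
  transitivity (\sum_j g2 i j x * l 0 i * l 0 j + \sum_j s * (2 * (i == j)%:R) * l 0 i * l 0 j).
    by rewrite -big_split /=; apply: eq_bigr => j _; rewrite !mulrDl.
  congr (_ + _); rewrite (bigD1 i) //= big1 ?addr0 ?eqxx; first by rewrite mulr1 expr2 !mulrA.
  by move=> j ji; rewrite eq_sym (negPf ji) !mulr0 !mul0r.
pose S2 := \sum_k a_coef D al k x * (s * (2 * sqn (ell D k))).
pose S4 := \sum_k b_coef D al k x * (s * (2 * dot (x - x0) (ell D k))).
have -> : L_op D al psi x - (L_op D al phi x - c_coef D al x * (psi x - phi x)) = S2 + S4.
  have EA : \sum_k a_coef D al k x * D2l (ell D k) psi x =
      \sum_k a_coef D al k x * D2l (ell D k) phi x + S2.
    by rewrite /S2 -big_split /=; apply: eq_bigr => i _; rewrite D2 mulrDr.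
  have EB : \sum_k b_coef D al k x * Dl (ell D k) psi x =
      \sum_k b_coef D al k x * Dl (ell D k) phi x + S4.
    by rewrite /S4 -big_split /=; apply: eq_bigr => i _; rewrite D1 mulrDr.
  pose T1 := \sum_k a_coef D al k x * D2l (ell D k) phi x.
  pose T2 := \sum_k b_coef D al k x * Dl (ell D k) phi x.
  have Lpsi : L_op D al psi x = (T1 + S2) + (T2 + S4) - c_coef D al x * psi x.
    exact: (f_equal2 (fun p q => p + q - c_coef D al x * psi x) EA EB).
  have Lphi : L_op D al phi x = T1 + T2 - c_coef D al x * phi x by [].
  rewrite Lpsi Lphi; move: (T1) (T2) (S2) (S4) (psi x) => ? ? ? ? ?; ring.
have K0 : 0 <= K := le_trans ler01 K_ge1.
have -> : `|s| * (2 * n * K ^+ 4 * (1 + sqn (x - x0))) =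
    \sum_(k : I) `|s| * (2 * K ^+ 4 * (1 + sqn (x - x0))).
  rewrite sumr_const -mulr_natr (_ : #|_| = #|{: bool * 'I_d1}|); last exact: eq_card.
  by rewrite -/n; ring.
rewrite /S2 /S4 -big_split /= (le_trans (ler_norm_sum _ _ _)) //.
apply: ler_sum => i _.
have -> : a_coef D al i x * (s * (2 * sqn (ell D i))) + b_coef D al i x * (s * (2 * dot (x - x0) (ell D i)))
  = s * (sigma_coef D al i x ^+ 2 * sqn (ell D i) + b_coef D al i x * (2 * dot (x - x0) (ell D i))).
  by rewrite /a_coef; field.
rewrite normrM ler_wpM2l // (le_trans (ler_normD _ _)) //.
have sl : sqn (ell D i) <= K ^+ 2 by rewrite -enorm_sqr lerXn2r ?nnegrE ?enorm_ge0 ?(ell_le sa).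
have s2 : sigma_coef D al i x ^+ 2 <= K ^+ 2.
  by rewrite -real_normK ?num_real // lerXn2r ?nnegrE // (sigma_bl sa al i).1.
have T1 : `|sigma_coef D al i x ^+ 2 * sqn (ell D i)| <= K ^+ 4.
  have -> : K ^+ 4 = K ^+ 2 * K ^+ 2 by ring.
  rewrite ger0_norm; last by apply: mulr_ge0 (sqr_ge0 _) (sqn_ge0 _).
  exact: ler_pM (sqr_ge0 _) (sqn_ge0 _) s2 sl.
have T2 : `|b_coef D al i x * (2 * dot (x - x0) (ell D i))| <= K * (sqn (x - x0) + K ^+ 2).
  rewrite normrM ler_pM //; first exact: (b_bl sa al i).1.
  rewrite normrM ger0_norm //; apply: (le_trans (dot_abs _ _)); lra.
have K14 : K <= K ^+ 4 by rewrite exprS ler_peMr // exprn_ege1.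
have K34 : K ^+ 3 <= K ^+ 4 by rewrite [K ^+ 4]exprS ler_peMl // exprn_ge0.
have := sqn_ge0 (x - x0); move: T2; rewrite mulrDr -exprS.
set q := sqn (x - x0) => T2 q0.
have : K * q <= K ^+ 4 * q by rewrite ler_wpM2r.
have : 0 <= K ^+ 4 * q by rewrite mulr_ge0 // exprn_ge0.
lra.
Qed.
End test_function.

Let C3 : R := 2 * n * K ^+ 4.
Let C30 : 0 <= C3.
Proof. by apply: mulr_ge0; [apply: mulr_ge0|apply: exprn_ge0; exact: le_trans ler01 K_ge1]. Qed.

(** [phi] is smooth, so after a quadratic localization it is itself the test function and variables
    are not doubled. *)
Lemma viscosity_subsolution_le v phi (U B E : R) :
  continuous v -> (forall x, `|v x| <= U) -> viscosity_subsolution D v ->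
  smooth 2 B phi -> (forall x, `|phi x| <= U) -> 0 <= E ->
  (forall al x, L_op D al phi x + f_coef D al x <= E) ->
  forall x, v x <= phi x + E / lambda.
Proof.
move=> cv vU vsub sm phiU E0 Lphi xx.
have la0 : 0 < lambda := lt_le_trans ltr01 lambda_ge1.
have la1 := lambda_ge1; have C3_ge0 := C30.
rewrite -lerBlDl leNgt; apply/negP => big.
pose w x := v x - phi x.
have hs : has_sup (range w).
  split; first by exists (w 0), 0.
  exists (2 * U) => _ [x _ <-]; have := vU x; have := phiU x.
  by rewrite /w !ler_norml => /andP[? ?] /andP[? ?]; lra.
set m := sup (range w).
have wm x : w x <= m by apply: (ub_le_sup hs.2); exists x.
have Em : E < lambda * m.
  by rewrite mulrC -ltr_pdivrMr //; exact: lt_le_trans (wm xx).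
have L0 : 0 < lambda + 2 * C3 + 1 by lra.
(* The total loss will be [(lambda + 2 * C3 + 1) * de], half of the gap [lambda * m - E]. *)
pose de := (lambda * m - E) / (2 * (lambda + 2 * C3 + 1)).
have de0 : 0 < de by rewrite divr_gt0 ?mulr_gt0 //; lra.
have deE : 2 * (lambda + 2 * C3 + 1) * de = lambda * m - E by rewrite /de; field; rewrite gt_eqF.
have dem : de <= m.
  rewrite -(ler_pM2l la0); have : 0 <= C3 * de by rewrite mulr_ge0 // ltW.
  have : 0 <= lambda * de by rewrite mulr_ge0 // ltW.
  lra.
have [_ [x0 _ <-] wx0] : exists2 t, range w t & m - de < t by apply: sup_adherent.
have cg : continuous (fun x => - v x + phi x).
  apply: fun_continuousD; last by have [C lC] := smooth_lip sm; exact: lip_continuous lC.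
  by move=> x; apply: continuousN; exact: cv.
have gU x : `|- v x + phi x| <= 2 * U.
  rewrite (le_trans (ler_normD _ _)) // normrN.
  by have := vU x; have := phiU x; lra.
have [x1 Hx1] := penalized_min x0 de0 cg gU.
have s00 : sqn (x0 - x0) = 0.
  by rewrite subrr /sqn big1 // => i _; rewrite mxE expr0n.
have wx1 : m - de <= w x1 - de * sqn (x1 - x0).
  by have := Hx1 x0; rewrite s00 /w in wx0 *; lra.
(* So [x1] is within distance 1 of [x0], and the penalty changes the operator by at most
   [2 * C3 * de]. *)
have dsq : de * sqn (x1 - x0) <= de by have := wm x1; lra.
have sq0 := sqn_ge0 (x1 - x0).
pose k := w x1 - de * sqn (x1 - x0).
pose psi y := phi y + de * sqn (y - x0) + k.
have psix1 : psi x1 = v x1 by rewrite /psi /k /w; ring.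
have vpsi : \forall y \near x1, v y <= psi y.
  by apply/nbhs_ballP; exists 1 => /= [|y _]; [exact: ltr01|]; have := Hx1 y; rewrite /psi /k /w; lra.
have := vsub psi x1 (test_function_C2 _ _ _ sm) psix1 vpsi.
rewrite /bellman => sup0.
have : ((- de)%:E < ereal_sup [set (L_op D al psi x1 + f_coef D al x1)%:E | al in [set: A]])%E.
  by apply: lt_le_trans sup0; rewrite lte_fin oppr_lt0.
move=> /ereal_sup_gt [_ [al _ <-]]; rewrite lte_fin => Lpsi.
have : `|L_op D al psi x1 - (L_op D al phi x1 - c_coef D al x1 * (psi x1 - phi x1))|
    <= `|de| * (2 * n * K ^+ 4 * (1 + sqn (x1 - x0))) := L_op_test de k x0 sm al x1.
rewrite (gtr0_norm de0) ler_norml => /andP[_ Lt].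
have := Lphi al x1; rewrite psix1 in Lt.
have cl := c_ge sa al x1.
have w1 : 0 <= w x1.
  have : 0 <= de * sqn (x1 - x0) by rewrite mulr_ge0 // ltW.
  lra.
have : lambda * w x1 <= c_coef D al x1 * (v x1 - phi x1) by rewrite ler_wpM2r.
have : lambda * (m - de) <= lambda * w x1.
  rewrite ler_pM2l //; have : 0 <= de * sqn (x1 - x0) by rewrite mulr_ge0 // ltW.
  lra.
have : de * (2 * n * K ^+ 4 * (1 + sqn (x1 - x0))) <= 2 * C3 * de.
  rewrite -/C3; have : C3 * (de * sqn (x1 - x0)) <= C3 * de by rewrite ler_wpM2l.
  lra.
lra.
Qed.

(* The near-maximality hypothesis is where a switching system is known to
   satisfy its own equation. *)
Lemma viscosity_supersolution_ge v (phi : A -> 'rV[R]_d -> R) (U E d0 : R) (B : A -> R) :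
  continuous v -> (forall x, `|v x| <= U) -> viscosity_supersolution D v ->
  (forall al, smooth 2 (B al) (phi al)) -> (forall al x, `|phi al x| <= U) -> 0 <= E -> 0 < d0 ->
  (forall al x, (forall be, phi be x <= phi al x + d0) -> - E <= L_op D al (phi al) x + f_coef D al x) ->
  forall al x, phi al x <= v x + E / lambda.
Proof.
move=> cv vU vsup sm phiU E0 d00 Lphi al0 xx.
have la0 : 0 < lambda := lt_le_trans ltr01 lambda_ge1.
have la1 := lambda_ge1; have C3_ge0 := C30.
rewrite -lerBlDl leNgt; apply/negP => big.
pose w (t : A * 'rV[R]_d) := phi t.1 t.2 - v t.2.
have hs : has_sup (range w).
  split; first by exists (w (al0, 0)), (al0, 0).
  exists (2 * U) => _ [t _ <-]; have := vU t.2; have := phiU t.1 t.2.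
  by rewrite /w !ler_norml => /andP[? ?] /andP[? ?]; lra.
set m := sup (range w).
have wm t : w t <= m by apply: (ub_le_sup hs.2); exists t.
have Em : E < lambda * m.
  by rewrite mulrC -ltr_pdivrMr //; exact: lt_le_trans (wm (al0, xx)).
have L0 : 0 < lambda + 2 * C3 + 1 by lra.
pose de0 := (lambda * m - E) / (2 * (lambda + 2 * C3 + 1)).
have de00 : 0 < de0 by rewrite divr_gt0 ?mulr_gt0 //; lra.
have de0E : 2 * (lambda + 2 * C3 + 1) * de0 = lambda * m - E by rewrite /de0; field; rewrite gt_eqF.
(* The bound by [d0] makes [al] nearly maximal among all indices at [x1], so that [Lphi] applies
   there. *)
pose de := Num.min de0 d0.
have deL : de <= de0 by rewrite /de ge_min lexx.
have ded : de <= d0 by rewrite /de ge_min lexx orbT.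
have dep : 0 < de by rewrite /de lt_min de00.
have dem : de <= m.
  apply: (le_trans deL).
  rewrite -(ler_pM2l la0); have : 0 <= C3 * de0 by rewrite mulr_ge0 // ltW.
  have : 0 <= lambda * de0 by rewrite mulr_ge0 // ltW.
  lra.
have [_ [[al x0] _ <-] wx0] : exists2 t, range w t & m - de < t by apply: sup_adherent.
have cg : continuous (fun x => v x + (-1) * phi al x).
  apply: fun_continuousD => //.
  by have [C lC] := smooth_lip (sm al); exact: lip_continuous (lipZ (-1) lC).
have gU x : `|v x + (-1) * phi al x| <= 2 * U.
  rewrite mulN1r (le_trans (ler_normB _ _)) //.
  by have := vU x; have := phiU al x; lra.
have [x1 Hx1] := penalized_min x0 dep cg gU.
have s00 : sqn (x0 - x0) = 0.
  by rewrite subrr /sqn big1 // => i _; rewrite mxE expr0n.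
have wx1 : m - de <= phi al x1 - v x1 - de * sqn (x1 - x0).
  by have := Hx1 x0; rewrite s00 /w /= in wx0 *; lra.
have sq0 := sqn_ge0 (x1 - x0).
have dsq0 : 0 <= de * sqn (x1 - x0) by rewrite mulr_ge0 // ltW.
have dsq : de * sqn (x1 - x0) <= de by have := wm (al, x1); rewrite /w /=; lra.
have near_max be : phi be x1 <= phi al x1 + d0.
  by have := wm (be, x1); rewrite /w /=; lra.
pose k := v x1 - phi al x1 + de * sqn (x1 - x0).
pose psi y := phi al y + (- de) * sqn (y - x0) + k.
have psix1 : psi x1 = v x1 by rewrite /psi /k; ring.
have vpsi : \forall y \near x1, psi y <= v y.
  by apply/nbhs_ballP; exists 1 => /= [|y _]; [exact: ltr01|]; have := Hx1 y; rewrite /psi /k; lra.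
have := vsup psi x1 (test_function_C2 _ _ _ (sm al)) psix1 vpsi.
rewrite /bellman => sup0.
have Lpsi : L_op D al psi x1 + f_coef D al x1 <= 0.
  by rewrite -lee_fin (le_trans _ sup0) // ereal_sup_ubound //; exists al.
have : `|L_op D al psi x1 - (L_op D al (phi al) x1 - c_coef D al x1 * (psi x1 - phi al x1))|
    <= `|- de| * (2 * n * K ^+ 4 * (1 + sqn (x1 - x0))) := L_op_test (- de) k x0 (sm al) al x1.
rewrite normrN (gtr0_norm dep) ler_norml => /andP[Lt _].
have := Lphi al x1 near_max; rewrite psix1 in Lt.
have cl := c_ge sa al x1.
have : lambda * (phi al x1 - v x1) <= c_coef D al x1 * (phi al x1 - v x1) by rewrite ler_wpM2r //; lra.
have : lambda * (m - de) <= lambda * (phi al x1 - v x1) by rewrite ler_pM2l //; lra.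
have : de * (2 * n * K ^+ 4 * (1 + sqn (x1 - x0))) <= 2 * C3 * de.
  rewrite -/C3; have : C3 * (de * sqn (x1 - x0)) <= C3 * de by rewrite ler_wpM2l.
  lra.
have : (lambda + 2 * C3) * de <= (lambda + 2 * C3) * de0 by rewrite ler_wpM2l //; lra.
lra.
Qed.
End ViscosityComparison.

(** * The upper bound *)

Section DiscreteEquation.
Variables (R : realType) (V : zmodType) (B : Type) (I : finType).
Variables (w : I -> V) (h : R) (sg b : B -> I -> V -> R) (c f : B -> V -> R).
Variables (K lambda : R).
Hypotheses (h_gt0 : 0 < h) (K_ge1 : 1 <= K) (lambda_ge1 : 1 <= lambda).
Hypothesis sg_le : forall be k x, `|sg be k x| <= K.
Hypothesis b_ge0 : forall be k x, 0 <= b be k x.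
Hypothesis b_le : forall be k x, b be k x <= K.
Hypothesis c_ge : forall be x, lambda <= c be x.

Let n : R := #|I|%:R.
Let P be k x := sg be k x ^+ 2 / h + b be k x.
Let PK := K ^+ 2 / h + K.
Let Q := n * (PK / h).

Let P_ge0 be k x : 0 <= P be k x.
Proof. by apply: addr_ge0 => //; apply: divr_ge0 (sqr_ge0 _) (ltW h_gt0). Qed.

Let K_ge0 : 0 <= K. Proof. exact: le_trans ler01 K_ge1. Qed.

Let P_le be k x : P be k x <= PK.
Proof.
by apply: lerD => //; rewrite ler_pM2r ?invr_gt0 // -real_normK ?num_real // lerXn2r ?nnegrE.
Qed.

Let PK_ge0 : 0 <= PK.
Proof. by apply: addr_ge0 K_ge0; apply: divr_ge0 (sqr_ge0 _) (ltW h_gt0). Qed.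

Let Q_ge0 : 0 <= Q. Proof. by apply: mulr_ge0 => //; apply: divr_ge0 => //; exact: ltW. Qed.

Let sum_P be x : \sum_k P be k x / h <= Q.
Proof.
apply: (@le_trans _ _ (\sum_(k : I) PK / h)).
  by apply: ler_sum => k _; rewrite ler_pM2r ?invr_gt0.
by rewrite sumr_const -[X in X <= _]mulr_natl.
Qed.

(** At fixed [h] the total jump rate is at most [Q], so missing the maximum by [de] costs at most
    [Q * de] in the difference terms. *)
Lemma fd_op_comparison (w1 w2 : V -> R) (U E : R) : 0 <= E ->
  (forall x, `|w1 x| <= U) -> (forall x, `|w2 x| <= U) ->
  (forall x e, 0 < e -> exists be, - e <= fd_op w h sg b c f be w1 x) ->
  (forall be x, fd_op w h sg b c f be w2 x <= E) ->
  forall x, w1 x <= w2 x + E / lambda.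
Proof.
move=> E0 U1 U2 sub super xx.
have la1 := lambda_ge1; have Q0 := Q_ge0; have la0 : 0 < lambda := lt_le_trans ltr01 la1.
rewrite -lerBlDl leNgt; apply/negP => big.
pose v x := w1 x - w2 x.
have hs : has_sup (range v).
  split; first by exists (v 0), 0.
  exists (2 * U) => _ [x _ <-]; have := U1 x; have := U2 x.
  by rewrite /v !ler_norml => /andP[? ?] /andP[? ?]; lra.
set m := sup (range v).
have vm x : v x <= m by apply: (ub_le_sup hs.2); exists x.
have Em : E < lambda * m.
  by rewrite mulrC -ltr_pdivrMr //; exact: lt_le_trans (vm xx).
have L0 : 0 < lambda + Q + 1 by lra.
pose de := (lambda * m - E) / (2 * (lambda + Q + 1)).
have de0 : 0 < de by rewrite divr_gt0 ?mulr_gt0 //; lra.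
have deE : 2 * (lambda + Q + 1) * de = lambda * m - E by rewrite /de; field; rewrite gt_eqF.
have dem : de <= m.
  rewrite -(ler_pM2l la0); have : 0 <= Q * de by rewrite mulr_ge0 // ltW.
  have : 0 <= lambda * de by rewrite mulr_ge0 // ltW.
  lra.
have [_ [x _ <-] vx] : exists2 t, range v t & m - de < t by apply: sup_adherent.
have [be Lw1] := sub x de de0.
have Lw2 := super be x.
have D1 : fd_op w h sg b c f be w1 x - fd_op w h sg b c f be w2 x =
    \sum_k P be k x / h * (v (x + w k) - v x) - c be x * v x.
  rewrite /fd_op (_ : \sum_k P be k x / h * _ = \sum_k P be k x * ((w1 (x + w k) - w1 x) / h)
     - \sum_k P be k x * ((w2 (x + w k) - w2 x) / h)); first by rewrite /v /P; ring.
  by rewrite -sumrB; apply: eq_bigr => k _; rewrite /v; ring.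
have D2 : \sum_k P be k x / h * (v (x + w k) - v x) <= Q * de.
  apply: (@le_trans _ _ (\sum_k P be k x / h * de)).
    apply: ler_sum => k _; apply: ler_wpM2l; first by apply: divr_ge0 => //; exact: ltW.
    by have := vm (x + w k); lra.
  by rewrite -mulr_suml; apply: ler_wpM2r; [exact: ltW|exact: sum_P].
have D3 : lambda * v x <= c be x * v x.
  by apply: ler_wpM2r; [lra|exact: c_ge].
have D4 : lambda * (m - de) <= lambda * v x by rewrite ler_pM2l //; lra.
lra.
Qed.

Lemma fd_op_solution_exists (cmax : R) : inhabited B -> (forall be x, c be x <= cmax) ->
  (forall be x, `|f be x| <= K) ->
  exists u : V -> R, [/\ forall x, `|u x| <= K,
    forall be x, fd_op w h sg b c f be u x <= 0 &
    forall x e, 0 < e -> exists be, - e <= fd_op w h sg b c f be u x].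
Proof.
move=> [b0] c_le f_le; have la1 := lambda_ge1.
have lac be x : 1 <= c be x := le_trans la1 (c_ge be x).
have cm0 : 1 <= cmax := le_trans (lac b0 0) (c_le b0 0).
have Q0 := Q_ge0.
(* With this time step the explicit iteration has nonnegative weights, so [T] is monotone and
   Perron's method applies. *)
pose t := (cmax + Q)^-1.
have t0 : 0 < t by rewrite invr_gt0; lra.
have tE : t * (cmax + Q) = 1 by rewrite mulVf // gt_eqF //; lra.
pose T be (_ : unit) (u : V -> R) x := u x + t * fd_op w h sg b c f be u x.
have TE be tt u x : T be tt u x = (1 - t * (c be x + \sum_k P be k x / h)) * u x
    + t * (\sum_k P be k x / h * u (x + w k) + f be x).
  rewrite /T /fd_op (_ : \sum_k _ * _ = \sum_k P be k x / h * u (x + w k)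
     - (\sum_k P be k x / h) * u x); first ring.
  by rewrite mulr_suml -sumrB; apply: eq_bigr => k _; rewrite /P; ring.
have T1 be x : 0 <= 1 - t * (c be x + \sum_k P be k x / h).
  by rewrite subr_ge0 -tE ler_pM2l // lerD.
have Tcst be tt (a : R) x : T be tt (fun=> a) x = a - t * (c be x * a - f be x).
  rewrite TE /= -[\sum_k _ / h * a]mulr_suml; ring.
have fb be x : - K <= f be x <= K by rewrite -ler_norml.
have [|be e u v uv x|be e x|x|u [uK sub sup]] := @isaacs_exists R V B unit T K K_ge0.
- exact: (inhabits tt).
- rewrite !TE; apply: lerD; first exact: ler_wpM2l.
  rewrite ler_pM2l // lerD2r; apply: ler_sum => k _; apply: ler_wpM2l => //.
  by apply: divr_ge0 => //; exact: ltW.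
- rewrite Tcst gerBl; apply: mulr_ge0; first exact: ltW.
  have /andP[_ ?] := fb be x.
  have : K <= c be x * K by apply: ler_peMl.
  lra.
- exists b0 => e; rewrite Tcst.
  have /andP[? _] := fb b0 x.
  have : K <= c b0 x * K by apply: ler_peMl.
  have : 0 <= t * (c b0 x * K + f b0 x) -> - K <= - K - t * (c b0 x * - K - f b0 x) by lra.
  by move=> H ?; apply: H; apply: mulr_ge0; [exact: ltW|lra].
exists u; split => // [be x|x e e0].
  apply/ler_addgt0Pr => e e0; rewrite add0r.
  have [[] ] := sup x be (t * e) (mulr_gt0 t0 e0).
  by rewrite /T lerD2l ler_pM2l.
have [be /(_ tt) Tu] := sub x (t * e) (mulr_gt0 t0 e0); exists be.
by rewrite -(ler_pM2l t0); move: Tu; rewrite /T; lra.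
Qed.
End DiscreteEquation.

Lemma fd_op_expand (R : realType) (V : zmodType) (B : Type) (J : finType) (w : J -> V) (h : R)
    (sg b : B -> J -> V -> R) (c f : B -> V -> R) be (u : V -> R) x :
  fd_op w h sg b c f be u x = \sum_k ((sg be k x ^+ 2 / h + b be k x) / h) * u (x + w k)
    + (- (\sum_k (sg be k x ^+ 2 / h + b be k x) / h) - c be x) * u x + f be x.
Proof.
rewrite /fd_op mulrBl addrA; congr (_ - _ + _).
rewrite mulNr mulr_suml -sumrB; apply: eq_bigr => k _; ring.
Qed.

(** The gradient estimate covers displacements of size at most [h]; a longer one is cut into equal
    pieces along the additive family [W]. *)
Lemma chain_bound (R : realType) (V : zmodType) (W : R -> V) (u : V -> R) (h M : R) :
  0 < h -> 0 <= M -> {morph W : x y / x + y} ->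
  (forall t, 0 < t -> t <= h -> forall z, `|u (z + W t) - u z| <= M * t) ->
  forall r, 0 < r -> forall z, `|u (z + W r) - u z| <= M * r.
Proof.
move=> h0 M0 WD H r r0 z.
pose N := (Num.truncn (r / h)).+1.
have N0 : (0 : R) < N%:R by [].
pose t := r / N%:R.
have t0 : 0 < t by rewrite divr_gt0.
have th : t <= h.
  rewrite ler_pdivrMr // mulrC -ler_pdivrMr //; apply: ltW; exact: real_truncnS_gt (num_real _).
have -> : r = N%:R * t by rewrite /t; field; rewrite gt_eqF.
have W0 : W 0 = 0 by apply: (@addrI _ (W 0)); rewrite -WD !addr0.
have step := H t t0 th; move: (t) step => t' step.
elim: (N) z => [|N' IH] z; first by rewrite mul0r W0 addr0 subrr normr0 mulr0.
rewrite -natr1 mulrDl mul1r WD addrA.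
rewrite (_ : _ - _ = (u (z + W (N'%:R * t') + W t') - u (z + W (N'%:R * t')))
   + (u (z + W (N'%:R * t')) - u z)); last by ring.
by rewrite mulrDr addrC (le_trans (ler_normD _ _)) // lerD // IH.
Qed.

Section BellmanScheme.
Variables (R : realType) (d d1 : nat) (A : metricType R).
Variables (D : coefficients d d1 A) (K lambda : R).
Hypotheses (sa : standing_assumptions K lambda D) (K_ge1 : 1 <= K).
Hypothesis lambda_ge1 : 1 <= lambda.
Implicit Types (x y l : 'rV[R]_d) (u v phi : 'rV[R]_d -> R) (al be : A).

Local Notation I := (bool * 'I_d1)%type.
Let n : R := #|{: I}|%:R.
Let m : R := #|{: I + bool}|%:R.

Let K_ge0 : 0 <= K. Proof. exact: le_trans ler01 K_ge1. Qed.

Let K_le_sqr : K <= K ^+ 2. Proof. by rewrite expr2 ler_peMl. Qed.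

Definition schemeop (h : R) al u x : R :=
  @fd_op R 'rV[R]_d A I (fun k => h *: ell D k) h (sigma_coef D) (b_coef D) (c_coef D) (f_coef D) al u x.

Lemma Lh_opE (h : R) al u x : 0 < h -> Lh_op D h al u x + f_coef D al x = schemeop h al u x.
Proof.
move=> h0; rewrite /Lh_op /schemeop /fd_op; congr (_ - _ + _).
rewrite (_ : \sum_k a_coef D al k x * Deltah h (ell D k) u x =
  \sum_(k : I) sigma_coef D al k x ^+ 2 / h * ((u (x + h *: ell D k) - u x) / h)).
  by rewrite -big_split /=; apply: eq_bigr => k _; rewrite /deltah; ring.
pose F (k : I) := sigma_coef D al k x ^+ 2 / h * ((u (x + h *: ell D k) - u x) / h).
have EF : \sum_(k : I) F (opp_index k) = \sum_(k : I) F k.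
  by rewrite [RHS](reindex_inj (can_inj (@opp_indexK d1))).
rewrite -/(\sum_(k : I) F k).
have -> : \sum_(k : I) F k = \sum_(k : I) 2^-1 * (F k + F (opp_index k)).
  by rewrite -mulr_sumr big_split /= EF; field.
apply: eq_bigr => k _; rewrite /F /a_coef /Deltah -(sigma_opp sa).
have -> : ell D (opp_index k) = - ell D k by rewrite (ell_opp sa k) opprK.
by rewrite scalerN; field; rewrite gt_eqF.
Qed.

Lemma fd_solution_super (h : R) v : 0 < h -> fd_solution D h v -> forall al x, schemeop h al v x <= 0.
Proof.
move=> h0 sol al x; rewrite -Lh_opE // -lee_fin.
apply: (@le_trans _ _ (bellmanh D h v x)); last by rewrite sol.
by apply: ereal_sup_ubound; exists al.
Qed.

Lemma fd_solution_sub (h : R) v : 0 < h -> fd_solution D h v ->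
  forall x (e : R), 0 < e -> exists al, - e <= schemeop h al v x.
Proof.
move=> h0 sol x e e0.
have : ((- e)%:E < bellmanh D h v x)%E by rewrite sol lte_fin oppr_lt0.
move=> /ereal_sup_gt [_ [al _ <-]]; rewrite lte_fin Lh_opE // => /ltW.
by exists al.
Qed.

Let b_le al k x : b_coef D al k x <= K.
Proof. by have [+ _] := b_bl sa al k => /(_ x); rewrite ler_norml => /andP[]. Qed.

Lemma scheme_comparison (h : R) (w1 w2 : 'rV[R]_d -> R) (U E : R) : 0 < h -> 0 <= E ->
  (forall x, `|w1 x| <= U) -> (forall x, `|w2 x| <= U) ->
  (forall x (e : R), 0 < e -> exists al, - e <= schemeop h al w1 x) ->
  (forall al x, schemeop h al w2 x <= E) ->
  forall x, w1 x <= w2 x + E.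
Proof.
move=> h0 E0 U1 U2 sub super x.
have sg al (k : I) y : `|sigma_coef D al k y| <= K := (sigma_bl sa al k).1 y.
have b0 al (k : I) y : 0 <= b_coef D al k y := b_ge0 sa al k y.
have bK al (k : I) y : b_coef D al k y <= K := b_le al k y.
apply: (le_trans (fd_op_comparison h0 K_ge1 lambda_ge1 sg b0 bK (c_ge sa) E0 U1 U2 sub super x)).
by rewrite lerD2l ler_pdivrMr ?(lt_le_trans ltr01 lambda_ge1) // ler_peMr.
Qed.

Hypothesis lambda_big : 7 * n * m * (K ^+ 2) ^+ 2 + 4 * m * m * n * (K ^+ 2) ^+ 2 + 1 <= lambda.

(* The second variable of [u] measures how far the coefficients are shaken in
   the direction [e]; the Lipschitz bound in it compares the shaken equation with
   the original one. *)
Lemma shaken_solution (h : R) : 0 < h -> inhabited A ->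
  exists u : 'rV[R]_d * R -> R,
  [/\ forall z, `|u z| <= K,
      forall y : R, lip (m * K ^+ 2 * (K + 1)) (fun x => u (x, y)),
      forall x (r : R), 0 < r -> `|u (x, r) - u (x, 0)| <= m * K ^+ 2 * (K + 1) * r,
      forall x (r : R) (e : 'rV[R]_d) al, enorm e <= 1 ->
        @fd_op R 'rV[R]_d A I (fun k => h *: ell D k) h (fun al k x => sigma_coef D al k (x + r *: e))
          (fun al k x => b_coef D al k (x + r *: e)) (fun al x => c_coef D al (x + r *: e))
          (fun al x => f_coef D al (x + r *: e)) al (fun x => u (x, r)) x <= 0 &
      forall x (e : R), 0 < e -> exists al, - e <= schemeop h al (fun x => u (x, 0)) x].
Proof.
move=> h0 [al0].
pose V := ('rV[R]_d * R)%type; pose B := (A * @ball_of R d 1)%type.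
pose pt (b : B) (z : V) := z.1 + z.2 *: sval b.2.
pose w (k : I) : V := (h *: ell D k, 0).
pose sg (b : B) (k : I) (z : V) := sigma_coef D b.1 k (pt b z).
pose bb (b : B) (k : I) (z : V) := b_coef D b.1 k (pt b z).
pose c (b : B) (z : V) := c_coef D b.1 (pt b z).
pose f (b : B) (z : V) := f_coef D b.1 (pt b z).
have sg_le b k z : `|sg b k z| <= K := (sigma_bl sa b.1 k).1 _.
have bb_ge0 b k z : 0 <= bb b k z := b_ge0 sa b.1 k _.
have bb_le b k z : bb b k z <= K := b_le b.1 k _.
have c_ge b z : lambda <= c b z := c_ge sa b.1 _.
have c_le b z : c b z <= lambda + K.
  by have [+ _] := c_bl sa b.1 => /(_ (pt b z)); rewrite ler_norml /c => /andP[_]; lra.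
have f_le b z : `|f b z| <= K := (f_bl sa b.1).1 _.
have [u [uK super sub]] := fd_op_solution_exists w h0 K_ge1 lambda_ge1 sg_le bb_ge0 bb_le c_ge
  (inhabits (al0, ball0 d ler01)) c_le f_le.
set M := m * K ^+ 2 * (K + 1).
have K21 : 1 <= K ^+ 2 := le_trans K_ge1 K_le_sqr.
have M0 : 0 <= M by rewrite !mulr_ge0 ?sqr_ge0 // addr_ge0.
have lipc psi b (z v : V) : bounded_lipschitz K psi ->
    `|psi (pt b (z + v)) - psi (pt b z)| <= K * enorm (v.1 + v.2 *: sval b.2).
  move=> [_ lpsi]; apply: (le_trans (lpsi _ _)).
  by rewrite /pt /= scalerDl addrACA [X in enorm X]addrC addKr.
have slow_w psi b z k : bounded_lipschitz K psi ->
    `|psi (pt b (z + w k)) - psi (pt b z)| <= K ^+ 2 * h.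
  move=> bl; apply: (le_trans (lipc _ _ _ _ bl)).
  rewrite /w /= scale0r addr0 enormZ (gtr0_norm h0) expr2 -mulrA ler_wpM2l //.
  by rewrite mulrC ler_wpM2r ?(ltW h0) // (ell_le sa).
have grad (w0 : V) (r : R) : 0 < r -> r <= h ->
    (forall b : B, enorm (w0.1 + w0.2 *: sval b.2) <= r) ->
    forall z, `|u (z + w0) - u z| <= M * r.
  move=> r0 rh w0r.
  have slow_0 psi b z : bounded_lipschitz K psi ->
      `|psi (pt b (z + w0)) - psi (pt b z)| <= K ^+ 2 * r.
    move=> bl; apply: (le_trans (lipc _ _ _ _ bl)).
    by apply: ler_pM => //; exact: enorm_ge0.
  have c_blK b : bounded_lipschitz K (c_coef D b.1 \- (fun=> lambda)) := c_bl sa b.1.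
  have c_eq b z z' : c b z - c b z' =
      (c_coef D b.1 (pt b z) - lambda) - (c_coef D b.1 (pt b z') - lambda) by rewrite /c; ring.
  (* [K1 = K ^+ 2]: the coefficients are [K]-Lipschitz and a step [h *: ell] has length at most
     [K * h]; since [K >= 1], this also bounds their values. *)
  apply: (gradient_bound (opp := @opp_index d1) (h := h) (h0 := r) (w := w) (sg := sg) (b := bb) (c := c)
      (f := f) (u := u) (K1 := K ^+ 2) (U := K) (la := lambda)) => //.
  - exact: opp_indexK.
  - move=> k; rewrite /w (_ : ell D (opp_index k) = - ell D k) ?scalerN.
      by rewrite -[RHS]/(- (h *: ell D k), - 0) oppr0.
    by rewrite (ell_opp sa k) opprK.
  - by move=> b k z; rewrite /sg -(sigma_opp sa).
  - by move=> b k z; rewrite (le_trans (sg_le _ _ _)).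
  - by move=> b k z; rewrite (le_trans (bb_le _ _ _)).
  - move=> b k z; split=> [k'|]; [apply: slow_w|apply: slow_0]; exact: (sigma_bl sa).
  - move=> b k z; split=> [k'|]; [apply: slow_w|apply: slow_0]; exact: (b_bl sa).
  - move=> b z; split=> [k'|]; rewrite c_eq.
      exact: (slow_w _ b z k' (c_bl sa b.1)).
    exact: (slow_0 _ b z (c_bl sa b.1)).
  - move=> b z; split=> [k'|]; [apply: slow_w|apply: slow_0]; exact: (f_bl sa).
exists u; split=> //.
- move=> y x x'.
  have [->|xx'] := eqVneq x x'.
    by rewrite !subrr normr0 mulr_ge0 // enorm_ge0.
  pose r := enorm (x - x').
  have r0 : 0 < r.
    rewrite lt_neqAle enorm_ge0 andbT eq_sym; apply: contra_neq xx' => r0.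
    apply/rowP => i; apply/eqP; rewrite -subr_eq0 -normr_le0.
    by have := coord_le_enorm (x - x') i; rewrite -/r r0 !mxE.
  pose W (t : R) : V := ((t / r) *: (x - x'), 0).
  have WD : {morph W : s t / s + t}.
    by move=> s t; rewrite /W mulrDl scalerDl -[RHS]/(_ + _, 0 + 0) addr0.
  have := chain_bound (W := W) h0 M0 WD _ r0 (x', y).
  rewrite /W divff ?gt_eqF // scale1r -[(x', y) + _]/(x' + (x - x'), y + 0) addr0.
  rewrite [x' + _]addrC subrK; apply => t t0 th z.
  apply: (grad (W t)) => // b.
  by rewrite /W /= scale0r addr0 enormZ gtr0_norm ?divr_gt0 // -/r divfK // gt_eqF.
- move=> x r r0.
  pose W (t : R) : V := (0, t).
  have WD : {morph W : s t / s + t} by move=> s t; rewrite -[RHS]/(0 + 0, _) addr0.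
  have := chain_bound (W := W) h0 M0 WD _ r0 (x, 0).
  rewrite /W -[(x, 0) + _]/(x + 0, 0 + r) addr0 add0r; apply => t t0 th z.
  apply: (grad (W t)) => // b.
  rewrite /W /= add0r enormZ gtr0_norm // ler_piMr ?(ltW t0) //.
  exact: (svalP b.2).
- move=> x r e al e1.
  have := super (al, exist _ e e1) (x, r).
  rewrite /fd_op /sg /bb /c /f /pt /w /=.
  by under eq_bigr do rewrite -[(x, r) + _]/(_, r + 0) addr0.
- move=> x e e0; have [b Hb] := sub (x, 0) e e0; exists b.1.
  move: Hb; rewrite /schemeop /fd_op /sg /bb /c /f /pt /w /= scale0r addr0.
  by under eq_bigr do rewrite -[(x, 0) + _]/(_, 0 + 0) addr0.
Qed.
End BellmanScheme.

(** * Mollification at a given scale *)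

Section Mollification.
Variables (R : realType) (d : nat).

(** Four averages per coordinate give the four derivatives used in the consistency of second
    differences. *)
Definition four_copies : seq 'I_d := flatten (nseq 4 (enum 'I_d)).

Lemma count_four_copies j : count_mem j four_copies = 4.
Proof.
rewrite count_flatten map_nseq sumn_nseq count_uniq_mem ?enum_uniq //.
by rewrite mem_enum.
Qed.

Definition radius (e : R) : R := d%:R * ((size four_copies)%:R * e).

Lemma radius_ge0 e : 0 <= e -> 0 <= radius e.
Proof. by move=> e0; rewrite /radius !mulr_ge0. Qed.

Lemma radius_gt0 (e : R) : (0 < d)%N -> 0 < e -> 0 < radius e.
Proof.
move=> d0 e0; rewrite /radius mulr_gt0 ?ltr0n // mulr_gt0 // ltr0n lt0n.
apply/negP => /eqP s0; have := count_four_copies (Ordinal d0).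
by have := count_size (pred1 (Ordinal d0)) four_copies; rewrite s0 leqn0 => /eqP ->.
Qed.

Definition mollify (e : R) (g : 'rV[R]_d -> R) := mol e four_copies g.

Lemma mollify_smooth (e M : R) k g : 0 < e -> 0 <= M -> lip M g -> (k < 4)%N ->
  smooth k.+1 (M / e ^+ k) (mollify e g).
Proof.
move=> e0 M0 lg k4; apply: (smooth_mol e0 M0 lg) => [j|js x sz].
  by rewrite count_four_copies.
exact: cdiff_iter_bound.
Qed.

Lemma mollify_dist (e M : R) g x : 0 < e -> 0 <= M -> lip M g -> `|mollify e g x - g x| <= M * radius e.
Proof. by move=> e0 M0 lg; exact: mol_dist. Qed.

Lemma box_radius (e : R) (z : 'rV[R]_d) :
  (forall i, `|z 0 i| <= (size four_copies)%:R * e) -> enorm z <= radius e.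
Proof. exact: enorm_box. Qed.
End Mollification.

Section UpperBound.
Variables (R : realType) (d d1 : nat) (A : metricType R).
Variables (D : coefficients d d1 A) (K lambda : R).
Hypotheses (sa : standing_assumptions K lambda D) (K_ge1 : 1 <= K).
Hypothesis lambda_ge1 : 1 <= lambda.
Hypothesis d_gt0 : (0 < d)%N.
Implicit Types (x y l : 'rV[R]_d) (u v phi : 'rV[R]_d -> R) (al be : A).

Local Notation I := (bool * 'I_d1)%type.
Let n : R := #|{: I}|%:R.
Let m : R := #|{: I + bool}|%:R.
Let La : R := d%:R * K.

Let K_ge0 : 0 <= K. Proof. exact: le_trans ler01 K_ge1. Qed.

Lemma sum_ell k : \sum_j `|ell D k 0 j| <= La.
Proof.
apply: (@le_trans _ _ (\sum_(j < d) K)); last by rewrite sumr_const card_ord /La mulr_natl.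
by apply: ler_sum => j _; apply: (le_trans (coord_le_enorm _ _)); exact: (ell_le sa).
Qed.

Let sum_cst (a : R) : \sum_(k : signed_index d1) a = a * n.
Proof. by rewrite sumr_const -mulr_natr /n; congr (_ * _%:R); apply: eq_card. Qed.

Lemma a_coef_bound al k x : 0 <= a_coef D al k x <= K ^+ 2 / 2.
Proof.
rewrite /a_coef; apply/andP; split; first by apply: mulr_ge0 (sqr_ge0 _).
rewrite mulrC ler_pM2r // -real_normK ?num_real // lerXn2r ?nnegrE //.
exact: (sigma_bl sa al k).1.
Qed.

Definition consistency_const (M : R) : R := n * (K ^+ 2 * M * La ^+ 4 + K * M * La ^+ 2).

(** With [r] the square root of [h], both errors balance: [h ^+ 2 / r ^+ 3] for second differences
    and [h / r] for first ones are equal to [r]. *)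
Lemma scheme_consistent (h M : R) phi al x : 0 < h -> 0 <= M ->
  smooth 2 (M / Num.sqrt h) phi -> smooth 4 (M / Num.sqrt h ^+ 3) phi ->
  `|L_op D al phi x - Lh_op D h al phi x| <= consistency_const M * Num.sqrt h.
Proof.
move=> h0 M0 sm2 sm4; set r := Num.sqrt h in sm2 sm4 *.
have r0 : 0 < r by rewrite sqrtr_gt0.
have hE : h = r ^+ 2 by rewrite sqr_sqrtr // ltW.
rewrite /L_op /Lh_op (_ : _ - _ = \sum_k (a_coef D al k x * (D2l (ell D k) phi x - Deltah h (ell D k) phi x)
  + b_coef D al k x * (Dl (ell D k) phi x - deltah h (ell D k) phi x))); last first.
  rewrite big_split /=; under eq_bigr do rewrite mulrBr.
  under [X in _ = _ + X]eq_bigr do rewrite mulrBr.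
  by rewrite !sumrB; ring.
apply: (le_trans (ler_norm_sum _ _ _)).
rewrite (_ : consistency_const M * r = \sum_(k : signed_index d1) (K ^+ 2 * M * La ^+ 4 + K * M * La ^+ 2) * r); last first.
  by rewrite sum_cst /consistency_const; ring.
apply: ler_sum => k _; rewrite mulrDl; apply: (le_trans (ler_normD _ _)).
have /andP[a0 aK] := a_coef_bound al k x.
apply: lerD; rewrite normrM distrC.
  rewrite ger0_norm //.
  have := Deltah_consistent (divr_ge0 M0 (exprn_ge0 3 (ltW r0))) (sum_ell k) h0 sm4 x.
  move=> /(ler_pM a0 (normr_ge0 _) aK) /le_trans; apply.
  by rewrite hE le_eqVlt; apply/orP; left; apply/eqP; field; rewrite gt_eqF.
have := deltah_consistent (divr_ge0 M0 (ltW r0)) (sum_ell k) h0 sm2 x.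
have := (b_bl sa al k).1 x => bK /(ler_pM (normr_ge0 _) (normr_ge0 _) bK) /le_trans; apply.
by rewrite hE le_eqVlt; apply/orP; left; apply/eqP; field; rewrite gt_eqF.
Qed.

Lemma consistency_const_ge0 M : 0 <= M -> 0 <= consistency_const M.
Proof. by move=> M0; rewrite /consistency_const mulr_ge0 // addr_ge0 // !mulr_ge0 // ?exprn_ge0 // mulr_ge0. Qed.

Hypothesis lambda_big : 7 * n * m * (K ^+ 2) ^+ 2 + 4 * m * m * n * (K ^+ 2) ^+ 2 + 1 <= lambda.

Let M : R := m * K ^+ 2 * (K + 1).

(** The radius counts twice, once for mollifying [g] and once for returning from the shaken solution
    to [u (x, 0)]. Lambda stays out of the constant because dividing by [lambda >= 1] only decreases
    the error. *)
Lemma upper_bound (h U : R) v vh : 0 < h -> continuous v -> (forall x, `|v x| <= U) ->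
  viscosity_subsolution D v -> (forall x, `|vh x| <= U) -> fd_solution D h vh ->
  forall x, v x <= vh x + (consistency_const M + 2 * M * radius d 1) * Num.sqrt h.
Proof.
move=> h0 cv vU vsub vhU sol x.
have M0 : 0 <= M by rewrite /M !mulr_ge0 ?sqr_ge0 // addr_ge0.
set r := Num.sqrt h; have r0 : 0 < r by rewrite sqrtr_gt0.
have radE : radius d r = radius d 1 * r by rewrite /radius; ring.
have rad0 : 0 < radius d r := radius_gt0 d_gt0 r0.
have [al0 _] := fd_solution_sub sa h0 sol 0 ltr01.
have [u [uK ulip ushift ushaken u0]] := shaken_solution sa K_ge1 lambda_ge1 lambda_big h0 (inhabits al0).
set g := fun x => u (x, radius d r).
have lg : lip M g := ulip _.
pose phi := mollify r g.
have gphi y : `|phi y - g y| <= M * radius d r := mollify_dist y r0 M0 lg.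
have scheme_phi al y : schemeop D h al phi y <= 0.
  rewrite /schemeop fd_op_expand; apply: (mol_ineq r0 lg) => z /box_radius zr.
  (* This shake cancels the displacement [z]: the coefficients stay frozen at [y] while the
     mollifier moves the argument. *)
  have e1 : enorm (- (radius d r)^-1 *: z) <= 1.
    rewrite enormZ normrN gtr0_norm ?invr_gt0 // mulrC ler_pdivrMr // mul1r //.
  have := ushaken (y + z) (radius d r) _ al e1; rewrite fd_op_expand.
  by rewrite scalerA mulrN mulfV ?gt_eqF // scaleN1r addrK.
have E0 : 0 <= consistency_const M * r by rewrite mulr_ge0 ?consistency_const_ge0 // ltW.
have Lphi al y : L_op D al phi y + f_coef D al y <= consistency_const M * r.
  have sm2 : smooth 2 (M / r) phi by rewrite -[r]expr1; exact: mollify_smooth.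
  have sm4 : smooth 4 (M / r ^+ 3) phi by exact: mollify_smooth.
  have := scheme_consistent al y h0 M0 sm2 sm4; rewrite -/r ler_norml => /andP[_].
  by have := scheme_phi al y; rewrite -(Lh_opE sa) //; lra.
have phiK y : `|phi y| <= K by apply: (mol_bound r0 _ _ lg) => z; exact: uK.
have vUK y : `|v y| <= U + K by apply: (le_trans (vU y)); rewrite lerDl.
have phiUK y : `|phi y| <= U + K.
  by apply: (le_trans (phiK y)); rewrite lerDr (le_trans _ (vU 0)).
have := viscosity_subsolution_le sa K_ge1 lambda_ge1 cv vUK vsub
  (mollify_smooth r0 M0 lg (isT : (1 < 4)%N)) phiUK E0 Lphi x.
have : consistency_const M * r / lambda <= consistency_const M * r.
  by rewrite ler_pdivrMr ?(lt_le_trans ltr01 lambda_ge1) // ler_peMr.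
have vhUK y : `|vh y| <= U + K by apply: (le_trans (vhU y)); rewrite lerDl.
have uUK y : `|u (y, 0)| <= U + K.
  by apply: (le_trans (uK _)); rewrite lerDr (le_trans _ (vU 0)).
have := scheme_comparison sa K_ge1 lambda_ge1 h0 (lexx 0) uUK vhUK u0
  (fd_solution_super sa h0 sol) x.
have := ushift x _ rad0; have := gphi x; rewrite -/phi -/M /g radE !ler_norml => /andP[_ ?] /andP[_ ?].
lra.
Qed.
End UpperBound.

(** * The lower bound *)

Section LowerBound.
Variables (R : realType) (d d1 : nat) (A : metricType R).
Variables (D : coefficients d d1 A) (K lambda : R).
Hypotheses (sa : standing_assumptions K lambda D) (K_ge1 : 1 <= K).
Hypothesis lambda_ge1 : 1 <= lambda.
Hypotheses (d_gt0 : (0 < d)%N) (d1_gt0 : (0 < d1)%N).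
Implicit Types (x y l : 'rV[R]_d) (u v phi : 'rV[R]_d -> R) (al be : A).

Local Notation I := (bool * 'I_d1)%type.
Let n : R := #|{: I}|%:R.
Let La : R := d%:R * K.

Let K_ge0 : 0 <= K. Proof. exact: le_trans ler01 K_ge1. Qed.
Let n_gt0 : 0 < n. Proof. exact: card_signed_gt0. Qed.
Let sum_cst (a : R) : \sum_(k : signed_index d1) a = a * n.
Proof. by rewrite sumr_const -mulr_natr /n; congr (_ * _%:R); apply: eq_card. Qed.

Lemma D2l_bound (B Lb : R) phi l x : 0 <= B -> \sum_j `|l 0 j| <= Lb -> smooth 2 B phi ->
  `|D2l l phi x| <= B * Lb ^+ 2.
Proof.
move=> B0 lL sm; rewrite (smooth_D2l _ sm).
have [sm1 _] := smooth_Dl l sm; have [[_ b] _] := smooth_Dl l sm1.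
apply: (le_trans (b x)); rewrite expr2 mulrA.
have S0 : 0 <= \sum_j `|l 0 j| by exact: sumr_ge0.
by apply: ler_pM => //; [exact: mulr_ge0|exact: ler_pM].
Qed.

(** It involves lambda and the mollification scale; this is harmless, as it is multiplied by the
    square root of [n * tau] and [tau] is chosen last. *)
Definition SL_const (B2 B3 M : R) : R :=
  n * (8 * B3 * La ^+ 3 * K ^+ 3 + 2 * K ^+ 2 * B2 * La ^+ 2) + 2 * (lambda + K) * M * K ^+ 2.

(** First-order noise cancels by oddness, and a remainder of order [s1 ^+ 3] is [tau] times a small
    factor because [s1 ^+ 2 = n * tau]. *)
Lemma SL_consistent (tau B2 B3 M : R) phi al x :
  0 < tau -> n * tau <= 1 -> 0 <= B2 -> 0 <= B3 -> 0 <= M ->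
  smooth 2 B2 phi -> smooth 3 B3 phi -> lip M phi ->
  `|SL D tau al x phi x - phi x - tau * (L_op D al phi x + f_coef D al x)|
  <= tau * (SL_const B2 B3 M * Num.sqrt (n * tau)).
Proof.
move=> tau0 ntau B20 B30 M0 sm2 sm3 lphi.
have La0 : 0 <= La by rewrite mulr_ge0.
set s1 := Num.sqrt (n * tau); pose s2 := n * tau.
have s20 : 0 <= s2 by rewrite mulr_ge0 // ltW.
have s1E : s1 ^+ 2 = s2 by rewrite sqr_sqrtr.
have s10 : 0 <= s1 := sqrtr_ge0 _.
have s11 : s1 <= 1 by rewrite -[1]sqrtr1 ler_wsqrtr.
have s21 : s2 <= s1 by rewrite -s1E expr2 ler_piMr.
pose sg k := sigma_coef D al k x; pose b k := b_coef D al k x.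
pose D1 k := Dl (ell D k) phi x; pose D2 k := D2l (ell D k) phi x.
pose t k := s1 * sg k + s2 * b k.
have sgK k : `|sg k| <= K := (sigma_bl sa al k).1 x.
have bK k : `|b k| <= K := (b_bl sa al k).1 x.
have tK k : `|t k| <= 2 * K * s1.
  apply: (le_trans (ler_normD _ _)).
  rewrite [`|s1 * _|]normrM [`|s2 * _|]normrM (ger0_norm s10) (ger0_norm s20).
  have : s1 * `|sg k| <= s1 * K by rewrite ler_wpM2l.
  have : s2 * `|b k| <= s1 * K by rewrite ler_pM.
  lra.
(* Of [t k ^+ 2 / 2] only [s1 ^+ 2 * sg k ^+ 2 / 2] belongs to the generator; the mixed product and
   the squared drift are counted as remainder. *)
pose rem k := phi (x + t k *: ell D k) - phi x - t k * D1 k - t k ^+ 2 / 2 * D2 k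
   + (s1 * s2 * sg k * b k + s2 ^+ 2 * b k ^+ 2 / 2) * D2 k.
pose C0 := 8 * B3 * La ^+ 3 * K ^+ 3 + 2 * K ^+ 2 * B2 * La ^+ 2.
have rem_le k : `|rem k| <= s1 ^+ 3 * C0.
  rewrite /C0 mulrDr /rem; apply: (le_trans (ler_normD _ _)); apply: lerD.
    apply: (le_trans (smooth_taylor3 B30 (sum_ell sa k) sm3 x (t k))).
    have -> : s1 ^+ 3 * (8 * B3 * La ^+ 3 * K ^+ 3) = B3 * La ^+ 3 * (2 * K * s1) ^+ 3 by ring.
    rewrite ler_wpM2l ?mulr_ge0 ?exprn_ge0 // lerXn2r ?nnegrE //.
    by rewrite !mulr_ge0.
  have D2B := D2l_bound x B20 (sum_ell sa k) sm2.
  rewrite normrM.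
  have -> : s1 ^+ 3 * (2 * K ^+ 2 * B2 * La ^+ 2) = (s1 ^+ 3 * (2 * K ^+ 2)) * (B2 * La ^+ 2) by ring.
  apply: ler_pM => //.
  have sb : `|sg k * b k| <= K ^+ 2 by rewrite normrM expr2 ler_pM.
  have b2 : b k ^+ 2 <= K ^+ 2 by rewrite -real_normK ?num_real // lerXn2r ?nnegrE.
  have s3E : s1 * s2 = s1 ^+ 3 by rewrite -s1E; ring.
  have s30 : 0 <= s1 ^+ 3 by exact: exprn_ge0.
  have s22 : s2 ^+ 2 <= s1 ^+ 3 by rewrite -s3E expr2; apply: ler_wpM2r.
  apply: (le_trans (ler_normD _ _)).
  rewrite s3E -mulrA normrM (ger0_norm s30).
  have -> : `|s2 ^+ 2 * b k ^+ 2 / 2| = s2 ^+ 2 * b k ^+ 2 / 2.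
    by rewrite ger0_norm // divr_ge0 // mulr_ge0 ?sqr_ge0.
  have : s1 ^+ 3 * `|sg k * b k| <= s1 ^+ 3 * K ^+ 2 by rewrite ler_wpM2l.
  have : s2 ^+ 2 * b k ^+ 2 <= s1 ^+ 3 * K ^+ 2 by rewrite ler_pM ?sqr_ge0.
  have : 0 <= s1 ^+ 3 * K ^+ 2 by rewrite mulr_ge0 ?sqr_ge0.
  lra.
pose avg := n^-1 * \sum_(k : signed_index d1) phi (x + t k *: ell D k).
pose G := \sum_(k : signed_index d1) (a_coef D al k x * D2 k + b k * D1 k).
pose rho := n^-1 * \sum_(k : signed_index d1) rem k.
have odd0 : \sum_(k : signed_index d1) s1 * sg k * D1 k = 0.
  apply: sum_odd0 => k.
  have -> : D1 (opp_index k) = - D1 k.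
    rewrite /D1 (_ : ell D (opp_index k) = - ell D k); last by rewrite (ell_opp sa k) opprK.
    by rewrite /Dl -sumrN; apply: eq_bigr => i _; rewrite mxE mulrN.
  by rewrite mulrN /sg -(sigma_opp sa).
have avgE : avg = phi x + tau * G + rho.
  have E k : phi (x + t k *: ell D k) =
      phi x + s1 * sg k * D1 k + s2 * (a_coef D al k x * D2 k + b k * D1 k) + rem k.
    rewrite /rem; set X := phi (x + _); rewrite /t /a_coef -/(sg k).
    have -> : s2 * (2^-1 * sg k ^+ 2 * D2 k + b k * D1 k)
      = s1 ^+ 2 * (2^-1 * sg k ^+ 2 * D2 k) + s2 * (b k * D1 k) by rewrite s1E; ring.
    by field.
  rewrite /avg; under eq_bigr do rewrite E.
  rewrite big_split /= [X in X + _]big_split /= [X in X + _ + _]big_split /=.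
  rewrite odd0 sum_cst -mulr_sumr -/G /rho /s2.
  by field; rewrite gt_eqF.
have rhoB : `|rho| <= tau * (n * C0 * s1).
  rewrite /rho normrM (gtr0_norm (_ : 0 < n^-1)) ?invr_gt0 // mulrC ler_pdivrMr //.
  have -> : tau * (n * C0 * s1) * n = (s1 ^+ 3 * C0) * n.
    by rewrite exprSr s1E /s2; ring.
  rewrite -sum_cst; apply: (le_trans (ler_norm_sum _ _ _)); apply: ler_sum => k _.
  exact: rem_le.
have avgB : `|avg - phi x| <= 2 * M * K ^+ 2 * s1.
  have -> : avg - phi x = n^-1 * \sum_(k : signed_index d1) (phi (x + t k *: ell D k) - phi x).
    by rewrite sumrB sum_cst /avg; field; rewrite gt_eqF.
  rewrite normrM (gtr0_norm (_ : 0 < n^-1)) ?invr_gt0 // mulrC ler_pdivrMr // -sum_cst.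
  apply: (le_trans (ler_norm_sum _ _ _)); apply: ler_sum => k _.
  apply: (le_trans (lphi _ _)); rewrite addrC addKr enormZ.
  have -> : 2 * M * K ^+ 2 * s1 = M * (2 * K * s1 * K) by ring.
  by rewrite ler_wpM2l // ler_pM ?enorm_ge0 // (ell_le sa).
have c0 : 0 <= c_coef D al x <= lambda + K.
  have [+ _] := c_bl sa al => /(_ x); rewrite ler_norml => /andP[_ ?].
  have := c_ge sa al x; have := lambda_ge1; move=> ? ?; apply/andP; split; lra.
have -> : SL D tau al x phi x - phi x - tau * (L_op D al phi x + f_coef D al x)
   = rho - tau * (c_coef D al x * (avg - phi x)).
  have -> : SL D tau al x phi x = (1 - tau * c_coef D al x) * avg + tau * f_coef D al x by [].
  have -> : L_op D al phi x = G - c_coef D al x * phi x by rewrite /L_op /G big_split.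
  have -> : rho = avg - phi x - tau * G by rewrite avgE; ring.
  ring.
apply: (le_trans (ler_normB _ _)).
rewrite [`|tau * _|]normrM (gtr0_norm tau0).
have : tau * `|c_coef D al x * (avg - phi x)| <= tau * ((lambda + K) * (2 * M * K ^+ 2 * s1)).
  case/andP: c0 => c0 cl.
  by rewrite ler_pM2l // normrM ger0_norm // ler_pM.
rewrite /SL_const -/C0.
have -> : tau * ((n * C0 + 2 * (lambda + K) * M * K ^+ 2) * s1) =
  tau * (n * C0 * s1) + tau * ((lambda + K) * (2 * M * K ^+ 2 * s1)) by ring.
by move=> ?; apply: lerD.
Qed.
End LowerBound.

(** * Estimates for the two switching systems *)

Section SwitchingApproximation.
Variables (R : realType) (d d1 : nat) (A : metricType R).
Variables (D : coefficients d d1 A) (K lambda : R).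
Hypotheses (sa : standing_assumptions K lambda D) (K_ge1 : 1 <= K).
Hypothesis lambda_ge1 : 1 <= lambda.
Hypotheses (d_gt0 : (0 < d)%N) (d1_gt0 : (0 < d1)%N).
Implicit Types (x y l : 'rV[R]_d) (u v phi : 'rV[R]_d -> R) (al be : A).

Local Notation I := (bool * 'I_d1)%type.
Let n : R := #|{: I}|%:R.
Let M : R := 2 * K * (K + 1).

Hypothesis lambda_big : 6 * n * K ^+ 4 + 1 <= lambda.

Let K_ge0 : 0 <= K. Proof. exact: le_trans ler01 K_ge1. Qed.
Let M_ge0 : 0 <= M. Proof. by rewrite !mulr_ge0 // addr_ge0. Qed.
Let n_gt0 : 0 < n. Proof. exact: card_signed_gt0. Qed.

Section fixed_time_step.
Variable tau : R.
Hypotheses (tau_gt0 : 0 < tau) (tau_n : n * tau <= 1) (tau_c : tau * (lambda + K) <= 1).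

(** [doubling] of the system with itself: the two displacements are equal, so [rho] may tend to
    0. *)
Lemma system_lip (u : A -> 'rV[R]_d -> R) : (forall al x, `|u al x| <= K) ->
  (forall al x y eta, 0 < eta -> exists be e (p : R),
     u al x <= SL D tau be (x + e) (u be) x - p + eta /\
     SL D tau be (y + e) (u be) y - p <= u al y + eta) ->
  forall al, lip M (u al).
Proof.
move=> uK H.
have half al x y : u al x - u al y <= M * enorm (x - y).
  apply/ler_addgt0Pr => eps eps0.
  pose rho := eps / (M + 1).
  have M1 : 0 < M + 1 by rewrite ltr_wpDl.
  have rho0 : 0 < rho by rewrite divr_gt0.
  have Mrho : M * rho <= eps.
    have -> : eps = (M + 1) * rho by rewrite /rho; field; rewrite gt_eqF.
    by rewrite ler_pM2r // lerDl.
  have := doubling sa K_ge1 d1_gt0 tau_gt0 tau_n tau_c rho0 uK uK lambda_big _ al x y.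
  move=> /(_ _)/le_trans; apply.
    move=> al' x' y' eta eta0; have [be [e [p [h1 h2]]]] := H al' x' y' eta eta0.
    exists be, e, e, p; split => //.
    by rewrite subrr /sqn big1 ?sqr_ge0 // => i _; rewrite mxE expr0n.
  rewrite -/M; apply: (@le_trans _ _ (M * (enorm (x - y) + rho))); last by rewrite mulrDr lerD2l.
  rewrite ler_wpM2l // -(@ler_pXn2r _ 2) ?nnegrE ?sqrtr_ge0 ?addr_ge0 ?enorm_ge0 ?(ltW rho0) //.
  rewrite sqr_sqrtr ?addr_ge0 ?sqn_ge0 ?sqr_ge0 // -enorm_sqr sqrrD.
  rewrite -addrA lerD2l lerDr; by rewrite mulrn_wge0 // mulr_ge0 ?enorm_ge0 // ltW.
move=> al x y; rewrite ler_norml; apply/andP; split; last exact: half.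
by have := half al y x; rewrite enormB; lra.
Qed.

Section systems.
Variables (kappa rho1 rho2 : R) (us ui : A -> 'rV[R]_d -> R).
Hypotheses (kappa_gt0 : 0 < kappa) (rho1_gt0 : 0 < rho1) (rho2_gt0 : 0 < rho2).
Hypothesis us_le : forall al x, `|us al x| <= K.
Hypothesis us_sub : forall al x eta, 0 < eta -> exists be, exists e : ball_of d rho1,
  us al x <= SL D tau be (x + sval e) (us be) x - switch_cost kappa al be + eta.
Hypothesis us_super : forall al x be (e : ball_of d rho1),
  SL D tau be (x + sval e) (us be) x - switch_cost kappa al be <= us al x.
Hypothesis ui_le : forall al x, `|ui al x| <= K.
Hypothesis ui_sub : forall al x eta, 0 < eta -> exists be, forall e : ball_of d rho2,
  ui al x <= SL D tau be (x + sval e) (ui be) x - switch_cost kappa al be + eta.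
Hypothesis ui_super : forall al x be eta, 0 < eta -> exists e : ball_of d rho2,
  SL D tau be (x + sval e) (ui be) x - switch_cost kappa al be <= ui al x + eta.

Lemma sup_system_lip al : lip M (us al).
Proof.
apply: system_lip => // al' x y eta eta0.
have [be [e he]] := us_sub al' x eta0.
exists be, (sval e), (switch_cost kappa al' be); split => //.
by apply: (le_trans (us_super al' y be e)); rewrite lerDl ltW.
Qed.

(** The control is the maximizer's choice at [x], the displacement the minimizer's reply to it at
    [y]; the same pair is then used at both points. *)
Lemma inf_system_lip al : lip M (ui al).
Proof.
apply: system_lip => // al' x y eta eta0.
have [be hbe] := ui_sub al' x eta0; have [e he] := ui_super al' y be eta0.
by exists be, (sval e), (switch_cost kappa al' be).
Qed.

Lemma sup_system_le_inf_system al x : us al x <= ui al x + M * (2 * (rho1 + rho2)).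
Proof.
have r0 : 0 < 2 * (rho1 + rho2) by rewrite mulr_gt0 // addr_gt0.
have := doubling sa K_ge1 d1_gt0 tau_gt0 tau_n tau_c r0 us_le ui_le lambda_big _ al x x.
rewrite subrr [sqn 0](_ : _ = 0); last by rewrite /sqn big1 // => i _; rewrite mxE expr0n.
rewrite add0r sqrtr_sqr (gtr0_norm r0) -/M => H; rewrite -lerBlDl; apply: H.
move=> al' x' y' eta eta0; have [be [e he]] := us_sub al' x' eta0.
have [e' he'] := ui_super al' y' be eta0.
exists be, (sval e), (sval e'), (switch_cost kappa al' be); split => //.
have sqe (r : R) (z : ball_of d r) : 0 < r -> sqn (sval z) <= r ^+ 2.
  move=> rp; rewrite -enorm_sqr lerXn2r ?nnegrE ?enorm_ge0 ?(ltW rp) //; exact: (svalP z).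
apply: (le_trans (sqnD _ _)).
rewrite (_ : sqn (- sval e') = sqn (sval e')); last first.
  by rewrite -!enorm_sqr enormN.
have := sqe _ e rho1_gt0; have := sqe _ e' rho2_gt0.
have : 0 <= rho1 * rho2 by rewrite mulr_ge0 // ltW.
have := sqr_ge0 rho1; have := sqr_ge0 rho2.
nra.
Qed.

(** Whatever [ga] is good for [al] is also open to [be], at an extra cost of at most [kappa]. *)
Lemma sup_system_switch al be x : us al x <= us be x + kappa.
Proof.
apply/ler_addgt0Pr => eta eta0; have [ga [e he]] := us_sub al x eta0.
have := us_super be x ga e.
have : 0 <= switch_cost kappa al ga by rewrite /switch_cost; case: asboolP => // _; exact: ltW.
have : switch_cost kappa be ga <= kappa by rewrite /switch_cost; case: asboolP => // _; exact: ltW.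
lra.
Qed.

Let cost0 al : switch_cost kappa al al = 0.
Proof. by rewrite /switch_cost asboolT. Qed.

Lemma sup_system_shaken al x z : enorm z <= rho1 -> SL D tau al x (us al) (x + z) <= us al (x + z).
Proof.
rewrite -enormN => zr; have := us_super al (x + z) al (exist _ (- z) zr).
by rewrite cost0 subr0 /= addrK.
Qed.

(** Switching to another index costs [kappa] and gains at most [gap], so the good control must be
    [al] itself; its inequality then holds for every displacement, in particular for [- z]. *)
Lemma inf_system_shaken al x z (gap : R) : gap < kappa -> enorm z <= rho2 ->
  (forall be, ui be (x + z) <= ui al (x + z) + gap) ->
  ui al (x + z) <= SL D tau al x (ui al) (x + z).
Proof.
rewrite -enormN => gk zr Hmax; apply/ler_addgt0Pr => eps eps0.
pose eta := Num.min eps ((kappa - gap) / 4).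
have kg : 0 < (kappa - gap) / 4 by lra.
have eta0 : 0 < eta by rewrite /eta lt_min eps0.
have eta1 : eta <= eps by rewrite /eta ge_min lexx.
have eta2 : eta <= (kappa - gap) / 4 by rewrite /eta ge_min lexx orbT.
have [be Hbe] := ui_sub al (x + z) eta0.
have [bal|bal] := pselect (be = al).
  subst be; have := Hbe (exist _ (- z) zr); rewrite cost0 subr0 /= addrK; lra.
have [e He] := ui_super be (x + z) be eta0.
have := Hbe e; rewrite cost0 in He; rewrite /switch_cost asboolF //.
by have := Hmax be; lra.
Qed.
End systems.
End fixed_time_step.

Lemma SL_expand (tau : R) al x u z : SL D tau al x u z - u z =
  \sum_(k : I) ((1 - tau * c_coef D al x) * n^-1) * u (z + step D tau al k x *: ell D k)
  + (-1) * u z + tau * f_coef D al x.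
Proof. by rewrite /SL -mulr_sumr -/n; ring. Qed.

Lemma mollify_SL_le (tau e : R) al x u : 0 < e -> lip M u ->
  (forall z, enorm z <= radius d e -> SL D tau al x u (x + z) <= u (x + z)) ->
  SL D tau al x (mollify e u) x <= mollify e u x.
Proof.
move=> e0 lu H; rewrite -subr_le0 SL_expand; apply: (mol_ineq e0 lu) => z /box_radius zr.
by rewrite -SL_expand subr_le0; exact: H.
Qed.

Lemma mollify_SL_ge (tau e : R) al x u : 0 < e -> lip M u ->
  (forall z, enorm z <= radius d e -> u (x + z) <= SL D tau al x u (x + z)) ->
  mollify e u x <= SL D tau al x (mollify e u) x.
Proof.
move=> e0 lu H.
pose p := - ((1 - tau * c_coef D al x) * n^-1).
have E w z : w z - SL D tau al x w z = \sum_(k : I) p * w (z + step D tau al k x *: ell D k)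
   + 1 * w z + - (tau * f_coef D al x).
  rewrite -opprB SL_expand /p.
  under [X in _ = X + _ + _]eq_bigr do rewrite mulNr.
  by rewrite sumrN; ring.
rewrite -subr_le0 E; apply: (mol_ineq e0 lu) => z /box_radius zr.
by rewrite -E subr_le0; exact: H.
Qed.

Lemma SL_const_ge0 (B2 B3 M' : R) : 0 <= B2 -> 0 <= B3 -> 0 <= M' -> 0 <= SL_const d d1 K lambda B2 B3 M'.
Proof.
move=> ? ? ?; have la0 : 0 <= lambda := le_trans ler01 lambda_ge1.
have La0 : 0 <= d%:R * K by rewrite mulr_ge0.
rewrite /SL_const addr_ge0 //.
  by rewrite mulr_ge0 ?(ltW n_gt0) // addr_ge0 // !mulr_ge0 ?exprn_ge0.
by rewrite !mulr_ge0 ?exprn_ge0 // addr_ge0.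
Qed.

Lemma mollify_le_add (e kappa : R) u w : 0 < e -> lip M u -> lip M w ->
  (forall x, u x <= w x + kappa) -> forall x, mollify e u x <= mollify e w x + kappa.
Proof.
move=> e0 lu lw H x.
have := mol_le (s := four_copies d) (x := x) e0 lu (lipD lw (lip_cst kappa)) (fun z _ => H (x + z)).
by rewrite (molD _ _ lw (lip_cst kappa)) ?mol_cst.
Qed.
End SwitchingApproximation.

(** * Choice of the parameters and the lower bound *)

Section LowerBoundProof.
Variables (R : realType) (d d1 : nat) (A : metricType R).
Variables (D : coefficients d d1 A) (K lambda : R).
Hypotheses (sa : standing_assumptions K lambda D) (K_ge1 : 1 <= K).
Hypothesis lambda_ge1 : 1 <= lambda.
Hypotheses (d_gt0 : (0 < d)%N) (d1_gt0 : (0 < d1)%N).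
Implicit Types (x y l : 'rV[R]_d) (u v phi : 'rV[R]_d -> R) (al be : A).

Local Notation I := (bool * 'I_d1)%type.
Let n : R := #|{: I}|%:R.
Let M : R := 2 * K * (K + 1).

Hypothesis lambda_big : 6 * n * K ^+ 4 + 1 <= lambda.

Let K_ge0 : 0 <= K. Proof. exact: le_trans ler01 K_ge1. Qed.
Let M_ge0 : 0 <= M. Proof. by rewrite !mulr_ge0 // addr_ge0. Qed.
Let n_gt0 : 0 < n. Proof. exact: card_signed_gt0. Qed.

(** At fixed [h] the scheme is bounded in the supremum norm. Each component of the first system is a
    supersolution for its own control, while [scheme_comparison] wants one function for all
    controls; this lemma bridges the two. *)
Lemma scheme_perturb (h kappa : R) al u w x : 0 < h -> 0 <= kappa ->
  (forall y, `|u y - w y| <= kappa) ->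
  schemeop D h al u x <= schemeop D h al w x
    + (n * ((K ^+ 2 / h + K) / h * 2) + (lambda + K)) * kappa.
Proof.
move=> h0 kap0 uw.
pose P (k : I) := sigma_coef D al k x ^+ 2 / h + b_coef D al k x.
have -> : schemeop D h al u x = schemeop D h al w x
   + (\sum_(k : I) P k / h * ((u (x + h *: ell D k) - w (x + h *: ell D k)) - (u x - w x)))
   - c_coef D al x * (u x - w x).
  rewrite /schemeop /fd_op (_ : \sum_(k : I) P k / h * _ =
    \sum_(k : I) P k * ((u (x + h *: ell D k) - u x) / h)
    - \sum_(k : I) P k * ((w (x + h *: ell D k) - w x) / h)).
    by rewrite /P; ring.
  by rewrite -sumrB; apply: eq_bigr => k _; ring.
rewrite mulrDl addrA; apply: lerD.
  rewrite lerD2l.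
  have -> : n * ((K ^+ 2 / h + K) / h * 2) * kappa = \sum_(k : I) (K ^+ 2 / h + K) / h * (2 * kappa).
    by rewrite sumr_const -mulr_natr (_ : #|_| = #|{: I}|) -/n; [ring|exact: eq_card].
  apply: ler_sum => k _; apply: (le_trans (ler_norm _)); rewrite normrM; apply: ler_pM => //.
    have P0 : 0 <= P k by apply: addr_ge0 (b_ge0 sa _ _ _); apply: divr_ge0 (sqr_ge0 _) (ltW h0).
    rewrite ger0_norm ?ler_pM2r ?invr_gt0 //; last by apply: divr_ge0 => //; exact: ltW.
    apply: lerD; last by rewrite (le_trans (ler_norm _)) // (b_bl sa al k).1.
    rewrite ler_pM2r ?invr_gt0 // -real_normK ?num_real // lerXn2r ?nnegrE //.
    exact: (sigma_bl sa al k).1.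
  by apply: (le_trans (ler_normB _ _)); have := uw x; have := uw (x + h *: ell D k); lra.
have [+ _] := c_bl sa al => /(_ x); rewrite ler_norml => /andP[_ cK].
have cl := c_ge sa al x; have la1 := lambda_ge1.
rewrite -mulrN; apply: (le_trans (ler_norm _)); rewrite normrM normrN.
by apply: ler_pM => //; rewrite ger0_norm; lra.
Qed.

(** The multiple 3 of [M * radius d 1] is one mollification of the first system plus twice its
    radius in the comparison of the systems. The three [om] pay for the switching cost, the small
    radius and the time step. *)
Lemma lower_bound_eps (h U om : R) v vh : 0 < h -> continuous v -> (forall x, `|v x| <= U) ->
  viscosity_supersolution D v -> (forall x, `|vh x| <= U) -> fd_solution D h vh -> 0 < om ->
  forall x, vh x <= v x + (consistency_const d d1 K M + 3 * M * radius d 1) * Num.sqrt h + 3 * om.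
Proof.
move=> h0 cv vU vsuper vhU sol om0 x.
set r := Num.sqrt h; have r0 : 0 < r by rewrite sqrtr_gt0.
have la1 := lambda_ge1; have K1 := K_ge1; have K0 := K_ge0; have M0 := M_ge0; have n0 := n_gt0.
have radE (e : R) : radius d e = radius d 1 * e by rewrite /radius; ring.
have R1 : 0 < radius d (1 : R) := radius_gt0 d_gt0 ltr01.
pose Ch := n * ((K ^+ 2 / h + K) / h * 2) + (lambda + K).
have Ch0 : 0 < Ch.
  rewrite ltr_wpDl ?addr_gt0 //; try lra.
  rewrite !mulr_ge0 ?(ltW n0) ?invr_ge0 ?(ltW h0) //.
  by rewrite addr_ge0 // divr_ge0 ?sqr_ge0 // ltW.
(* The switching cost depends on [h], because the norm [Ch] of the scheme grows like h^(-2) as [h]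
   tends to 0. *)
pose kappa := om / Ch; have kappa0 : 0 < kappa by rewrite divr_gt0.
have ChK : Ch * kappa = om by rewrite /kappa; field; rewrite gt_eqF.
pose mk := Num.min kappa om.
have mk0 : 0 < mk by rewrite lt_min kappa0.
have mk1 : mk <= kappa by rewrite ge_min lexx.
have mk2 : mk <= om by rewrite ge_min lexx orbT.
have MR : 0 <= M * radius d 1 := mulr_ge0 M0 (ltW R1).
(* The 16 serves twice: [4 * (M * rho2)] must stay below [kappa / 4] in the near-maximality gap, and
   [3 * (M * rho2)] below [om] in the final sum. *)
pose e2 := mk / (16 * (M * radius d 1 + 1)).
have e20 : 0 < e2 by rewrite divr_gt0 // mulr_gt0 //; lra.
have e2E : 16 * (M * radius d 1) * e2 + 16 * e2 = mk.
  by rewrite /e2; field; rewrite gt_eqF //; lra.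
pose rho1 := radius d r; pose rho2 := radius d e2.
have rho10 : 0 < rho1 := radius_gt0 d_gt0 r0.
have rho20 : 0 < rho2 := radius_gt0 d_gt0 e20.
have Mrho2 : 16 * (M * rho2) <= mk by rewrite /rho2 radE; lra.
pose C1 := SL_const d d1 K lambda (M / r) (M / r ^+ 2) M.
pose C2 := SL_const d d1 K lambda (M / e2) (M / e2 ^+ 2) M.
have C10 : 0 <= C1.
  by apply: (SL_const_ge0 d K_ge1 lambda_ge1 d1_gt0) => //; rewrite divr_ge0 ?exprn_ge0 // ltW.
have C20 : 0 <= C2.
  by apply: (SL_const_ge0 d K_ge1 lambda_ge1 d1_gt0) => //; rewrite divr_ge0 ?exprn_ge0 // ltW.
pose q := om / (C1 + C2 + 1).
have q0 : 0 < q by rewrite divr_gt0 //; lra.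
have qE : (C1 + C2) * q <= om.
  have -> : om = (C1 + C2 + 1) * q by rewrite /q; field; rewrite gt_eqF //; lra.
  by rewrite ler_pM2r // lerDl.
(* Chosen last, since [C1] and [C2] depend on both mollification scales. *)
pose tau := Num.min (Num.min 1 (q ^+ 2) / n) (lambda + K)^-1.
have laK : 0 < lambda + K by lra.
have tau0 : 0 < tau by rewrite lt_min divr_gt0 ?invr_gt0 // lt_min ltr01 exprn_gt0.
have ntau' : n * tau <= Num.min 1 (q ^+ 2).
  by rewrite mulrC -ler_pdivlMr // ge_min lexx.
have ntau : n * tau <= 1 by apply: (le_trans ntau'); rewrite ge_min lexx.
have tauc : tau * (lambda + K) <= 1.
  by rewrite -ler_pdivlMr // mul1r ge_min lexx orbT.
have sq : Num.sqrt (n * tau) <= q.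
  rewrite -[q]ger0_norm ?(ltW q0) // -sqrtr_sqr ler_wsqrtr //.
  by apply: (le_trans ntau'); rewrite ge_min lexx orbT.
have sq0 : 0 <= Num.sqrt (n * tau) := sqrtr_ge0 _.
have [us [usK us_sub us_super]] := switching_sup sa K_ge1 d1_gt0 tau0 tauc lambda_ge1 (ltW kappa0) (ltW rho10).
have [ui [uiK ui_sub ui_super]] := switching_inf sa K_ge1 d1_gt0 tau0 tauc lambda_ge1 (ltW kappa0) (ltW rho20).
have lus := sup_system_lip sa K_ge1 d1_gt0 lambda_big tau0 ntau tauc usK us_sub us_super.
have lui := inf_system_lip sa K_ge1 d1_gt0 lambda_big tau0 ntau tauc uiK ui_sub ui_super.
have usui := sup_system_le_inf_system sa K_ge1 d1_gt0 lambda_big tau0 ntau tauc rho10 rho20 usK us_sub uiK ui_super.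
have ussw := sup_system_switch kappa0 us_sub us_super.
have [al0 _] := fd_solution_sub sa h0 sol 0 ltr01.
pose ps al := mollify r (us al); pose pi al := mollify e2 (ui al).
have dps al y : `|ps al y - us al y| <= M * rho1 := mollify_dist y r0 M0 (lus al).
have dpi al y : `|pi al y - ui al y| <= M * rho2 := mollify_dist y e20 M0 (lui al).
have psK al y : `|ps al y| <= K by apply: (mol_bound r0 _ _ (lus al)) => z; exact: usK.
have piK al y : `|pi al y| <= K by apply: (mol_bound e20 _ _ (lui al)) => z; exact: uiK.
have Lps al y : L_op D al (ps al) y + f_coef D al y <= C1 * Num.sqrt (n * tau).
  have H1 : SL D tau al y (ps al) y <= ps al y.
    apply: (mollify_SL_le r0 (lus al)) => z zr.
    exact: (sup_system_shaken (kappa := kappa) us_super).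
  have := SL_consistent sa K_ge1 lambda_ge1 d1_gt0 al y tau0 ntau (divr_ge0 M0 (ltW r0))
    (divr_ge0 M0 (exprn_ge0 2 (ltW r0))) M0
    (mollify_smooth r0 M0 (lus al) (isT : (1 < 4)%N)) (mollify_smooth r0 M0 (lus al) (isT : (2 < 4)%N))
    (mol_lip r0 (four_copies d) (lus al)).
  rewrite -/C1 ler_norml => /andP[H2 _].
  rewrite -(ler_pM2l tau0); move: H1 H2; rewrite /ps; lra.
have vh_ps al y : vh y <= ps al y + (consistency_const d d1 K M * r + C1 * Num.sqrt (n * tau) + om).
  have E0 : 0 <= consistency_const d d1 K M * r + C1 * Num.sqrt (n * tau) + om.
    have := mulr_ge0 (consistency_const_ge0 d d1 K_ge1 M0) (ltW r0).
    have := mulr_ge0 C10 sq0; lra.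
  apply: (scheme_comparison (U := U + K) sa K_ge1 lambda_ge1 h0 E0).
  - by move=> z; rewrite (le_trans (vhU z)) // lerDl.
  - by move=> z; rewrite (le_trans (psK al z)) // lerDr (le_trans _ (vU 0)).
  - exact: (fd_solution_sub sa h0 sol).
  move=> be z.
  (* Hence [ps al] may replace [ps be] in the inequality of the control [be], at the price
     [Ch * kappa = om]. *)
  have pert t : `|ps al t - ps be t| <= kappa.
    have h1 := mollify_le_add r0 (lus al) (lus be) (ussw al be) t.
    have h2 := mollify_le_add r0 (lus be) (lus al) (ussw be al) t.
    by rewrite ler_norml; apply/andP; split; rewrite /ps; lra.
  apply: (le_trans (scheme_perturb be z h0 (ltW kappa0) pert)).
  rewrite -/Ch ChK lerD2r -(Lh_opE sa) //.
  have sm2 : smooth 2 (M / r) (ps be) by rewrite -[r]expr1; exact: mollify_smooth.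
  have sm4 : smooth 4 (M / r ^+ 3) (ps be) by exact: mollify_smooth.
  have := scheme_consistent sa K_ge1 be z h0 M0 sm2 sm4; rewrite -/r ler_norml => /andP[H3 _].
  by have := Lps be z; lra.
have d00 : 0 < kappa / 4 by rewrite divr_gt0.
have Lpi al y : (forall be, pi be y <= pi al y + kappa / 4) ->
    - (C2 * Num.sqrt (n * tau)) <= L_op D al (pi al) y + f_coef D al y.
  move=> near_max.
  have H1 : pi al y <= SL D tau al y (pi al) y.
    apply: (mollify_SL_ge e20 (lui al)) => z zr.
    (* Four changes of at most [M * rho2]: mollification and displacement, each for [be] and for
       [al]. *)
    apply: (inf_system_shaken ui_sub ui_super (gap := kappa / 4 + 4 * (M * rho2))) => //.
      by have : mk <= kappa := mk1; lra.
    move=> be; have zM ga : `|ui ga (y + z) - ui ga y| <= M * rho2.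
      by rewrite (le_trans (lui ga _ _)) // [y + z]addrC addrK ler_wpM2l.
    have := near_max be; have := dpi be y; have := dpi al y; have := zM al; have := zM be.
    rewrite !ler_norml => /andP[? ?] /andP[? ?] /andP[? ?] /andP[? ?]; lra.
  have := SL_consistent sa K_ge1 lambda_ge1 d1_gt0 al y tau0 ntau (divr_ge0 M0 (ltW e20))
    (divr_ge0 M0 (exprn_ge0 2 (ltW e20))) M0
    (mollify_smooth e20 M0 (lui al) (isT : (1 < 4)%N)) (mollify_smooth e20 M0 (lui al) (isT : (2 < 4)%N))
    (mol_lip e20 (four_copies d) (lui al)).
  rewrite -/C2 ler_norml => /andP[_ H2].
  rewrite -(ler_pM2l tau0); move: H1 H2; rewrite /pi; lra.
have C2s0 : 0 <= C2 * Num.sqrt (n * tau) by rewrite mulr_ge0.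
have vUK y : `|v y| <= U + K by rewrite (le_trans (vU y)) // lerDl.
have piUK al y : `|pi al y| <= U + K by rewrite (le_trans (piK al y)) // lerDr (le_trans _ (vU 0)).
have := viscosity_supersolution_ge sa K_ge1 lambda_ge1 cv vUK vsuper
  (fun al => mollify_smooth e20 M0 (lui al) (isT : (1 < 4)%N)) piUK C2s0 d00 Lpi al0 x.
have : C2 * Num.sqrt (n * tau) / lambda <= C2 * Num.sqrt (n * tau).
  by rewrite ler_pdivrMr ?(lt_le_trans ltr01 la1) // ler_peMr.
have : (C1 + C2) * Num.sqrt (n * tau) <= om.
  by apply: le_trans qE; rewrite ler_wpM2l // addr_ge0.
have := vh_ps al0 x; have := usui al0 x; have := dps al0 x; have := dpi al0 x.
rewrite !ler_norml => /andP[? _] /andP[_ ?].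
have : M * rho1 = M * radius d 1 * r by rewrite /rho1 radE mulrA.
rewrite -/M -/(pi al0); lra.
Qed.

Lemma lower_bound (h U : R) v vh : 0 < h -> continuous v -> (forall x, `|v x| <= U) ->
  viscosity_supersolution D v -> (forall x, `|vh x| <= U) -> fd_solution D h vh ->
  forall x, vh x <= v x + (consistency_const d d1 K M + 3 * M * radius d 1) * Num.sqrt h.
Proof.
move=> h0 cv vU vsuper vhU sol x; apply/ler_addgt0Pr => eps eps0.
have om0 : 0 < eps / 3 by rewrite divr_gt0.
apply: (le_trans (lower_bound_eps h0 cv vU vsuper vhU sol om0 x)).
by rewrite lerD2l mulrC divfK.
Qed.
End LowerBoundProof.

Theorem theorem2p3 (R : realType) (d1 : nat) (K : R)
    (hd1 : (1 <= d1)%N) (hK : 1 <= K) :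
  exists N2 : R, forall d : nat, (1 <= d)%N ->
  exists N : R, forall (A : metricType R) (lambda : R)
    (D : coefficients d d1 A),
    separable A -> 0 <= lambda -> standing_assumptions K lambda D ->
    N2 <= lambda ->
    forall vt : 'rV[R]_d -> R,
      bounded_fun vt -> viscosity_solution D vt ->
    forall (h : R) (vth : 'rV[R]_d -> R),
      0 < h -> bounded_fun vth -> fd_solution D h vth ->
    forall x : 'rV[R]_d, `|vt x - vth x| <= N * Num.sqrt h.
Proof.
pose n : R := #|{: bool * 'I_d1}|%:R.
pose m : R := #|{: (bool * 'I_d1) + bool}|%:R.
have K0 : 0 <= K := le_trans ler01 hK.
pose T1 := 7 * n * m * (K ^+ 2) ^+ 2 + 4 * m * m * n * (K ^+ 2) ^+ 2.
pose T2 := 6 * n * K ^+ 4.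
have T10 : 0 <= T1 by rewrite addr_ge0 // !mulr_ge0 ?sqr_ge0.
have T20 : 0 <= T2 by rewrite !mulr_ge0 ?exprn_ge0.
(* [T1] serves the gradient estimate and [T2] the coupling; both involve only [d1] and [K]. The
   summand 1 also gives [1 <= lambda]. *)
exists (T1 + T2 + 1) => d hd.
pose Mu := m * K ^+ 2 * (K + 1); pose Ml := 2 * K * (K + 1).
pose Nu := consistency_const d d1 K Mu + 2 * Mu * radius d 1.
pose Nl := consistency_const d d1 K Ml + 3 * Ml * radius d 1.
have rad0 : 0 <= radius d (1 : R) := radius_ge0 d ler01.
have Mu0 : 0 <= Mu by rewrite !mulr_ge0 ?sqr_ge0 // addr_ge0.
have Ml0 : 0 <= Ml by rewrite !mulr_ge0 // addr_ge0.
have Nu0 : 0 <= Nu.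
  by rewrite addr_ge0 ?(consistency_const_ge0 d d1 hK Mu0) // mulr_ge0 // mulr_ge0.
have Nl0 : 0 <= Nl.
  by rewrite addr_ge0 ?(consistency_const_ge0 d d1 hK Ml0) // mulr_ge0 // mulr_ge0.
(* [d] enters through [radius d 1] and through the bound [d%:R * K] on the sum of the coordinates of
   [ell]; the bounds of [vt] and [vth] do not enter. *)
exists (Nu + Nl) => A lambda D _ _ sa Nla vt bvt [cvt vsub vsuper] h vth h0 bvth sol x.
have la1 : 1 <= lambda by lra.
have laT1 : T1 + 1 <= lambda by lra.
have laT2 : T2 + 1 <= lambda by lra.
have bd (u : 'rV[R]_d -> R) : bounded_fun u -> exists U : R, forall y, `|u y| <= U.
  move=> [B0 [_ HB]]; exists (B0 + 1) => y.
  by apply: (HB (B0 + 1)) => //; rewrite ltrDl.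
have [U1 HU1] := bd _ bvt; have [U2 HU2] := bd _ bvth.
pose U := Num.max U1 U2.
have vtU y : `|vt y| <= U by rewrite (le_trans (HU1 y)) // le_max lexx.
have vthU y : `|vth y| <= U by rewrite (le_trans (HU2 y)) // le_max lexx orbT.
have s0 := sqrtr_ge0 h.
have up := upper_bound sa hK la1 hd laT1 h0 cvt vtU vsub vthU sol x.
have lo := lower_bound sa hK la1 hd hd1 laT2 h0 cvt vtU vsuper vthU sol x.
rewrite -/Mu -/Nu in up; rewrite -/Ml -/Nl in lo.
have := mulr_ge0 Nu0 s0; have := mulr_ge0 Nl0 s0.
by rewrite ler_norml => ? ?; apply/andP; split; lra.
Qed.
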